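(* Let $(X,D)$ be a snc pair, $\mathsf{N}\subset\mathrm{Nef}(X,D)$ a convex sub-cone with non-empty interior, and $\tilde{\mathfrak m}\subset\tilde R(\mathsf N)$ the toric maximal ideal. Suppose that one of the following holds: (1) $\mathsf{N}$ is Calabi–Yau, and $H^2(X\setminus D;\mathbb{Q})=0$; (2) $\mathsf{N}$ is positive, and $X$ has minimal Chern number $\ge2$. Then $H^2(X\setminus D;\tilde{\mathfrak m})=0$.
   Context: $\Bbbk$ is a field of characteristic $0$. A snc pair $(X,D)$ is a smooth compact complex manifold $X$ with a simple normal crossings divisor $D=\bigcup_{p\in P}D_p$; it is assumed Kähler, i.e. there is an ample divisor $\sum_p\ell_pD_p$ with all $\ell_p>0$. $H^2(X,X\setminus D;\mathbb{R})\cong\mathbb{R}^P$ is identified with $\mathbb{R}$-divisors supported on $D$, and $\mathrm{Nef}(X,D)$ is the closed cone of effective nef ones. $H_2(X,X\setminus D)\cong\mathbb{Z}^P$ via $u\mapsto(u\cdot D_p)_p$. $\tilde R(\mathsf{N})=\Bbbk[\mathsf{N}^\vee\cap H_2(X,X\setminus D)]$ with monomials $r^u$ ($\mathsf N^\vee$ the dual cone); $\tilde{\mathfrak m}$ is the ideal spanned by $r^u$ with $u\ne0$. It is graded by $G=H_1(\mathcal{G}(X\setminus D))$, where $\mathcal{G}$ denotes the total space of the (unoriented) Lagrangian Grassmannian: the degree of $r^u$ is the image of $u$ under $H_2(X,X\setminus D)\cong H_2(\mathcal{G}X,\mathcal{G}(X\setminus D))\xrightarrow{\partial}H_1(\mathcal{G}(X\setminus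 D))\xrightarrow{-\mathrm{id}}H_1(\mathcal{G}(X\setminus D))$. There is a homomorphism $\mathbb{Z}\to G$ induced by inclusion of a fibre, and integer degrees are interpreted in $G$ through it. $H^2(X\setminus D;\tilde{\mathfrak m})$ denotes the degree-$2$ part of the $G$-graded vector space $H^\bullet(X\setminus D;\Bbbk)\otimes\tilde{\mathfrak m}$, where $H^i$ has degree the image of $i$ in $G$. $\mathsf{N}$ is positive if $c_1(TX)\in H^2(X;\mathbb{R})$ lies in the image of the interior of $\mathsf{N}$ under $H^2(X,X\setminus D;\mathbb{R})\to H^2(X;\mathbb{R})$; it is Calabi–Yau if $c_1(TX)$ is torsion, i.e. vanishes in $H^2(X;\mathbb{R})$. The minimal Chern number of $X$ is the non-negative generator of $c_1(TX)(H_2(X;\mathbb{Z}))\subset\mathbb{Z}$. *)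

(* Defs.v *)
From HB Require Import structures.
From mathcomp Require Import all_boot all_order all_algebra.
From mathcomp Require Import generic_quotient ring_quotient.
From mathcomp Require Import all_classical all_reals all_analysis.
From mathcomp Require Import complex freeg.
Set Implicit Arguments.
Unset Strict Implicit.
Unset Printing Implicit Defensive.
Import Order.TTheory GRing.Theory Num.Theory.
Import numFieldNormedType.Exports.
Local Open Scope classical_set_scope.
Local Open Scope quotient_scope.
Local Open Scope ring_scope.

(* The complex numbers, typed so that the analysis library finds their
   topology and their structure of normed space over themselves; in particular
   [differentiable] between spaces over [Cx R] is complex differentiability. *)
Definition Cx (R : realType) : numClosedFieldType := R[i].
Definition mkC (R : realType) (a b : R) : Cx R := (a +i* b)%C.
Definition ReC (R : realType) (z : Cx R) : R := complex.Re z.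
Definition ImC (R : realType) (z : Cx R) : R := complex.Im z.

(* For subgroups Z and B of V, [subquot Z B] is the group Z / (Z :&: B).
   [sclass] sends an element of Z to its class, [srepr] picks a
   representative. *)
Section Subquotient.
Variables (V : zmodType) (Z B : zmodClosed V).

Record zsub := ZSub { zval : V; zvalP : zval \in Z }.
HB.instance Definition _ := [isSub for zval].
HB.instance Definition _ := [Choice of zsub by <:].
HB.instance Definition _ := [SubChoice_isSubZmodule of zsub by <:].

Definition zsub_in : {pred zsub} := [pred z | zval z \in B].
Fact zsub_in_closed : zmod_closed zsub_in.
Proof.
split=> [|x y]; rewrite !inE.
  suff -> : zval (0 : zsub) = 0 by exact: rpred0.
  exact: (raddf0 (val : zsub -> V)).
move=> hx hy; suff -> : zval (x - y) = zval x - zval y by exact: rpredB.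
exact: (raddfB (val : zsub -> V)).
Qed.
HB.instance Definition _ := GRing.isZmodClosed.Build zsub zsub_in zsub_in_closed.

Definition subquot := Quotient.quot zsub_in.

Definition sclass (v : V) : subquot :=
  \pi_(Quotient.quot zsub_in) (insubd (0 : zsub) v).
Definition srepr (q : subquot) : V := zval (repr (q : Quotient.quot zsub_in)).
End Subquotient.

Definition simplex_set (R : realType) (n : nat) : set 'rV[R]_n.+1 :=
  [set t | (forall j, 0 <= t 0 j) /\ \sum_j t 0 j = 1].
Definition simplex (R : realType) (n : nat) : topologicalType :=
  set_type (@simplex_set R n).

Definition face_row (R : realType) (n : nat) (i : 'I_n.+2) (t : 'rV[R]_n.+1) :
  'rV[R]_n.+2 := \row_j (if unlift i j is Some k then t 0 k else 0).

Fact face_subproof (R : realType) (n : nat) (i : 'I_n.+2) (t : simplex R n) :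
  face_row i (\val t) \in @simplex_set R n.+1.
Proof.
case: t => t /= /set_mem [t0 t1]; apply/mem_set; split.
  by move=> j; rewrite mxE; case: unliftP.
rewrite (bigD1_ord i) //= mxE unlift_none add0r -[RHS]t1.
by apply: eq_bigr => k _; rewrite mxE liftK.
Qed.

Definition face (R : realType) (n : nat) (i : 'I_n.+2) (t : simplex R n) :
  simplex R n.+1 := exist _ (face_row i (\val t)) (face_subproof i t).

Section SingularHomology.
Variables (R : realType) (X : topologicalType).

(* Chains are formal sums of arbitrary maps from the standard simplex; a
   chain on the subspace S is one whose support consists of singular simplices
   of S, i.e. of continuous maps with values in S. *)
Definition chain (n : nat) := {freeg (simplex R n -> X) / int}.

Definition sing (n : nat) (S : set X) : set (simplex R n -> X) :=
  [set s | continuous s /\ forall t, S (s t)].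

Definition chain_on (n : nat) (S : set X) (c : chain n) : Prop :=
  forall s, coeff s c != 0 -> sing S s.

(* In degree 0 the boundary is the zero map from chain 0 to itself. *)
Definition bd (n : nat) : chain n -> chain n.-1 :=
  match n return chain n -> chain n.-1 with
  | 0 => fun=> 0
  | p.+1 => fglift (fun s : simplex R p.+1 -> X =>
              \sum_(i < p.+2) << (-1) ^+ i *g (s \o face i) >> : chain p)
  end.

Definition cycles (n : nat) (S T : set X) : {pred chain n} :=
  [pred c | `[< chain_on S c /\ chain_on T (bd c) >]].
Definition boundaries (n : nat) (S T : set X) : {pred chain n} :=
  [pred c | `[< exists (b : chain n.+1) (c' : chain n),
                 [/\ chain_on S b, chain_on T c' & c = bd b + c'] >]].

Lemma bdB n : {morph @bd n : c c' / c - c'}.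
Proof. by case: n => [|n] c c' /=; [rewrite subr0|apply: lift_is_additive]. Qed.
Lemma bd0 n : @bd n 0 = 0.
Proof. by rewrite -[0 in LHS](subrr 0) bdB subrr. Qed.
Lemma chain_on0 n S : chain_on S (0 : chain n).
Proof. by move=> s; rewrite coeff0 eqxx. Qed.
Lemma chain_onB n S (c c' : chain n) :
  chain_on S c -> chain_on S c' -> chain_on S (c - c').
Proof.
move=> hc hc' s; rewrite coeffB; have [E|+ _] := eqVneq (coeff s c) 0.
  by rewrite E sub0r oppr_eq0; exact: hc'.
exact: hc.
Qed.

Fact cycles_closed n S T : zmod_closed (@cycles n S T).
Proof.
split=> [|x y]; rewrite !inE.
  by rewrite bd0; split; exact: chain_on0.
move=> [x1 x2] [y1 y2].
by rewrite bdB; split; exact: chain_onB.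
Qed.
HB.instance Definition _ n S T :=
  GRing.isZmodClosed.Build (chain n) (@cycles n S T) (@cycles_closed n S T).

Fact boundaries_closed n S T : zmod_closed (@boundaries n S T).
Proof.
split=> [|x y]; rewrite !inE.
  exists 0, 0; rewrite bd0 addr0.
  by split=> //; exact: chain_on0.
move=> [b [c [hb hc ->]]] [b' [c' [hb' hc' ->]]].
exists (b - b'), (c - c'); rewrite bdB opprD addrACA.
by split=> //; exact: chain_onB.
Qed.
HB.instance Definition _ n S T :=
  GRing.isZmodClosed.Build (chain n) (@boundaries n S T)
    (@boundaries_closed n S T).

(* H_n(S, T; Z) for subspaces T `<=` S of X; H_n(S; Z) is [hom n S set0]. *)
Definition hom (n : nat) (S T : set X) :=
  subquot (@cycles n S T) (@boundaries n S T).

Definition hcl n S T (c : chain n) : hom n S T := sclass _ _ c.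
Definition hrep n S T (u : hom n S T) : chain n := srepr u.

(* Cochains on S are functions on all maps from the simplex, considered up to
   their values outside of [sing S]; with this identification built into
   [cocycles] and [coboundaries], the quotient is H^n(S, T; M). *)
Section Cohomology.
Variable M : zmodType.

Definition cochain (n : nat) := (simplex R n -> X) -> M.

Definition cobd (n : nat) : cochain n.-1 -> cochain n :=
  match n return cochain n.-1 -> cochain n with
  | 0 => fun _ _ => 0
  | p.+1 => fun f s => \sum_(i < p.+2) f (s \o face i) *~ (-1) ^+ i
  end.

Definition cocycles (n : nat) (S T : set X) : {pred cochain n} :=
  [pred f | `[< (forall s, sing T s -> f s = 0) /\
                (forall s, sing S s -> @cobd n.+1 f s = 0) >]].
Definition coboundaries (n : nat) (S T : set X) : {pred cochain n} :=
  [pred f | `[< exists g : cochain n.-1, (forall s, sing T s -> g s = 0) /\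
                (forall s, sing S s -> f s = @cobd n g s) >]].

Lemma cobdB n (f g : cochain n.-1) s :
  @cobd n (fun s => f s - g s) s = @cobd n f s - @cobd n g s.
Proof.
case: n f g s => [|n] f g s /=; first by rewrite subr0.
by rewrite -sumrB; apply: eq_bigr => i _; rewrite mulrzBl.
Qed.
Lemma cobd0 n s : @cobd n (fun=> 0) s = 0.
Proof. by case: n s => [|n] s //=; apply: big1 => i _; rewrite mul0rz. Qed.

Fact cocycles_closed n S T : zmod_closed (@cocycles n S T).
Proof.
split=> [|x y]; rewrite !inE.
  by split=> // s _; exact: (@cobd0 n.+1).
move=> [x1 x2] [y1 y2]; split=> s hs.
  by rewrite /GRing.add /= /GRing.opp /= x1 // y1 // subr0.
by have := @cobdB n.+1 x y s; rewrite x2 // y2 // subr0.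
Qed.
HB.instance Definition _ n S T :=
  GRing.isZmodClosed.Build (cochain n) (@cocycles n S T) (@cocycles_closed n S T).

Fact coboundaries_closed n S T : zmod_closed (@coboundaries n S T).
Proof.
split=> [|x y]; rewrite !inE.
  by exists (fun=> 0); split=> // s _; rewrite cobd0.
move=> [f [f1 f2]] [g [g1 g2]].
exists (fun s => f s - g s); split=> s hs; first by rewrite f1 // g1 // subr0.
by rewrite cobdB -f2 // -g2.
Qed.
HB.instance Definition _ n S T :=
  GRing.isZmodClosed.Build (cochain n) (@coboundaries n S T)
    (@coboundaries_closed n S T).

Definition coh (n : nat) (S T : set X) :=
  subquot (@cocycles n S T) (@coboundaries n S T).

Definition cocl n S T (f : cochain n) : coh n S T := sclass _ _ f.
Definition corep n S T (a : coh n S T) : cochain n := srepr a.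

Definition pairing n S T (a : coh n S T) (u : hom n S T) : M :=
  \sum_(s <- dom (hrep u)) corep a s *~ coeff s (hrep u).
End Cohomology.

Definition connecting n S T (u : hom n.+1 S T) : hom n T set0 :=
  hcl T set0 (bd (hrep u) : chain n).

End SingularHomology.

(* The maps below are meant for f continuous with f(S) in S' and f(T) in T'. *)
Definition push (R : realType) (X Y : topologicalType) (f : X -> Y) n
    (S T : set X) (S' T' : set Y) (u : hom R n S T) : hom R n S' T' :=
  hcl S' T' (fglift (fun s : simplex R n -> X => << f \o s >> : chain R Y n)
                    (hrep u)).
Definition pull (R : realType) (X Y : topologicalType) (f : X -> Y)
    (M : zmodType) n (S T : set X) (S' T' : set Y) (a : coh R M n S' T') :
    coh R M n S T :=
  cocl S T (fun s : simplex R n -> X => corep a (f \o s)).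

Section ComplexManifold.
Variables (R : realType) (n : nat) (X : topologicalType).

(* A chart is a homeomorphism [cmap] from the open set [cdom] onto an open set
   of C^n, with inverse [cinv]; the values of [cmap] and [cinv] outside of
   [cdom] and [ccod] are irrelevant. *)
Record chart := Chart {
  cdom : set X;
  cmap : X -> 'rV[Cx R]_n;
  cinv : 'rV[Cx R]_n -> X }.

Definition ccod (phi : chart) : set 'rV[Cx R]_n := cmap phi @` cdom phi.

Definition is_chart (phi : chart) : Prop :=
  [/\ open (cdom phi), open (ccod phi),
      {within cdom phi, continuous (cmap phi)},
      {within ccod phi, continuous (cinv phi)} &
      forall x, cdom phi x -> cinv phi (cmap phi x) = x].

Definition transition (phi psi : chart) : 'rV[Cx R]_n -> 'rV[Cx R]_n :=
  cmap psi \o cinv phi.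

Definition compatible (phi psi : chart) : Prop :=
  forall x, cdom phi x -> cdom psi x ->
    differentiable (transition phi psi) (cmap phi x).

Record complex_manifold (A : set chart) : Prop := ComplexManifold {
  cm_hausdorff : hausdorff_space X;
  cm_second_countable : @second_countable X;
  cm_chart : forall phi, A phi -> is_chart phi;
  cm_cover : forall x, exists2 phi, A phi & cdom phi x;
  cm_compatible : forall phi psi, A phi -> A psi -> compatible phi psi;
  cm_maximal : forall phi, is_chart phi ->
    (forall psi, A psi -> compatible phi psi /\ compatible psi phi) -> A phi }.

Definition compact_connected_manifold (A : set chart) : Prop :=
  [/\ complex_manifold A, compact [set: X] & connected [set: X]].

(* Tangent vectors are row vectors in each chart; the change of coordinates
   from phi to psi at x is v |-> v *m tangent_change phi psi x. *)
Definition tangent_change (phi psi : chart) (x : X) : 'M[Cx R]_n :=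
  'J (transition phi psi) (cmap phi x).

(* Positively oriented triangle around 0 in C with vertices 1, i, -1 - i. *)
Definition triangle (t : simplex R 2) : Cx R :=
  let c j := (\val t : 'rV[R]_3) 0 (inord j) in
  mkC (c 0%N - c 2%N) (c 1%N - c 2%N).

(* Small 2-simplex through x in the complex line of direction e_j. *)
Definition disc_point (phi : chart) (x : X) (j : 'I_n) (e : R)
    (t : simplex R 2) : 'rV[Cx R]_n :=
  cmap phi x + (mkC e 0 * triangle t) *: delta_mx 0 j.
Definition disc (phi : chart) (x : X) (j : 'I_n) (e : R)
    (t : simplex R 2) : X := cinv phi (disc_point phi x j e t).
Definition disc_in (phi : chart) (x : X) (j : 'I_n) (e : R) : Prop :=
  0 < e /\ forall t, ccod phi (disc_point phi x j e t).

End ComplexManifold.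

(* The fundamental class of a compact Riemann surface: its image in
   H_2(S, S \ q) is the complex orientation at q, for all q. *)
Definition fundamental_class (R : realType) (S : topologicalType)
    (A : set (chart R 1 S)) (u : hom R 2 [set: S] set0) : Prop :=
  forall phi q e, A phi -> cdom phi q -> disc_in phi q ord0 e ->
    hcl [set: S] (~` [set q]) (hrep u)
    = hcl [set: S] (~` [set q])
        (<< (disc phi q ord0 e : simplex R 2 -> S) >> : chain R S 2).

Definition holomorphic_map (R : realType) (m n : nat) (Y X : topologicalType)
    (B : set (chart R m Y)) (A : set (chart R n X)) (f : Y -> X) : Prop :=
  continuous f /\
  forall phi psi y, B phi -> A psi -> cdom phi y -> cdom psi (f y) ->
    differentiable (cmap psi \o f \o cinv phi) (cmap phi y).

Section SncPair.
Variables (R : realType) (n m : nat) (X : topologicalType).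
Variables (A : set (chart R n X)) (D : 'I_m -> set X).

Definition total_divisor : set X := \bigcup_p D p.

(* In the chart phi, D_p is the coordinate hyperplane z_j = 0 if
   J p = Some j, and D_p is empty if J p = None. *)
Definition adapted (phi : chart R n X) (J : 'I_m -> option 'I_n) : Prop :=
  [/\ A phi,
      forall p x, cdom phi x ->
        D p x <-> (if J p is Some j then cmap phi x 0 j = 0 else False) &
      forall p q j, J p = Some j -> J q = Some j -> p = q].

Definition snc_divisor : Prop :=
  (forall p, D p !=set0 /\ connected (D p)) /\
  (forall x, exists phi J, adapted phi J /\ cdom phi x).

(* \sum_p l_p D_p is ample: for some k > 0 there are sections s_0, ..., s_N of
   O(k \sum_p l_p D_p), given as functions on X \ D with poles along D, that
   embed X in projective space. F phi J is the expression of (s_0, ..., s_N)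
   in the local trivialization of the line bundle over an adapted chart. *)
Definition ample (l : 'I_m -> nat) : Prop :=
  exists (k N : nat) (s : X -> 'rV[Cx R]_N.+1)
         (F : chart R n X -> ('I_m -> option 'I_n) ->
              'rV[Cx R]_n -> 'rV[Cx R]_N.+1),
  (0 < k)%N /\
  (forall phi J x, adapted phi J -> cdom phi x ->
     let z := cmap phi x in
     [/\ differentiable (F phi J) z,
         ~ total_divisor x ->
           F phi J z = (\prod_p (if J p is Some j then z 0 j ^+ (k * l p)
                                 else 1)) *: s x,
         F phi J z != 0 &
         forall (v : 'rV[Cx R]_n) (c : Cx R),
           'd (F phi J) z v = c *: F phi J z -> v = 0]) /\
  (forall phi J x phi' J' x' (c : Cx R),
     adapted phi J -> cdom phi x -> adapted phi' J' -> cdom phi' x' ->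
     F phi J (cmap phi x) = c *: F phi' J' (cmap phi' x') -> x = x').

Definition snc_pair : Prop :=
  [/\ compact_connected_manifold A, snc_divisor &
      exists l : 'I_m -> nat, (forall p, (0 < l p)%N) /\ ample l].

(* The class in H^2(X, X \ D_p) dual to D_p, i.e. the Thom class of its normal
   bundle: it is characterized by taking the value 1 on each small disc
   transverse to D_p with its complex orientation. *)
Definition thom_divisor (p : 'I_m)
    (tau : coh R int 2 [set: X] (~` D p)) : Prop :=
  forall phi j x e, A phi ->
    (forall y, cdom phi y -> D p y <-> cmap phi y 0 j = 0) ->
    cdom phi x -> D p x -> disc_in phi x j e ->
    pairing tau (hcl [set: X] (~` D p)
      (<< (disc phi x j e : simplex R 2 -> X) >> : chain R X 2)) = 1.

Variable tau : forall p, coh R int 2 [set: X] (~` D p).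

Definition intersection (S : set X) (u : hom R 2 [set: X] S) (p : 'I_m) : int :=
  pairing (tau p) (push id [set: X] (~` D p) u).

(* The class in H^2(X, X \ D; R) of the R-divisor \sum_p a_p D_p. *)
Definition divisor_class (a : 'rV[R]_m) :
    coh R R 2 [set: X] (~` total_divisor) :=
  cocl [set: X] (~` total_divisor) (fun s : simplex R 2 -> X =>
    \sum_p a 0 p * (corep (tau p) s)%:~R).

(* Nef(X, D); the intersection number with a curve is computed on its
   normalization. *)
Definition nef_cone : set 'rV[R]_m :=
  [set a | (forall p, 0 <= a 0 p) /\
    forall (S : topologicalType) (B : set (chart R 1 S)) (f : S -> X)
           (u : hom R 2 [set: S] set0),
      compact_connected_manifold B -> holomorphic_map B A f ->
      fundamental_class B u ->
      0 <= \sum_p a 0 p * (intersection (push f [set: X] set0 u) p)%:~R].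

End SncPair.

Section DeterminantBundle.
Variables (R : realType) (n : nat) (X : topologicalType).
Variable (A : set (chart R n X)).

Record det_bundle := DetBundle {
  dbase : X;
  dcoord : chart R n X -> Cx R;
  dchange : forall phi psi, A phi -> A psi ->
    cdom phi dbase -> cdom psi dbase ->
    dcoord psi = \det (tangent_change phi psi dbase) * dcoord phi;
  dout : forall phi, ~ (A phi /\ cdom phi dbase) -> dcoord phi = 0 }.

HB.instance Definition _ := gen_eqMixin det_bundle.
HB.instance Definition _ := gen_choiceMixin det_bundle.

(* W is open iff it is so in each local trivialization. *)
Definition det_open (W : set det_bundle) : Prop :=
  forall g, W g -> forall phi, A phi -> cdom phi (dbase g) ->
    \forall y \near ((dbase g, dcoord g phi) : (X * Cx R)%type),
      forall g', dbase g' = y.1 -> dcoord g' phi = y.2 -> W g'.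

Fact det_openT : det_open [set: det_bundle].
Proof. by move=> g _ phi _ _; apply: filterS filterT. Qed.
Fact det_openI : setI_closed det_open.
Proof.
move=> U V oU oV g [Ug Vg] phi Aphi xphi.
have hU := oU g Ug phi Aphi xphi; have hV := oV g Vg phi Aphi xphi.
near=> y => g' e1 e2; split; move: g' e1 e2; near: y; [exact: hU|exact: hV].
Unshelve. all: by end_near. Qed.
Fact det_openU (I : Type) (f : I -> set det_bundle) :
  (forall i, det_open (f i)) -> det_open (\bigcup_i f i).
Proof.
move=> of_ g [i _ fig] phi Aphi xphi.
have := of_ i g fig phi Aphi xphi.
by apply: filterS => y h g' e1 e2; exists i => //; exact: h.
Qed.
HB.instance Definition _ :=
  isOpenTopological.Build det_bundle det_openT det_openI det_openU.

Fact zero_change (x : X) phi psi : A phi -> A psi ->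
  cdom phi x -> cdom psi x -> 0 = \det (tangent_change phi psi x) * 0 :> Cx R.
Proof. by rewrite mulr0. Qed.

Definition zero_section (x : X) : det_bundle :=
  @DetBundle x (fun=> 0) (@zero_change x) (fun _ _ => erefl).

Definition det_nonzero : set det_bundle := ~` (range zero_section).

(* The Thom class of det TX: it takes the value 1 on the complex orientation
   of each fibre. *)
Definition thom_det (tau : coh R int 2 [set: det_bundle] det_nonzero) : Prop :=
  forall (phi : chart R n X) (x : X) (s : simplex R 2 -> det_bundle),
    A phi -> cdom phi x ->
    (forall t, dbase (s t) = x /\ dcoord (s t) phi = triangle t) ->
    pairing tau (hcl [set: det_bundle] det_nonzero
                   (<< s >> : chain R det_bundle 2)) = 1.

(* c1(TX) = c1(det TX) is the Euler class of det TX; there is exactly one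
   such c, since the Thom class exists and is unique. *)
Definition first_chern (c : coh R int 2 [set: X] set0) : Prop :=
  exists2 tau, thom_det tau & c = pull zero_section [set: X] set0 tau.

End DeterminantBundle.

Section Lagrangian.
Variables (R : realType) (n : nat) (X : topologicalType).
Variable (A : set (chart R n X)).

Definition adjoint (p q : nat) (M : 'M[Cx R]_(p, q)) : 'M[Cx R]_(q, p) :=
  map_mx Num.conj M^T.

Definition cplx (w : 'rV[R]_(n + n)) : 'rV[Cx R]_n :=
  \row_j mkC (lsubmx w 0 j) (rsubmx w 0 j).
Definition decplx (z : 'rV[Cx R]_n) : 'rV[R]_(n + n) :=
  row_mx (\row_j ReC (z 0 j)) (\row_j ImC (z 0 j)).

Fixpoint Ck (k : nat) (U : set 'rV[R]_(n + n)) (f : 'rV[R]_(n + n) -> R) :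
    Prop :=
  match k with
  | 0 => forall w, U w -> {for w, continuous f}
  | k'.+1 => (forall w, U w -> differentiable f w) /\
             (forall v, Ck k' U (fun w => 'd f w v))
  end.
Definition smooth U f := forall k, Ck k U f.

(* A Hermitian metric, given by its matrix in each chart, as a function of the
   point of X: <v, w> = v *m h phi x *m adjoint w. *)
Definition metric := chart R n X -> X -> 'M[Cx R]_n.

Variable h : metric.

Definition re_coef (phi : chart R n X) (j k : 'I_n) (w : 'rV[R]_(n + n)) : R :=
  ReC (h phi (cinv phi (cplx w)) j k).
Definition im_coef (phi : chart R n X) (j k : 'I_n) (w : 'rV[R]_(n + n)) : R :=
  ImC (h phi (cinv phi (cplx w)) j k).

Definition wirtinger (phi : chart R n X) (l j k : 'I_n) (x : X) : Cx R :=
  let w := decplx (cmap phi x) in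
  let dx : 'rV[R]_(n + n) := delta_mx 0 (lshift n l) in
  let dy : 'rV[R]_(n + n) := delta_mx 0 (rshift n l) in
  mkC (('d (re_coef phi j k) w dx + 'd (im_coef phi j k) w dy) / 2)
      (('d (im_coef phi j k) w dx - 'd (re_coef phi j k) w dy) / 2).

(* The closedness of omega = (i/2) \sum_(j, k) h_jk dz_j /\ dbar z_k amounts to
   d h_jk / d z_l = d h_lk / d z_j. *)
Record kaehler : Prop := Kaehler {
  kaehler_herm : forall phi x, A phi -> cdom phi x ->
    adjoint (h phi x) = h phi x;
  kaehler_pos : forall phi x (v : 'rV[Cx R]_n), A phi -> cdom phi x ->
    v != 0 -> 0 < (v *m h phi x *m adjoint v) 0 0;
  kaehler_change : forall phi psi x, A phi -> A psi ->
    cdom phi x -> cdom psi x ->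
    h phi x = tangent_change phi psi x *m h psi x
                *m adjoint (tangent_change phi psi x);
  kaehler_smooth : forall phi j k, A phi ->
    smooth [set w | ccod phi (cplx w)] (re_coef phi j k) /\
    smooth [set w | ccod phi (cplx w)] (im_coef phi j k);
  kaehler_closed : forall phi x l j k, A phi -> cdom phi x ->
    wirtinger phi l j k x = wirtinger phi j l k x }.

Definition realmx (p q : nat) (M : 'M[R]_(p, q)) : 'M[Cx R]_(p, q) :=
  map_mx (fun r => mkC r 0) M.

Definition rspan (F : 'M[Cx R]_n) : set 'rV[Cx R]_n :=
  [set v | exists c : 'rV[R]_n, v = realmx c *m F].

(* The rows of F are linearly independent over the reals, and omega, which is
   up to sign the imaginary part of the metric, vanishes on them. *)
Definition lagrangian_frame (phi : chart R n X) (x : X) (F : 'M[Cx R]_n) :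
    Prop :=
  (forall c : 'rV[R]_n, realmx c *m F = 0 -> c = 0) /\
  (forall j k, ImC ((F *m h phi x *m adjoint F) j k) = 0).

(* Pairs of a point of X and a Lagrangian subspace of its tangent space,
   the latter given by its image in each chart around the point. *)
Record lagr := Lagr {
  gbase : X;
  gplane : chart R n X -> set 'rV[Cx R]_n;
  gchange : forall phi psi, A phi -> A psi ->
    cdom phi gbase -> cdom psi gbase ->
    gplane psi = (fun v => v *m tangent_change phi psi gbase) @` gplane phi;
  glagr : forall phi, A phi -> cdom phi gbase ->
    exists2 F, lagrangian_frame phi gbase F & gplane phi = rspan F;
  gout : forall phi, ~ (A phi /\ cdom phi gbase) -> gplane phi = set0 }.

HB.instance Definition _ := gen_eqMixin lagr.
HB.instance Definition _ := gen_choiceMixin lagr.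

(* Quotient topology from the bundle of Lagrangian frames. *)
Definition lagr_open (W : set lagr) : Prop :=
  forall g, W g -> forall phi, A phi -> cdom phi (gbase g) ->
  forall F, lagrangian_frame phi (gbase g) F -> gplane g phi = rspan F ->
    \forall y \near ((gbase g, F) : (X * 'M[Cx R]_n)%type),
      forall g', gbase g' = y.1 -> lagrangian_frame phi y.1 y.2 ->
        gplane g' phi = rspan y.2 -> W g'.

Fact lagr_openT : lagr_open [set: lagr].
Proof. by move=> g _ phi _ _ F _ _; apply: filterS filterT. Qed.
Fact lagr_openI : setI_closed lagr_open.
Proof.
move=> U V oU oV g [Ug Vg] phi Aphi xphi F lF eF.
have hU := oU g Ug phi Aphi xphi F lF eF.
have hV := oV g Vg phi Aphi xphi F lF eF.
near=> y => g' e1 e2 e3; split; move: g' e1 e2 e3; near: y;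
  [exact: hU|exact: hV].
Unshelve. all: by end_near. Qed.
Fact lagr_openU (I : Type) (f : I -> set lagr) :
  (forall i, lagr_open (f i)) -> lagr_open (\bigcup_i f i).
Proof.
move=> of_ g [i _ fig] phi Aphi xphi F lF eF.
have := of_ i g fig phi Aphi xphi F lF eF.
by apply: filterS => y h' g' e1 e2 e3; exists i => //; exact: h'.
Qed.
HB.instance Definition _ :=
  isOpenTopological.Build lagr lagr_openT lagr_openI lagr_openU.

Definition lagr_over (S : set X) : set lagr := [set g | S (gbase g)].

(* The loop t |-> e^(i pi t) R (+) R^(n-1), t in [0, 1], of Maslov index 1, in
   the Lagrangian Grassmannian of a tangent space over S; the rows of U are a
   unitary basis of that space. *)
Definition fibre_loop (S : set X) (s : simplex R 1 -> lagr) : Prop :=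
  exists phi x (U : 'M[Cx R]_n),
    [/\ A phi, cdom phi x, S x, U *m h phi x *m adjoint U = 1%:M &
    forall t, gbase (s t) = x /\
      let a := pi * (\val t : 'rV[R]_2) 0 (inord 1) in
      gplane (s t) phi =
      rspan (diag_mx (\row_j (if val j == 0%N then mkC (cos a) (sin a) else 1))
             *m U)].

End Lagrangian.

Section Grading.
Variables (R : realType) (n m : nat) (X : topologicalType).
Variables (A : set (chart R n X)) (D : 'I_m -> set X).
Variable tau : forall p, coh R int 2 [set: X] (~` D p).
Variable h : metric R n X.

Local Notation XD := (~` total_divisor D).
Local Notation GXD := (@lagr_over R n X A h XD).

Definition grading_group := hom R 1 GXD set0.

(* Z -> G, for s a loop generating H_1 of a fibre *)
Definition grading_int (s : simplex R 1 -> lagr A h) (a : int) :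
  grading_group := hcl GXD set0 (<< s >> : chain R (lagr A h) 1) *~ a.

(* g is the degree of r^v, where v in Z^P is identified with the element u of
   H_2(X, X \ D) such that u . D_p = v_p. *)
Definition monomial_degree (v : 'rV[int]_m) (g : grading_group) : Prop :=
  exists (u : hom R 2 [set: X] XD) (w : hom R 2 [set: lagr A h] GXD),
    [/\ forall p, intersection tau u p = v 0 p,
        push (@gbase R n X A h) [set: X] XD w = u &
        g = - connecting w].

Variable N : set 'rV[R]_m.

Definition convex_cone : Prop :=
  forall (a b : R) x y, 0 < a -> 0 < b -> N x -> N y -> N (a *: x + b *: y).

Definition dual_cone : set 'rV[int]_m :=
  [set v | forall x, N x -> 0 <= \sum_p x 0 p * (v 0 p)%:~R].

(* Elements of H^*(X \ D; k) (x) m~ are written as finite sums of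
   c i v (x) r^v with c i v in H^i(X \ D; k) and v in the dual cone, v <> 0;
   this is the subspace of those of degree g. *)
Definition H_maximal_ideal (k : fieldType) (s : simplex R 1 -> lagr A h)
    (g : grading_group) : set (forall i, 'rV[int]_m -> coh R k i XD set0) :=
  [set c | [/\ finite_set [set iv : nat * 'rV[int]_m | c iv.1 iv.2 != 0],
      forall i v, c i v != 0 -> dual_cone v /\ v != 0 &
      forall i v, c i v != 0 ->
        exists2 d, monomial_degree v d & grading_int s (Posz i) + d = g]].

Variable c1 : coh R int 2 [set: X] set0.

Definition chern_real : coh R R 2 [set: X] set0 :=
  cocl [set: X] set0 (fun s : simplex R 2 -> X => (corep c1 s)%:~R).

Definition positive : Prop :=
  exists2 a, interior N a &
    chern_real = pull id [set: X] set0 (divisor_class tau a).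

Definition calabi_yau : Prop := chern_real = 0.

Definition minimal_chern_number (d : nat) : Prop :=
  forall a : int, (exists u : hom R 2 [set: X] set0, pairing c1 u = a) <->
                  (d%:Z %| a)%Z.

End Grading.

Arguments H_maximal_ideal {R n m X A D} tau {h} N k s g.

(* Main.v *)
(* Suppose that r^v has a nonzero coefficient of cohomological degree i. The
   degree of r^v is minus the boundary of a 2-chain W of Lagrangian planes, and
   the grading condition says that, after adding to W a chain over X \ D, this
   boundary is i - 2 times the loop s. Projecting W to X and capping off with
   constant simplices gives a 2-cycle Z with Z . D_p = v_p, and
                            i = 2 - 2 c_1(Z).
   Indeed a Lagrangian plane has two opposite unit lifts to det TX. Contracting
   the lifts of simplices to the zero section expresses twice the Euler cocycle
   of det TX, pulled back to Lagrangian planes, as a coboundary, and the value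
   on s of its primitive is a winding number: both lifts of s, put together,
   turn once around the origin of the fibre. Lifts exist because the
   transition functions of det TX are continuous, i.e. holomorphic maps are C^1
   (Goursat and Cauchy).
   If c_1 is torsion, then i = 2, and H^2(X \ D; k) = 0 because k is divisible.
   If N is positive, then c_1(Z) = \sum_p a_p v_p > 0 for some a in the interior
   of N, so c_1(Z) >= 2 and i < 0. *)

Require Import Defs.
From HB Require Import structures.
From mathcomp Require Import all_boot all_order all_algebra.
From mathcomp Require Import generic_quotient ring_quotient.
From mathcomp Require Import all_classical all_reals all_analysis.
From mathcomp Require Import complex freeg.
From mathcomp Require Import zify ring lra.
Import Defs.
Set Implicit Arguments.
Unset Strict Implicit.
Unset Printing Implicit Defensive.
Import Order.TTheory GRing.Theory Num.Theory numFieldNormedType.Exports.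
Local Open Scope classical_set_scope.
Local Open Scope quotient_scope.
Local Open Scope ring_scope.

(** * Subquotients, chains and cochains *)

(** Planes carry no orientation, so the sign of the determinant of a frame cannot be chosen
    continuously over a chain of planes; even the generating loop of a fibre lifts to an open path,
    from det U to its opposite. Summing over both lifts of each single path makes the result
    independent of choices, so the lifts of neighbouring simplices never have to match; the price is
    the factor 2 in front of c_1(Z). Only simplices of dimension 1 and 2 are lifted, by bisection of
    a square, the same bisection that proves Goursat's lemma. The Thom cocycle is an arbitrary
    representative, with an unknown value K on a constant simplex of the zero section. The primitive
    takes the value 2 K - 1 on s, and the constant caps of Z contribute -2 K for each copy of s,
    which leaves -1. Divisibility enters twice: that of the rationals gives additive maps from k to
    the rationals which detect a nonzero value of a cocycle on a cycle; that of k then extends the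
    cocycle from boundaries to a primitive on all chains. *)

Section SubquotTheory.
Variables (V : zmodType) (Z B : zmodClosed V).

Lemma zval_insubd (v : V) : v \in Z -> zval (insubd (0 : zsub Z) v) = v.
Proof. by move=> hv; rewrite -[zval _]/(val _) insubdK. Qed.

Lemma zvalB (x y : zsub Z) : zval (x - y) = zval x - zval y.
Proof. exact: (raddfB (val : zsub Z -> V)). Qed.

Lemma srepr_in (q : subquot Z B) : srepr q \in Z.
Proof. exact: zvalP. Qed.

Lemma sclass_srepr (q : subquot Z B) : sclass Z B (srepr q) = q.
Proof.
rewrite /sclass /srepr.
have -> : insubd (0 : zsub Z) (zval (repr (q : Quotient.quot (zsub_in (Z := Z) B)))) =
          repr (q : Quotient.quot (zsub_in (Z := Z) B)).
  by apply: val_inj; rewrite /= zval_insubd ?zvalP.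
exact: reprK.
Qed.

Lemma sclass_eqP (x y : V) : x \in Z -> y \in Z ->
  (sclass Z B x = sclass Z B y) <-> (x - y \in B).
Proof.
move=> hx hy; rewrite /sclass.
have -> : (x - y \in B) =
  (insubd (0 : zsub Z) x - insubd (0 : zsub Z) y \in zsub_in (Z := Z) B).
  by rewrite inE zvalB !zval_insubd.
rewrite Quotient.idealrBE; split=> [->|/eqP //]; exact: eqxx.
Qed.

Lemma sclassB (x y : V) : x \in Z -> y \in Z ->
  sclass Z B (x - y) = sclass Z B x - sclass Z B y.
Proof.
move=> hx hy; rewrite /sclass.
have -> : insubd (0 : zsub Z) (x - y) = insubd 0 x - insubd 0 y.
  by apply: (@val_inj _ _ (zsub Z)); rewrite -![val _]/(zval _) zvalB !zval_insubd ?rpredB.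
by rewrite !piE.
Qed.

Lemma sclass0 : sclass Z B 0 = 0.
Proof. by rewrite -(subrr 0) sclassB ?rpred0 ?subrr. Qed.

Lemma sclassN (x : V) : x \in Z -> sclass Z B (- x) = - sclass Z B x.
Proof. by move=> hx; rewrite -(sub0r x) sclassB ?rpred0 // sclass0 sub0r. Qed.

Lemma sclassD (x y : V) : x \in Z -> y \in Z ->
  sclass Z B (x + y) = sclass Z B x + sclass Z B y.
Proof. by move=> hx hy; rewrite -{1}(opprK y) sclassB ?rpredN // sclassN // opprK. Qed.

Lemma srepr_sclass (x : V) : x \in Z -> srepr (sclass Z B x) - x \in B.
Proof. by move=> hx; apply/sclass_eqP; rewrite ?srepr_in ?sclass_srepr. Qed.

Lemma sclass_mulz (x : V) (a : int) : x \in Z ->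
  sclass Z B (x *~ a) = sclass Z B x *~ a.
Proof.
move=> hx.
have hn : forall n, sclass Z B (x *+ n) = sclass Z B x *+ n.
  elim=> [|p IH]; first by rewrite !mulr0n sclass0.
  by rewrite !mulrS sclassD ?rpredMn // IH.
case: a => p; first exact: hn.
by rewrite NegzE !mulrNz sclassN ?rpredMn //; congr (- _); exact: hn.
Qed.
End SubquotTheory.

Lemma cyclesP (R : realType) (X : topologicalType) n (S T : set X) (c : chain R X n) :
  (c \in cycles S T) <-> (chain_on S c /\ chain_on T (bd c)).
Proof. by rewrite inE. Qed.

Lemma boundariesP (R : realType) (X : topologicalType) n (S T : set X) (c : chain R X n) :
  (c \in boundaries S T) <-> (exists (b : chain R X n.+1) (c' : chain R X n),
                 [/\ chain_on S b, chain_on T c' & c = bd b + c']).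
Proof. by rewrite inE. Qed.

Lemma cocyclesP (R : realType) (X : topologicalType) (M : zmodType) n (S T : set X) (f : cochain R X M n) :
  (f \in cocycles (R := R) (n := n) S T) <-> ((forall s, sing T s -> f s = 0) /\
                (forall s, sing S s -> @cobd R X M n.+1 f s = 0)).
Proof. by rewrite inE. Qed.

Lemma coboundariesP (R : realType) (X : topologicalType) (M : zmodType) n (S T : set X) (f : cochain R X M n) :
  (f \in coboundaries (R := R) (n := n) S T) <-> (exists g : cochain R X M n.-1, (forall s, sing T s -> g s = 0) /\
                (forall s, sing S s -> f s = @cobd R X M n g s)).
Proof. by rewrite inE. Qed.

(** * Evaluation of cochains on formal sums *)

Section Eval.
Variables (K : choiceType) (M : zmodType).
Implicit Types (f : K -> M) (c : {freeg K / int}).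

Definition ev f c : M := \sum_(s <- dom c) f s *~ coeff s c.

(** Supports change under addition; a common duplicate-free list containing all of them lets the
    sums be compared term by term. *)
Lemma ev_sub f c (r : seq K) : uniq r -> {subset dom c <= r} ->
  ev f c = \sum_(s <- r) f s *~ coeff s c.
Proof.
move=> ur sub; rewrite /ev [RHS](bigID [in dom c]) /= [X in _ + X]big1 ?addr0; last first.
  by move=> s hs; rewrite coeff_outdom // mulr0z.
rewrite -[RHS]big_filter; apply/perm_big/uniq_perm.
- exact: uniq_dom.
- exact: filter_uniq.
by move=> s; rewrite mem_filter; case: (boolP (s \in dom c)) => //= /sub ->.
Qed.

Lemma evD f c c' : ev f (c + c') = ev f c + ev f c'.
Proof.
pose r := undup (dom c ++ dom c' ++ dom (c + c')).
have ur : uniq r by exact: undup_uniq.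
rewrite !(@ev_sub _ _ r) //; try by move=> s hs; rewrite mem_undup !mem_cat hs ?orbT.
by rewrite -big_split /=; apply: eq_bigr => s _; rewrite coeffD mulrzDr.
Qed.

Lemma ev0 f : ev f 0 = 0.
Proof. by apply: (addrI (ev f 0)); rewrite -evD !addr0. Qed.

Lemma evN f c : ev f (- c) = - ev f c.
Proof. by apply: (addrI (ev f c)); rewrite -evD !subrr ev0. Qed.

Lemma evB f c c' : ev f (c - c') = ev f c - ev f c'.
Proof. by rewrite evD evN. Qed.

Lemma ev_sum I (r : seq I) (P : pred I) f (F : I -> {freeg K / int}) :
  ev f (\sum_(i <- r | P i) F i) = \sum_(i <- r | P i) ev f (F i).
Proof. exact: (big_morph (ev f) (evD f) (ev0 f)). Qed.

Lemma evU f k s : ev f << k *g s >> = f s *~ k.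
Proof.
have [->|k0] := eqVneq k 0; first by rewrite freegU0 ev0 mulr0z.
by rewrite /ev domU // big_seq1 coeffU eqxx mulr1.
Qed.

Lemma ev_mulz f c (a : int) : ev f (c *~ a) = ev f c *~ a.
Proof.
have hn n : ev f (c *+ n) = ev f c *+ n.
  by elim: n => [|n IH]; rewrite ?mulr0n ?ev0 // !mulrS evD IH.
by case: a => n; rewrite ?NegzE ?mulrNz ?evN; [exact: hn|congr (- _); exact: hn].
Qed.

Lemma eq_ev f g c : (forall s, coeff s c != 0 -> f s = g s) -> ev f c = ev g c.
Proof.
move=> fg; rewrite /ev big_seq [RHS]big_seq.
by apply: eq_bigr => s; rewrite mem_dom => hs; rewrite fg.
Qed.

Lemma ev_fun0 c : ev (fun=> 0) c = 0.
Proof. by apply: big1 => s _; rewrite mul0rz. Qed.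

Lemma ev_funD f g c : ev (fun s => f s + g s) c = ev f c + ev g c.
Proof. by rewrite /ev -big_split; apply: eq_bigr => s _; rewrite mulrzDl. Qed.

Lemma ev_funB f g c : ev (fun s => f s - g s) c = ev f c - ev g c.
Proof. by rewrite /ev -sumrB; apply: eq_bigr => s _; rewrite mulrzBl. Qed.

End Eval.

Lemma fgliftB (K K' : choiceType) (F : K -> {freeg K' / int}) :
  {morph (fglift F : {freeg K / int} -> {freeg K' / int}) : x y / x - y}.
Proof. exact: lift_is_additive. Qed.

Lemma fglift0 (K K' : choiceType) (F : K -> {freeg K' / int}) :
  fglift F (0 : {freeg K / int}) = 0.
Proof. by rewrite -{1}(subrr 0) fgliftB subrr. Qed.

Lemma fgliftN (K K' : choiceType) (F : K -> {freeg K' / int}) :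
  {morph (fglift F : {freeg K / int} -> {freeg K' / int}) : x / - x}.
Proof. by move=> x; rewrite -(sub0r x) fgliftB fglift0 sub0r. Qed.

Lemma fgliftD (K K' : choiceType) (F : K -> {freeg K' / int}) :
  {morph (fglift F : {freeg K / int} -> {freeg K' / int}) : x y / x + y}.
Proof. by move=> x y; rewrite -{1}(opprK y) fgliftB fgliftN opprK. Qed.

Lemma fglift_sum (K K' : choiceType) (F : K -> {freeg K' / int}) I (r : seq I)
    (P : pred I) (c : I -> {freeg K / int}) :
  fglift F (\sum_(i <- r | P i) c i) = \sum_(i <- r | P i) fglift F (c i).
Proof. exact: (big_morph _ (fgliftD F) (fglift0 F)). Qed.

Lemma ev_fglift (K K' : choiceType) (M : zmodType) (f : K' -> M)
    (F : K -> {freeg K' / int}) (c : {freeg K / int}) :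
  ev f (fglift F c) = ev (fun s => ev f (F s)) c.
Proof.
rewrite -(freeg_sumE c) fglift_sum !ev_sum; apply: eq_bigr => s _.
rewrite liftU evU -ev_mulz; congr (ev f _).
by rewrite -[RHS]scaler_int intz.
Qed.

Section Homology.
Variables (R : realType) (X : topologicalType).
Implicit Types (S T : set X).

Lemma bdD n : {morph @bd R X n : c c' / c + c'}.
Proof.
move=> c c'; rewrite -{1}(opprK c') bdB -(sub0r c') bdB bd0.
by rewrite sub0r opprK.
Qed.

(** Boundary and coboundary are adjoint for all maps from the simplex, continuous or not, since
    chains are formal sums of arbitrary maps. *)
Lemma ev_bd (M : zmodType) n (f : cochain R X M n) (c : chain R X n.+1) :
  ev f (bd c) = ev (@cobd R X M n.+1 f) c.
Proof.
rewrite /= ev_fglift; apply: eq_ev => s _; rewrite ev_sum.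
by apply: eq_bigr => i _; rewrite evU.
Qed.

Lemma bdU n (s : simplex R n.+1 -> X) :
  bd (<< s >> : chain R X n.+1) =
  \sum_(i < n.+2) << (-1) ^+ i *g (s \o face i) >> :> chain R X n.
Proof. by rewrite /= liftU scale1r. Qed.

Lemma chain_onD n S (c c' : chain R X n) :
  chain_on S c -> chain_on S c' -> chain_on S (c + c').
Proof.
move=> h h'; rewrite -(opprK c'); apply: chain_onB => // s.
by rewrite coeffN oppr_eq0; exact: h'.
Qed.

Lemma chain_onN n S (c : chain R X n) : chain_on S c -> chain_on S (- c).
Proof. by move=> h s; rewrite coeffN oppr_eq0; exact: h. Qed.

Lemma chain_on_mulz n S (c : chain R X n) (a : int) :
  chain_on S c -> chain_on S (c *~ a).
Proof.
move=> h; have hn p : chain_on S (c *+ p).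
  elim: p => [|p IH]; first by rewrite mulr0n; exact: chain_on0.
  by rewrite mulrS; exact: chain_onD.
by case: a => p; rewrite ?NegzE ?mulrNz; [exact: hn|apply: chain_onN; exact: hn].
Qed.

Lemma chain_onU n S (s : simplex R n -> X) (k : int) :
  sing S s -> chain_on S (<< k *g s >> : chain R X n).
Proof.
by move=> h t; rewrite coeffU; have [<- //|_] := eqVneq s t; rewrite mulr0 eqxx.
Qed.

Lemma chain_on_sum n S I (r : seq I) (c : I -> chain R X n) :
  (forall i, chain_on S (c i)) -> chain_on S (\sum_(i <- r) c i).
Proof.
by move=> h; apply: big_ind => [||i _]; [exact: chain_on0|exact: chain_onD|exact: h].
Qed.

Lemma chain_on_sub n S S' (c : chain R X n) :
  S `<=` S' -> chain_on S c -> chain_on S' c.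
Proof. by move=> sub h s /h [h1 h2]; split => // t; exact/sub/h2. Qed.

(** Standard simplices are non-empty ([delta_mx 0 0] is a vertex), so none maps to the empty set.
    This turns relative cycles modulo [set0] into chains with zero boundary. *)
Lemma chain_on_set0 n (c : chain R X n) : chain_on set0 c -> c = 0.
Proof.
move=> h; apply/eqP/freeg_eqP => s; rewrite coeff0; apply/eqP.
have [//|/h [_ /(_ _)]] := eqVneq (coeff s c) 0.
have [t _] : exists t : simplex R n, True.
  have ht : (delta_mx 0 0 : 'rV[R]_n.+1) \in @simplex_set R n.
    apply/mem_set; split=> [j|]; first by rewrite mxE ler0n.
    rewrite (bigD1 ord0) //= mxE !eqxx big1 ?addr0 // => j /negPf h0.
    by rewrite mxE h0 andbF.
  by exists (exist _ (delta_mx 0 0) ht : simplex R n).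
by move=> /(_ t).
Qed.

Lemma ev_on (M : zmodType) n S (f : cochain R X M n) (c : chain R X n) :
  chain_on S c -> (forall s, sing S s -> f s = 0) -> ev f c = 0.
Proof.
by move=> hc hf; rewrite (@eq_ev _ _ _ (fun=> 0)) ?ev_fun0 // => s /hc/hf.
Qed.

Lemma ev_eq_on (M : zmodType) n S (f g : cochain R X M n) (c : chain R X n) :
  chain_on S c -> (forall s, sing S s -> f s = g s) -> ev f c = ev g c.
Proof. by move=> hc hf; apply: eq_ev => s /hc/hf. Qed.

Lemma ev_cocycle_boundary (M : zmodType) n S T (f : cochain R X M n) c :
  f \in cocycles (R := R) (n := n) S T -> c \in boundaries (R := R) (n := n) S T ->
  ev f c = 0.
Proof.
move=> /cocyclesP [f1 f2] /boundariesP [b [c' [hb hc' ->]]].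
by rewrite evD ev_bd (ev_on hb) // (ev_on hc') // addr0.
Qed.

Lemma ev_coboundary_cycle (M : zmodType) n S T (f : cochain R X M n.+1) c :
  f \in coboundaries (R := R) (n := n.+1) S T -> c \in cycles (R := R) (n := n.+1) S T ->
  ev f c = 0.
Proof.
move=> /coboundariesP [g [g1 g2]] /cyclesP [c1 c2].
by rewrite (ev_eq_on c1 g2) -ev_bd (ev_on c2).
Qed.

Lemma corep_cocycle (M : zmodType) n S T (a : coh R M n S T) :
  corep a \in cocycles (R := R) (n := n) S T.
Proof. exact: srepr_in. Qed.

Lemma hrep_cycle n S T (u : Defs.hom R n S T) : hrep u \in cycles (R := R) (n := n) S T.
Proof. exact: srepr_in. Qed.

Lemma pairing_ev (M : zmodType) n S T (a : coh R M n S T) (u : Defs.hom R n S T) :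
  pairing a u = ev (corep a) (hrep u).
Proof. by []. Qed.

Lemma pairing_hcl (M : zmodType) n S T (a : coh R M n S T) c :
  c \in cycles (R := R) (n := n) S T ->
  pairing a (hcl S T c) = ev (corep a) c.
Proof.
move=> hc; rewrite pairing_ev; apply/eqP; rewrite -subr_eq0 -evB; apply/eqP.
exact: (ev_cocycle_boundary (corep_cocycle a) (srepr_sclass _ hc)).
Qed.

(** The chosen representative differs from [f] by a coboundary, which cycles do not see; explicit
    cochains may therefore replace [corep]. *)
Lemma ev_corep_cocl (M : zmodType) n S T (f : cochain R X M n.+1) c :
  f \in cocycles (R := R) (n := n.+1) S T -> c \in cycles (R := R) (n := n.+1) S T ->
  ev (corep (cocl S T f)) c = ev f c.
Proof.
move=> hf hc; apply/eqP; rewrite -subr_eq0 -ev_funB; apply/eqP.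
exact: (ev_coboundary_cycle (srepr_sclass (coboundaries S T) hf) hc).
Qed.

End Homology.

Section Push.
Variables (R : realType) (X Y : topologicalType) (f : X -> Y).

Definition pushc n (c : chain R X n) : chain R Y n :=
  fglift (fun s : simplex R n -> X => << f \o s >> : chain R Y n) c.

Lemma ev_pushc (M : zmodType) n (g : cochain R Y M n) (c : chain R X n) :
  ev g (pushc c) = ev (fun s : simplex R n -> X => g (f \o s)) c.
Proof. by rewrite ev_fglift; apply: eq_ev => s _; rewrite evU. Qed.

Lemma pushcU n (k : int) (s : simplex R n -> X) :
  pushc (<< k *g s >> : chain R X n) = << k *g (f \o s) >>.
Proof. by rewrite /pushc liftU -[k in LHS]intz scaler_int freeg_mulz intz. Qed.

Lemma pushc_sumE n (c : chain R X n) :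
  pushc c = \sum_(s <- dom c) << coeff s c *g (f \o s) >>.
Proof.
rewrite -{1}(freeg_sumE c) /pushc fglift_sum; apply: eq_bigr => s _.
exact: pushcU.
Qed.

Lemma pushc_mulz n (c : chain R X n) (a : int) : pushc (c *~ a) = pushc c *~ a.
Proof.
have hn p : pushc (c *+ p) = pushc c *+ p.
  elim: p => [|p IH]; first by rewrite !mulr0n /pushc fglift0.
  by rewrite !mulrS -IH /pushc fgliftD.
case: a => p; first exact: hn.
by rewrite NegzE !mulrNz {1}/pushc fgliftN; congr (- _); exact: hn.
Qed.

Lemma bd_pushc n (c : chain R X n.+1) : bd (pushc c) = pushc (bd c).
Proof.
rewrite -(freeg_sumE c) /pushc !fglift_sum /= !fglift_sum; apply: eq_bigr => s _.
rewrite -[fglift _ << _ *g _ >>]/(pushc _) pushcU !liftU.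
rewrite -[coeff s c]intz !scaler_int -[RHS]/(pushc _) pushc_mulz; congr (_ *~ _).
by rewrite /pushc fglift_sum; apply: eq_bigr => i _; rewrite -/(pushc _) pushcU.
Qed.

Lemma chain_on_pushc n (S : set X) (S' : set Y) (c : chain R X n) :
  continuous f -> (forall x, S x -> S' (f x)) ->
  chain_on S c -> chain_on S' (pushc c).
Proof.
move=> cf fS hc; rewrite pushc_sumE big_seq; apply: big_ind => [||s].
- exact: chain_on0.
- exact: chain_onD.
rewrite mem_dom => /hc [cs Ss]; apply: chain_onU; split=> [|t]; last exact/fS/Ss.
by move=> t; apply: continuous_comp; [exact: cs|exact: cf].
Qed.

End Push.

(** * Goursat's lemma and Cauchy's estimate *)

Section SquareBisection.
Variable R : realType.
Implicit Types x y L : R.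

Definition in_square x y L u v := [&& x <= u, u <= x + L, y <= v & v <= y + L].

Lemma square_quarter x0 y0 L0 x y L (q' : R * R) (P : Prop) : 0 < L ->
  in_square x0 y0 L0 x y -> in_square x0 y0 L0 (x + L) (y + L) ->
  q'.1 = x \/ q'.1 = x + L / 2 -> q'.2 = y \/ q'.2 = y + L / 2 -> P ->
  [/\ [/\ 0 < L / 2, in_square x0 y0 L0 q'.1 q'.2,
      in_square x0 y0 L0 (q'.1 + L / 2) (q'.2 + L / 2) & P], L / 2 = L / 2,
     x <= q'.1, y <= q'.2 & (q'.1 <= x + L / 2) && (q'.2 <= y + L / 2)].
Proof.
case: q' => x' y' L0p; rewrite /in_square /=.
move=> /and4P[a1 a2 a3 a4] /and4P[b1 b2 b3 b4] hx hy hP.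
have hx' : x <= x' <= x + L / 2 by case: hx => ->; apply/andP; split; lra.
have hy' : y <= y' <= y + L / 2 by case: hy => ->; apply/andP; split; lra.
move: hx' hy' => /andP[c1 c2] /andP[d1 d2].
split=> //; last exact/andP.
split=> //; first lra.
  by apply/and4P; split; lra.
by apply/and4P; split; lra.
Qed.

(** If the property failed, it would fail on one quarter of each bad square, hence on squares of
    side [L0 / 2 ^+ n] that shrink to a point, against the local hypothesis there. It serves both
    for Goursat's lemma and for lifting maps from a square. *)
Lemma square_bisection (T : R -> R -> R -> Prop) x0 y0 L0 : 0 < L0 ->
  (forall x y L, 0 < L -> T x y L -> T (x + L) y L -> T x (y + L) L ->
     T (x + L) (y + L) L -> T x y (L + L)) ->
  (forall u v, in_square x0 y0 L0 u v -> exists2 d, 0 < d &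
     forall x y L, 0 < L -> L < d -> in_square x y L u v ->
       in_square x0 y0 L0 x y -> in_square x0 y0 L0 (x + L) (y + L) -> T x y L) ->
  T x0 y0 L0.
Proof.
move=> L00 glue loc; apply: contrapT => bad0.
pose ok (q : R * R * R) := [/\ 0 < q.2, in_square x0 y0 L0 q.1.1 q.1.2,
  in_square x0 y0 L0 (q.1.1 + q.2) (q.1.2 + q.2) & ~ T q.1.1 q.1.2 q.2].
(* Stated for all triples, with the dummy value [(0, 0, 0)] for those that are not [ok], so that
   [choice] yields a total function to iterate. *)
have step (q : R * R * R) : exists q' : R * R * R, ok q ->
    [/\ ok q', q'.2 = q.2 / 2, q.1.1 <= q'.1.1, q.1.2 <= q'.1.2 &
     (q'.1.1 <= q.1.1 + q.2 / 2) && (q'.1.2 <= q.1.2 + q.2 / 2)].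
  case: q => [[x y] L].
  have [[/= Lp]|nok] := pselect (ok (x, y, L)); last by exists (0, 0, 0).
  rewrite /in_square => /and4P[a1 a2 a3 a4] /and4P[b1 b2 b3 b4] bad.
  have h2 : 0 < L / 2 by rewrite divr_gt0.
  have eL : L = L / 2 + L / 2 by field.
  suff [q' [hq' hbad]] : exists q' : R * R, ((q'.1 = x \/ q'.1 = x + L / 2) /\
      (q'.2 = y \/ q'.2 = y + L / 2)) /\ ~ T q'.1 q'.2 (L / 2).
    exists (q'.1, q'.2, L / 2) => _; rewrite /ok /in_square /=.
    by apply: square_quarter => //; [exact/and4P|exact/and4P|case: hq'|case: hq'].
  apply: contrapT => /forallNP hn; apply: bad; rewrite eL.
  apply: glue => //; apply: contrapT => hT.
  - by apply: (hn (x, y)); split=> //=; split; left.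
  - by apply: (hn (x + L / 2, y)); split=> //=; split; [right|left].
  - by apply: (hn (x, y + L / 2)); split=> //=; split; [left|right].
  - by apply: (hn (x + L / 2, y + L / 2)); split=> //=; split; right.
have [nx hnx] := choice step.
pose q n := iter n nx (x0, y0, L0).
have okq n : ok (q n).
  elim: n => [|n IH]; last by case: (hnx _ IH).
  rewrite /ok /in_square /= !lexx; split=> //; last by apply/and4P; split; lra.
  by apply/and4P; split; lra.
have L2 n : (q n).2 = L0 / 2 ^+ n.
  elim: n => [|n IH]; first by rewrite expr0 divr1.
  case: (hnx _ (okq n)) => _ /= -> _ _ _; rewrite IH exprS; field.
  by rewrite expf_neq0.
have hm n k : [&& (q n).1.1 <= (q (k + n)%N).1.1, (q n).1.2 <= (q (k + n)%N).1.2,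
   (q (k + n)%N).1.1 + (q (k + n)%N).2 <= (q n).1.1 + (q n).2 &
   (q (k + n)%N).1.2 + (q (k + n)%N).2 <= (q n).1.2 + (q n).2].
  elim: k => [|k IH]; first by rewrite add0n !lexx.
  case: (hnx _ (okq (k + n)%N)) => _ /= e1 e2 e3 /andP[e4 e5].
  by move: IH => /and4P[i1 i2 i3 i4]; rewrite e1; apply/and4P; split; lra.
(* Every left edge is at most every right edge, and likewise for lower and upper edges; so the
   suprema of the left and of the lower edges give a point of all the squares. *)
have hmm n k : (q k).1.1 <= (q n).1.1 + (q n).2 /\ (q k).1.2 <= (q n).1.2 + (q n).2.
  have [/subnK e|/ltnW/subnK e] := leqP n k.
    have := hm n (k - n)%N; rewrite e => /and4P[_ _ h1 h2].
    by have [p _ _ _] := okq k; split; lra.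
  have := hm k (n - k)%N; rewrite e => /and4P[h1 h2 _ _].
  by have [p _ _ _] := okq n; split; lra.
pose Sx := [set (q n).1.1 | n in [set: nat]].
pose Sy := [set (q n).1.2 | n in [set: nat]].
have hx n : (q n).1.1 <= sup Sx <= (q n).1.1 + (q n).2.
  apply/andP; split.
    apply: ub_le_sup; last by exists n.
    by exists ((q 0%N).1.1 + (q 0%N).2) => _ [k _ <-]; case: (hmm 0%N k).
  apply: ge_sup; first by exists (q 0%N).1.1; exists 0%N.
  by move=> _ [k _ <-]; case: (hmm n k).
have hy n : (q n).1.2 <= sup Sy <= (q n).1.2 + (q n).2.
  apply/andP; split.
    apply: ub_le_sup; last by exists n.
    by exists ((q 0%N).1.2 + (q 0%N).2) => _ [k _ <-]; case: (hmm 0%N k).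
  apply: ge_sup; first by exists (q 0%N).1.2; exists 0%N.
  by move=> _ [k _ <-]; case: (hmm n k).
have inq n : in_square (q n).1.1 (q n).1.2 (q n).2 (sup Sx) (sup Sy).
  by rewrite /in_square; move: (hx n) (hy n) => /andP[-> ->] /andP[-> ->].
have [d d0 hd] := loc _ _ (inq 0%N).
have [n hn] : exists n, L0 / 2 ^+ n < d.
  have /cvgrPdist_lt /(_ d d0) [n _ hn] : (fun n => L0 / 2 ^+ n) @ \oo --> (0 : R).
    rewrite -(mulr0 L0); apply: cvgM; first exact: cvg_cst.
    under eq_fun do rewrite -exprVn.
    by apply: cvg_expr; rewrite ger0_norm ?invr_ge0 ?invf_lt1 ?ltr1n.
  exists n; have := hn n (leqnn n); rewrite sub0r normrN ger0_norm //.
  by rewrite divr_ge0 ?exprn_ge0 // ltW.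
have [k1 k2 k3 k4] := okq n.
by apply: k4; apply: hd => //; rewrite L2.
Qed.

End SquareBisection.

Section RealIntegral.
Variable R : realType.
Implicit Types (a b c e : R) (f g : R -> R).
Local Notation mu := (@lebesgue_measure R).
Local Notation "'Int' a b f" := (\int[mu]_(t in `[a, b]) f t)
  (at level 10, a at level 8, b at level 8, f at level 8).

(** Continuity at the end points is two-sided, so the condition is stronger than continuity of the
    restriction and passes directly to subintervals. *)
Definition cont_on a b f := forall t, a <= t <= b -> {for t, continuous f}.

Lemma cont_on_integrable a b f : cont_on a b f ->
  mu.-integrable `[a, b] (EFin \o f).
Proof.
move=> cf; apply: continuous_compact_integrable; first exact: segment_compact.
apply: continuous_in_subspaceT => t; rewrite inE /= in_itv /= => ht.
exact: cf.
Qed.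

Lemma Int_bound a b f c e : a <= b -> cont_on a b f ->
  (forall t, a <= t <= b -> `|f t - c| <= e) ->
  `|Int a b f - c * (b - a)| <= e * (b - a).
Proof.
move=> ab cf hf.
have icst k : mu.-integrable `[a, b] (EFin \o cst k).
  by apply: cont_on_integrable => t _; exact: cst_continuous.
have Icst k : Int a b (cst k) = k * (b - a).
  rewrite Rintegral_cst //; have := @lebesgue_measure_itv R `[a, b].
  move=> /= /(congr1 fine) m; congr (_ * _); apply: eq_trans m _.
  case: ifP => [//|]; rewrite lte_fin lt_neqAle ab andbT => /negbFE/eqP ->.
  by rewrite subrr.
have ifc := cont_on_integrable cf.
have cd : cont_on a b (fun t => f t - c).
  by move=> t ht; apply: continuousB; [exact: cf|exact: cst_continuous].
rewrite -!Icst -RintegralB //.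
apply: le_trans (le_normr_Rintegral _ (cont_on_integrable cd)) _ => //.
apply: le_Rintegral => //.
apply: cont_on_integrable => t ht.
by apply: continuous_comp; [exact: cd|exact: norm_continuous].
Qed.

Lemma Int_cat a b c f : a <= b -> b <= c -> cont_on a c f ->
  Int a c f = Int a b f + Int b c f.
Proof.
move=> ab bc cf; have ifc := cont_on_integrable cf.
have -> : Int b c f = \int[mu]_(t in `]b, c]) f t.
  rewrite Rintegral_itv_obnd_cbnd //.
  apply: integrableS ifc => //; apply: subset_itv => //; rewrite bnd_simp //.
have := @Rintegral_itvB R f (BLeft a) (BRight c) b ifc.
by rewrite !bnd_simp => <- //; rewrite addrC subrK.
Qed.

Lemma Int_sub a b f g : cont_on a b f -> cont_on a b g ->
  \int[mu]_(t in `[a, b]) (f t - g t) = Int a b f - Int a b g.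
Proof.
by move=> cf cg; rewrite RintegralB //; exact: cont_on_integrable.
Qed.

End RealIntegral.

Section Goursat.
Variable R : realType.
Implicit Types (x y u v L e d : R) (P Q : R -> R -> R).
Local Notation mu := (@lebesgue_measure R).
Local Notation "'Int' a b f" := (\int[mu]_(t in `[a, b]) f t)
  (at level 10, a at level 8, b at level 8, f at level 8).

Definition diff_at P x y (a b : R) := forall e, 0 < e -> exists2 d : R, 0 < d &
  forall u v, `|u - x| < d -> `|v - y| < d ->
    `|P u v - P x y - (a * (u - x) + b * (v - y))| <= e * (`|u - x| + `|v - y|).

(** The 1-form P du + Q dv is differentiable and closed at the point: the shared [b] is both the
    v-derivative of P and the u-derivative of Q. *)
Definition closed_form_at P Q x y := exists a b d, diff_at P x y a b /\ diff_at Q x y b d.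

Lemma diff_at_cont P x y a b : diff_at P x y a b ->
  {for x, continuous (P ^~ y)} /\ {for y, continuous (P x)}.
Proof.
move=> hP; have [d d0 hd] := hP 1 ltr01.
have key (c : R) (f : R -> R) z : (forall u, `|u - z| < d -> `|f u - f z| <= c * `|u - z|) ->
    0 < c -> {for z, continuous f}.
  move=> hf c0; apply/cvgrPdist_le => e e0.
  exists (Num.min d (e / c)); first by rewrite /= lt_min d0 divr_gt0.
  move=> u /=; rewrite lt_min distrC => /andP[h1 h2].
  rewrite distrC; apply: le_trans (hf _ h1) _.
  by rewrite mulrC -ler_pdivlMr // ltW.
have tri (p q r s c : R) : `|p - q - c * r| <= `|r| -> `|p - q| <= (1 + `|c|) * `|r|.
  move=> h; have -> : p - q = (p - q - c * r) + c * r by ring.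
  by apply: le_trans (ler_normD _ _) _; rewrite normrM mulrDl mul1r lerD2r.
split.
  apply: (key (1 + `|a|)); last by rewrite ltr_wpDr.
  move=> u hu; apply: tri => //.
  have := hd u y hu; rewrite subrr normr0 mulr0 !addr0 mul1r; exact.
apply: (key (1 + `|b|)); last by rewrite ltr_wpDr.
move=> v hv; apply: tri => //.
by have := hd x v _ hv; rewrite subrr normr0 mulr0 !add0r mul1r; apply.
Qed.

(** The counterclockwise integral of P du + Q dv along the boundary of the square. Opposite sides
    are kept under one integral because the local estimate bounds the difference of their
    integrands. *)
Definition circ P Q x y L : R :=
  Int x (x + L) (fun u => P u y - P u (y + L)) +
  Int y (y + L) (fun v => Q (x + L) v - Q x v).

Lemma circE P Q x y L :
  cont_on x (x + L) (P ^~ y) -> cont_on x (x + L) (P ^~ (y + L)) ->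
  cont_on y (y + L) (Q (x + L)) -> cont_on y (y + L) (Q x) ->
  circ P Q x y L = Int x (x + L) (P ^~ y) - Int x (x + L) (P ^~ (y + L)) +
                   (Int y (y + L) (Q (x + L)) - Int y (y + L) (Q x)).
Proof. by move=> *; rewrite /circ (Int_sub (f := P ^~ y)) // (Int_sub (f := Q (x + L))). Qed.

Lemma circ_glue P Q x y L : 0 < L ->
  (forall v, y <= v <= y + L + L -> cont_on x (x + L + L) (P ^~ v)) ->
  (forall u, x <= u <= x + L + L -> cont_on y (y + L + L) (Q u)) ->
  circ P Q x y (L + L) = circ P Q x y L + circ P Q (x + L) y L +
    (circ P Q x (y + L) L + circ P Q (x + L) (y + L) L).
Proof.
move=> Lp cP cQ.
have cP1 v : y <= v <= y + L + L -> cont_on x (x + L) (P ^~ v).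
  by move=> /cP h t /andP[h1 h2]; apply: h; apply/andP; split; lra.
have cP2 v : y <= v <= y + L + L -> cont_on (x + L) (x + L + L) (P ^~ v).
  by move=> /cP h t /andP[h1 h2]; apply: h; apply/andP; split; lra.
have cQ1 v : x <= v <= x + L + L -> cont_on y (y + L) (Q v).
  by move=> /cQ h t /andP[h1 h2]; apply: h; apply/andP; split; lra.
have cQ2 v : x <= v <= x + L + L -> cont_on (y + L) (y + L + L) (Q v).
  by move=> /cQ h t /andP[h1 h2]; apply: h; apply/andP; split; lra.
have e0 z : z <= z <= z + L + L by apply/andP; split; lra.
have e1 z : z <= z + L <= z + L + L by apply/andP; split; lra.
have e2 z : z <= z + L + L <= z + L + L by apply/andP; split; lra.
rewrite !circE ?addrA; auto.
rewrite (@Int_cat _ x (x + L) (x + L + L) (P^~ y)); [|lra|lra|auto].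
rewrite (@Int_cat _ x (x + L) (x + L + L) (P^~ (y + L + L))); [|lra|lra|auto].
rewrite (@Int_cat _ y (y + L) (y + L + L) (Q x)); [|lra|lra|auto].
rewrite (@Int_cat _ y (y + L) (y + L + L) (Q (x + L + L))); [|lra|lra|auto].
ring.
Qed.

(** To first order the horizontal sides contribute -b L^2 and the vertical ones b L^2, with the same
    b by closedness; only the error of the linear approximation remains. *)
Lemma circ_local P Q u v e : closed_form_at P Q u v -> 0 < e ->
  exists2 d : R, 0 < d & forall x y L, 0 < L -> L < d -> in_square x y L u v ->
    (forall w, x <= w <= x + L -> forall z, y <= z <= y + L ->
      {for w, continuous (P ^~ z)} /\ {for z, continuous (Q w)}) ->
    `|circ P Q x y L| <= e * (L * L).
Proof.
move=> [a [b [c [hP hQ]]]] e0.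
(* Each value of P or Q is approximated within (e / 8)(2 L); a difference of two costs e L / 2, its
   integral e L^2 / 2, and there are two integrals. *)
have e8 : 0 < e / 8 by rewrite divr_gt0.
have [d1 d10 h1] := hP _ e8; have [d2 d20 h2] := hQ _ e8.
exists (Num.min d1 d2); first by rewrite lt_min d10.
move=> x y L Lp; rewrite lt_min => /andP[L1 L2] /and4P[a1 a2 a3 a4] hc.
have cl (p q z : R) : p <= q <= p + L -> p <= z <= p + L -> `|z - q| <= L.
  by move=> /andP[? ?] /andP[? ?]; rewrite ler_norml; apply/andP; split; lra.
have B (p q A1 A2 M s : R) : `|p - A1 - M| <= e / 8 * s -> `|q - A1 - A2| <= e / 8 * s ->
    s <= 2 * L -> `|p - q - (M - A2)| <= e / 2 * L.
  move=> k1 k2 sL.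
  have -> : p - q - (M - A2) = (p - A1 - M) - (q - A1 - A2) by ring.
  apply: le_trans (ler_normB _ _) _.
  apply: le_trans (lerD k1 k2) _; rewrite -mulrDl.
  have -> : e / 2 * L = (e / 8 + e / 8) * (2 * L) by field.
  by rewrite ler_wpM2l // addr_ge0 // ltW.
have hyL : y <= y + L <= y + L by apply/andP; split; lra.
have hyy : y <= y <= y + L by apply/andP; split; lra.
have hxL : x <= x + L <= x + L by apply/andP; split; lra.
have hxx : x <= x <= x + L by apply/andP; split; lra.
have hu : x <= u <= x + L by apply/andP.
have hv : y <= v <= y + L by apply/andP.
have I1 : `|Int x (x + L) (fun t => P t y - P t (y + L)) - (- b * L) * (x + L - x)|
    <= e / 2 * L * (x + L - x).
  apply: Int_bound; first lra.
    by move=> t ht; apply: continuousB; [case: (hc t ht y hyy)|case: (hc t ht _ hyL)].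
  move=> t ht.
  have -> : - b * L = (a * (t - u) + b * (y - v)) - (a * (t - u) + b * (y + L - v)) by ring.
  have k1 := h1 t y (le_lt_trans (cl _ _ _ hu ht) L1) (le_lt_trans (cl _ _ _ hv hyy) L1).
  have k2 := h1 t (y + L) (le_lt_trans (cl _ _ _ hu ht) L1) (le_lt_trans (cl _ _ _ hv hyL) L1).
  have n1 := cl _ _ _ hu ht; have n2 := cl _ _ _ hv hyy; have n3 := cl _ _ _ hv hyL.
  apply: (B _ _ (P u v) _ _ (2 * L)) => //.
    by apply: le_trans k1 _; rewrite ler_wpM2l ?(ltW e8) //; lra.
  by apply: le_trans k2 _; rewrite ler_wpM2l ?(ltW e8) //; lra.
have I2 : `|Int y (y + L) (fun t => Q (x + L) t - Q x t) - (b * L) * (y + L - y)|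
    <= e / 2 * L * (y + L - y).
  apply: Int_bound; first lra.
    by move=> t ht; apply: continuousB; [case: (hc _ hxL t ht)|case: (hc _ hxx t ht)].
  move=> t ht.
  have -> : b * L = (b * (x + L - u) + c * (t - v)) - (b * (x - u) + c * (t - v)) by ring.
  have k1 := h2 (x + L) t (le_lt_trans (cl _ _ _ hu hxL) L2) (le_lt_trans (cl _ _ _ hv ht) L2).
  have k2 := h2 x t (le_lt_trans (cl _ _ _ hu hxx) L2) (le_lt_trans (cl _ _ _ hv ht) L2).
  have n1 := cl _ _ _ hu hxx; have n2 := cl _ _ _ hu hxL; have n3 := cl _ _ _ hv ht.
  apply: (B _ _ (Q u v) _ _ (2 * L)) => //.
    by apply: le_trans k1 _; rewrite ler_wpM2l ?(ltW e8) //; lra.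
  by apply: le_trans k2 _; rewrite ler_wpM2l ?(ltW e8) //; lra.
rewrite /circ; move: I1 I2; set J1 := Rintegral _ _ _; set J2 := Rintegral _ _ _.
clear -Lp e0.
have -> : forall z, z + L - z = L by move=> z; ring.
have -> : forall z, z + L - z = L by move=> z; ring.
move=> I1 I2.
have -> : J1 + J2 = (J1 - - b * L * L) + (J2 - b * L * L) by ring.
apply: le_trans (ler_normD _ _) _; apply: le_trans (lerD I1 I2) _; lra.
Qed.

(** A bound proportional to the area is preserved exactly when four squares are put together, so
    bisection carries it from small squares to the given one, for every [e]. *)
Lemma goursat P Q x0 y0 L0 : 0 < L0 ->
  (forall u v, in_square x0 y0 L0 u v -> closed_form_at P Q u v) ->
  circ P Q x0 y0 L0 = 0.
Proof.
move=> L00 hPQ.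
suff H e : 0 < e -> `|circ P Q x0 y0 L0| <= e * (L0 * L0).
  apply/eqP; rewrite -normr_le0 -[leRHS](mul0r (L0 * L0)).
  have LL : 0 < L0 * L0 by rewrite mulr_gt0.
  rewrite -ler_pdivrMr //; apply/ler_addgt0Pl => e e0.
  by rewrite addr0 ler_pdivrMr //; exact: H.
move=> e0.
have cP u v : in_square x0 y0 L0 u v ->
    {for u, continuous (P ^~ v)} /\ {for v, continuous (Q u)}.
  move=> /hPQ [a [b [d [/diff_at_cont [? _] /diff_at_cont [_ ?]]]]]; done.
(* Containment in the given square is a premise of the property, because continuity of P and Q,
   needed for gluing, is known only there. *)
pose T x y L := in_square x0 y0 L0 x y -> in_square x0 y0 L0 (x + L) (y + L) ->
  `|circ P Q x y L| <= e * (L * L).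
suff : T x0 y0 L0.
  by apply; rewrite /in_square !lexx; apply/and4P; split; lra.
apply: square_bisection (L00) _ _ => [x y L Lp h1 h2 h3 h4|u v uv].
  rewrite /T => /[dup] s1 /and4P[a1 a2 a3 a4] /[dup] s2 /and4P[b1 b2 b3 b4].
  have sq u v : x <= u <= x + L + L -> y <= v <= y + L + L -> in_square x0 y0 L0 u v.
    by move=> /andP[? ?] /andP[? ?]; rewrite /in_square; apply/and4P; split; lra.
  have cPu v : y <= v <= y + L + L -> cont_on x (x + L + L) (P ^~ v).
    by move=> hv u hu; case: (cP u v (sq _ _ hu hv)).
  have cQv u : x <= u <= x + L + L -> cont_on y (y + L + L) (Q u).
    by move=> hu v hv; case: (cP u v (sq _ _ hu hv)).
  rewrite circ_glue //.
  have t1 : in_square x0 y0 L0 x y by apply: sq; apply/andP; split; lra.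
  have t2 : in_square x0 y0 L0 (x + L) y by apply: sq; apply/andP; split; lra.
  have t3 : in_square x0 y0 L0 x (y + L) by apply: sq; apply/andP; split; lra.
  have t4 : in_square x0 y0 L0 (x + L) (y + L) by apply: sq; apply/andP; split; lra.
  have t5 : in_square x0 y0 L0 (x + L + L) (y + L) by apply: sq; apply/andP; split; lra.
  have t6 : in_square x0 y0 L0 (x + L) (y + L + L) by apply: sq; apply/andP; split; lra.
  have t7 : in_square x0 y0 L0 (x + L + L) (y + L + L) by apply: sq; apply/andP; split; lra.
  have q1 := h1 t1 t4; have q2 := h2 t2 t5; have q3 := h3 t3 t6; have q4 := h4 t4 t7.
  apply: le_trans (ler_normD _ _) _.
  apply: le_trans (lerD (ler_normD _ _) (ler_normD _ _)) _.
  apply: le_trans (lerD (lerD q1 q2) (lerD q3 q4)) _; lra.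
have [d d0 hd] := circ_local (hPQ u v uv) e0.
exists d => // x y L Lp Ld xyuv s1 s2 _ _; apply: hd => // w /andP[w1 w2] z /andP[z1 z2].
apply: cP; move: s1 s2 => /and4P[a1 a2 a3 a4] /and4P[b1 b2 b3 b4].
by apply/and4P; split; lra.
Qed.

End Goursat.

(** * The real modulus of complex numbers and the exponential *)

Section ComplexNumbers.
Variable R : realType.
Implicit Types z w : Cx R.

(** The norm on [Cx R] takes its values in [Cx R]; estimates against real integrals need the modulus
    as an element of [R]. *)
Definition cabs z : R := Num.sqrt (ReC z ^+ 2 + ImC z ^+ 2).

Lemma Cx_ext z w : ReC z = ReC w -> ImC z = ImC w -> z = w.
Proof. by case: z => a b; case: w => c d /= -> ->. Qed.
Lemma mkCE z : mkC (ReC z) (ImC z) = z.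
Proof. by case: z. Qed.
Lemma ReCmk (a b : R) : ReC (mkC a b) = a. Proof. by []. Qed.
Lemma ImCmk (a b : R) : ImC (mkC a b) = b. Proof. by []. Qed.
Lemma ReCD z w : ReC (z + w) = ReC z + ReC w.
Proof. by case: z; case: w. Qed.
Lemma ImCD z w : ImC (z + w) = ImC z + ImC w.
Proof. by case: z; case: w. Qed.
Lemma ReCN z : ReC (- z) = - ReC z.
Proof. by case: z. Qed.
Lemma ImCN z : ImC (- z) = - ImC z.
Proof. by case: z. Qed.
Lemma ReCM z w : ReC (z * w) = ReC z * ReC w - ImC z * ImC w.
Proof. by case: z; case: w. Qed.
Lemma ImCM z w : ImC (z * w) = ReC z * ImC w + ImC z * ReC w.
Proof. by case: z => a b; case: w => c d. Qed.
Lemma ReC0 : ReC (0 : Cx R) = 0. Proof. by []. Qed.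
Lemma ImC0 : ImC (0 : Cx R) = 0. Proof. by []. Qed.
Lemma ReC1 : ReC (1 : Cx R) = 1. Proof. by []. Qed.
Lemma ImC1 : ImC (1 : Cx R) = 0. Proof. by []. Qed.
Lemma ReCconj z : ReC (Num.conj z) = ReC z.
Proof. by case: z. Qed.
Lemma ImCconj z : ImC (Num.conj z) = - ImC z.
Proof. by case: z. Qed.
Definition ReImE := (ReCD, ImCD, ReCN, ImCN, ReCM, ImCM, ReC0, ImC0, ReC1, ImC1,
  ReCconj, ImCconj, ReCmk, ImCmk).

Lemma normCxE z : `|z| = mkC (cabs z) 0.
Proof. by have := normc_def (z : R[i]); apply. Qed.

Lemma cabs_ge0 z : 0 <= cabs z. Proof. exact: sqrtr_ge0. Qed.
Lemma mkC_le (a b : R) : (mkC a 0 <= mkC b 0) = (a <= b).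
Proof. exact: (lecR a b). Qed.
Lemma mkC_lt (a b : R) : (mkC a 0 < mkC b 0) = (a < b).
Proof. exact: (ltcR a b). Qed.
Lemma mkCr0D (a b : R) : mkC (a + b) 0 = mkC a 0 + mkC b 0.
Proof. by apply: Cx_ext; rewrite !ReImE ?addr0. Qed.
Lemma mkCr0M (a b : R) : mkC (a * b) 0 = mkC a 0 * mkC b 0.
Proof. by apply: Cx_ext; rewrite !ReImE; ring. Qed.
Lemma mkC_inj (a b : R) : mkC a 0 = mkC b 0 -> a = b.
Proof. by case. Qed.

Lemma Cx_pos (e : Cx R) : 0 < e -> exists2 r : R, 0 < r & e = mkC r 0.
Proof.
case: e => a b; rewrite ltcE /= => /andP[/eqP -> h]; by exists a.
Qed.

Lemma cabsD z w : cabs (z + w) <= cabs z + cabs w.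
Proof. by rewrite -mkC_le mkCr0D -!normCxE ler_normD. Qed.
Lemma cabsM z w : cabs (z * w) = cabs z * cabs w.
Proof. by apply: mkC_inj; rewrite mkCr0M -!normCxE normrM. Qed.
Lemma cabsN z : cabs (- z) = cabs z.
Proof. by apply: mkC_inj; rewrite -!normCxE normrN. Qed.
Lemma cabsBC z w : cabs (z - w) = cabs (w - z).
Proof. by rewrite -cabsN opprB. Qed.
Lemma cabsB z w : cabs (z - w) <= cabs z + cabs w.
Proof. by rewrite -(cabsN w); exact: cabsD. Qed.
Lemma cabs0 : cabs 0 = 0.
Proof. by rewrite /cabs !ReImE expr0n /= addr0 sqrtr0. Qed.
Lemma cabs1 : cabs 1 = 1.
Proof. by rewrite /cabs !ReImE expr0n expr1n /= addr0 sqrtr1. Qed.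
Lemma cabs_eq0 z : (cabs z == 0) = (z == 0).
Proof.
rewrite -[RHS]normr_eq0 normCxE; apply/eqP/eqP => [->//|]; by case.
Qed.
Lemma cabs_gt0 z : (0 < cabs z) = (z != 0).
Proof. by rewrite lt_def cabs_eq0 cabs_ge0 andbT. Qed.
Lemma cabsV z : cabs z^-1 = (cabs z)^-1.
Proof.
have [->|z0] := eqVneq z 0; first by rewrite invr0 cabs0 invr0.
have c0 : cabs z != 0 by rewrite cabs_eq0.
by apply: (mulfI c0); rewrite -cabsM !divff // cabs1.
Qed.
Lemma cabs_sqr z : cabs z ^+ 2 = ReC z ^+ 2 + ImC z ^+ 2.
Proof. by rewrite sqr_sqrtr // addr_ge0 // sqr_ge0. Qed.
Lemma ReC_le z : `|ReC z| <= cabs z.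
Proof.
by rewrite -sqrtr_sqr ler_wsqrtr // lerDl sqr_ge0.
Qed.
Lemma ImC_le z : `|ImC z| <= cabs z.
Proof. by rewrite -sqrtr_sqr ler_wsqrtr // lerDr sqr_ge0. Qed.
Lemma cabs_real (a : R) : cabs (mkC a 0) = `|a|.
Proof. by rewrite /cabs !ReImE expr0n /= addr0 sqrtr_sqr. Qed.
Lemma cabs_imag (a : R) : cabs (mkC 0 a) = `|a|.
Proof. by rewrite /cabs !ReImE expr0n /= add0r sqrtr_sqr. Qed.
Lemma cabs_le z : cabs z <= `|ReC z| + `|ImC z|.
Proof.
have -> : z = mkC (ReC z) 0 + mkC 0 (ImC z).
  by apply: Cx_ext; rewrite !ReImE; ring.
by apply: le_trans (cabsD _ _) _; rewrite cabs_real cabs_imag !ReImE addr0 add0r.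
Qed.

Lemma cvgCx_abs T (F : set_system T) (FF : Filter F) (f : T -> Cx R) z :
  (f @ F --> z) <-> (forall e : R, 0 < e -> \forall t \near F, cabs (z - f t) < e).
Proof.
split=> [/cvgrPdist_lt h e e0|h].
  have := h (mkC e 0); rewrite (mkC_lt 0 e) => /(_ e0).
  by apply: filterS => t; rewrite normCxE mkC_lt.
apply/cvgrPdist_lt => e /Cx_pos [r r0 ->]; have := h r r0.
by apply: filterS => t; rewrite normCxE mkC_lt.
Qed.

Lemma cvgCx T (F : set_system T) (FF : Filter F) (f : T -> Cx R) z :
  (f @ F --> z) <-> ((fun t => ReC (f t)) @ F --> ReC z /\ (fun t => ImC (f t)) @ F --> ImC z).
Proof.
split.
  move/cvgCx_abs => h; split; apply/cvgrPdist_lt => e /h; apply: filterS => t.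
    by apply: le_lt_trans; rewrite -ReCN -ReCD ReC_le.
  by apply: le_lt_trans; rewrite -ImCN -ImCD ImC_le.
move=> [/cvgrPdist_lt hr /cvgrPdist_lt hi]; apply/cvgCx_abs => e e0.
have e2 : 0 < e / 2 by rewrite divr_gt0.
apply: filterS2 (hr _ e2) (hi _ e2) => t h1 h2.
apply: le_lt_trans (cabs_le _) _; rewrite !ReImE; lra.
Qed.

Lemma continuous_ReC : continuous (@ReC R).
Proof. by move=> z; have /cvgCx [h _] : id @ z --> z by exact: cvg_id. Qed.
Lemma continuous_ImC : continuous (@ImC R).
Proof. by move=> z; have /cvgCx [_ h] : id @ z --> z by exact: cvg_id. Qed.
Lemma continuous_cabs : continuous cabs.
Proof.
move=> z; apply: continuous_comp; last exact: sqrt_continuous.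
apply: continuousD.
  by apply: (@continuous_comp _ _ _ (@ReC R) (fun x => x ^+ 2));
    [exact: continuous_ReC|exact: exprn_continuous].
by apply: (@continuous_comp _ _ _ (@ImC R) (fun x => x ^+ 2));
  [exact: continuous_ImC|exact: exprn_continuous].
Qed.

End ComplexNumbers.

Section ComplexExp.
Variable R : realType.
Implicit Types z w h : Cx R.

Definition expc z : Cx R := mkC (expR (ReC z) * cos (ImC z)) (expR (ReC z) * sin (ImC z)).

Lemma expcD z w : expc (z + w) = expc z * expc w.
Proof.
by apply: Cx_ext; rewrite /expc !ReImE expRD ?cosD ?sinD; ring.
Qed.
Lemma expc0 : expc 0 = 1.
Proof. by apply: Cx_ext; rewrite /expc !ReImE expR0 ?cos0 ?sin0; ring. Qed.
Lemma expcNM z : expc z * expc (- z) = 1.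
Proof. by rewrite -expcD subrr expc0. Qed.
Lemma cabs_expc z : cabs (expc z) = expR (ReC z).
Proof.
rewrite /cabs /expc !ReImE !exprMn -mulrDr cos2Dsin2 mulr1 sqrtr_sqr.
by rewrite ger0_norm ?expR_ge0.
Qed.

Lemma derive_approx (f : R -> R) (df x : R) : is_derive x 1 f df ->
  forall e, 0 < e -> exists2 d : R, 0 < d & forall t, `|t| < d ->
    `|f (t + x) - f x - df * t| <= e * `|t|.
Proof.
move=> [dfx <-] e e0; have /cvgrPdist_le /(_ e e0) : h^-1 *: (f (h *: 1 + x) - f x) @[h --> 0^'] --> 'D_1 f x.
  exact: dfx.
move=> [d /= d0 hd]; exists d => // t td.
have [->|t0] := eqVneq t 0; first by rewrite add0r subrr mulr0 subrr normr0 mulr0.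
have := hd t; rewrite /= sub0r normrN => /(_ td t0).
rewrite -[t *: 1]/(t * 1) mulr1 distrC => k.
have -> : f (t + x) - f x - 'D_1 f x * t = (t^-1 *: (f (t + x) - f x) - 'D_1 f x) * t.
  by rewrite mulrBl -[_ *: _]/(t^-1 * _) [t^-1 * _]mulrC divfK.
by rewrite normrM ler_wpM2r.
Qed.

(** The derivative of the exponential at 0 is 1; by the addition law this gives its derivative
    everywhere. *)
Lemma expc_approx e : 0 < e -> exists2 d : R, 0 < d & forall h, cabs h < d ->
  cabs (expc h - 1 - h) <= e * cabs h.
Proof.
move=> e0; have e8 : 0 < e / 8 by rewrite divr_gt0.
have h8 : 0 < Num.min (e / 8) 1 by rewrite lt_min e8 ltr01.
have [d1 d10 h1] := derive_approx (is_derive_expR 0) h8.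
have [d2 d20 h2] := derive_approx (is_derive_cos 0) e8.
have [d3 d30 h3] := derive_approx (is_derive_sin 0) e8.
(* With r the modulus of h: r < 1/2 gives e^a <= 2, and r < e/16 bounds the product (e^a - 1) b, at
   most 2 r^2, by e r / 8. Real and imaginary part each cost 3 e r / 8. *)
exists (Num.min (Num.min d1 d2) (Num.min d3 (Num.min (1 / 2) (e / 16)))).
  by rewrite !lt_min d10 d20 d30 !divr_gt0.
move=> h; rewrite !lt_min => /andP[/andP[c1 c2] /and3P[c3 c4 c5]].
pose a := ReC h; pose b := ImC h; pose r := cabs h.
have r0 : 0 <= r by exact: cabs_ge0.
have ar : `|a| <= r by exact: ReC_le.
have br : `|b| <= r by exact: ImC_le.
have := h1 a (le_lt_trans ar c1); rewrite !addr0 expR0 mul1r => k1.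
have := h2 b (le_lt_trans br c2); rewrite !addr0 cos0 sin0 oppr0 mul0r subr0 => k2.
have := h3 b (le_lt_trans br c3); rewrite !addr0 cos0 sin0 mul1r subr0 => k3.
have m1 : Num.min (e / 8) 1 <= e / 8 by rewrite ge_min lexx.
have m2 : Num.min (e / 8) 1 <= 1 by rewrite ge_min lexx orbT.
have k1a : `|expR a - 1 - a| <= e / 8 * r.
  by apply: le_trans k1 _; rewrite ler_pM // ltW.
have k1b : `|expR a - 1 - a| <= r.
  by apply: le_trans k1 _; rewrite -[leRHS]mul1r ler_pM // ltW.
have k2a : `|cos b - 1| <= e / 8 * r by apply: le_trans k2 _; rewrite ler_wpM2l // ltW.
have k3a : `|sin b - b| <= e / 8 * r by apply: le_trans k3 _; rewrite ler_wpM2l // ltW.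
have E1 : `|expR a - 1| <= 2 * r.
  have -> : expR a - 1 = (expR a - 1 - a) + a by ring.
  apply: le_trans (ler_normD _ _) _; clear -k1b ar; lra.
have E2 : `|expR a| <= 2.
  have -> : expR a = (expR a - 1) + 1 by ring.
  apply: le_trans (ler_normD _ _) _; rewrite normr1; move: c4; rewrite -/r => c4.
  clear -E1 c4; lra.
have er0 : 0 <= e / 8 * r by rewrite mulr_ge0 // ltW.
apply: le_trans (cabs_le _) _; rewrite !ReImE -/a -/b.
have -> : expR a * cos b - 1 - a = (expR a - 1 - a) + expR a * (cos b - 1) by ring.
have -> : expR a * sin b - 0 - b = expR a * (sin b - b) + (expR a - 1) * b by ring.
have F1 : `|expR a - 1 - a + expR a * (cos b - 1)| <= 3 * (e / 8 * r).
  apply: le_trans (ler_normD _ _) _; rewrite normrM.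
  have := ler_pM (normr_ge0 _) (normr_ge0 _) E2 k2a; clear -k1a; lra.
have F2 : `|expR a * (sin b - b) + (expR a - 1) * b| <= 3 * (e / 8 * r).
  apply: le_trans (ler_normD _ _) _; rewrite !normrM.
  have q1 := ler_pM (normr_ge0 _) (normr_ge0 _) E2 k3a.
  have q2 := ler_pM (normr_ge0 _) (normr_ge0 _) E1 br.
  have q3 : 2 * r * r <= e / 8 * r.
    by rewrite ler_wpM2r //; move: c5; rewrite -/r; clear; lra.
  clear -q1 q2 q3; lra.
clear -F1 F2 er0; rewrite -/r; lra.
Qed.

Lemma expc_derivable z : derivable expc z 1.
Proof.
apply/cvg_ex; exists (expc z); apply/cvgCx_abs => e e0.
have ez : 0 < cabs (expc z) by rewrite cabs_expc expR_gt0.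
have [d d0 hd] := expc_approx (divr_gt0 e0 (mulr_gt0 ez (ltr0Sn _ 1))).
exists (mkC d 0); first by rewrite /= (mkC_lt 0 d).
move=> h /=; rewrite sub0r normrN normCxE mkC_lt => hd' h0.
have H := hd h hd'.
rewrite -[h *: 1]/(h * 1) mulr1 expcD -[_ *: _]/(h^-1 * _).
have -> : expc z - h^-1 * (expc h * expc z - expc z) =
    - (h^-1 * (expc h - 1 - h) * expc z) by field.
rewrite cabsN !cabsM cabsV.
have hp : 0 < cabs h by rewrite cabs_gt0.
rewrite -ltr_pdivlMr // ltr_pdivrMl //.
apply: le_lt_trans H _; rewrite mulrC ltr_pM2l //.
by rewrite ltr_pM2l // ltf_pV2 ?posrE // ?mulr_gt0 //; clear -ez; lra.
Qed.

Lemma expc_differentiable z : differentiable expc z.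
Proof. exact/derivable1_diffP/expc_derivable. Qed.

Lemma differentiable_approx (F : Cx R -> Cx R) z : differentiable F z ->
  forall e, 0 < e -> exists2 d : R, 0 < d & forall h, cabs h < d ->
    cabs (F (h + z) - F z - 'd F z 1 * h) <= e * cabs h.
Proof.
move=> dF e e0; have dv : derivable F z 1 by apply/derivable1_diffP.
have /cvgCx_abs /(_ e e0) : h^-1 *: (F (h *: 1 + z) - F z) @[h --> 0^'] --> 'd F z 1.
  by rewrite -deriveE.
move=> [d' /= /Cx_pos [d d0 ->] hd]; exists d => // t td.
have [->|t0] := eqVneq t 0; first by rewrite add0r subrr mulr0 subrr cabs0 mulr0.
have := hd t; rewrite /= sub0r normrN normCxE mkC_lt => /(_ td t0).
rewrite -[t *: 1]/(t * 1) mulr1 cabsBC => k.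
have -> : F (t + z) - F z - 'd F z 1 * t = (t^-1 *: (F (t + z) - F z) - 'd F z 1) * t.
  by rewrite mulrBl -[_ *: _]/(t^-1 * _) [t^-1 * _]mulrC divfK.
by rewrite cabsM ler_wpM2r ?cabs_ge0 // ltW.
Qed.

(* The form is Im (F dw). *)
Lemma holomorphic_closed (F : Cx R -> Cx R) x y : differentiable F (mkC x y) ->
  closed_form_at (fun x y => ImC (F (mkC x y))) (fun x y => ReC (F (mkC x y))) x y.
Proof.
move=> /differentiable_approx hF; pose K := 'd F (mkC x y) 1.
(* Cauchy-Riemann: the y-derivative of Im F is Im (i K) = Re K, which is also the x-derivative of Re
   F. *)
exists (ImC K), (ReC K), (- ImC K).
have key e : 0 < e -> exists2 d : R, 0 < d & forall u v, `|u - x| < d -> `|v - y| < d ->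
    cabs (F (mkC u v) - F (mkC x y) - K * mkC (u - x) (v - y)) <= e * (`|u - x| + `|v - y|).
  move=> e0; have [d d0 hd] := hF e e0; rewrite -/K in hd.
  exists (d / 2); first by rewrite divr_gt0.
  move=> u v ux vy; have ha : cabs (mkC (u - x) (v - y)) <= `|u - x| + `|v - y|.
    exact: cabs_le.
  have := hd (mkC (u - x) (v - y)).
  have -> : mkC (u - x) (v - y) + mkC x y = mkC u v.
    by apply: Cx_ext; rewrite !ReImE subrK.
  move=> H; apply: le_trans (H _) _; last by rewrite ler_wpM2l // ltW.
  by apply: le_lt_trans ha _; clear -ux vy; lra.
split=> e /key [d d0 hd]; exists d => // u v ux vy; apply: le_trans (hd u v ux vy).
  apply: le_trans (ImC_le _); rewrite !ReImE le_eqVlt; apply/orP; left; apply/eqP.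
  by congr (`| _ |); ring.
apply: le_trans (ReC_le _); rewrite !ReImE le_eqVlt; apply/orP; left; apply/eqP.
by congr (`| _ |); ring.
Qed.

End ComplexExp.

Section CauchyEstimate.
Variable R : realType.
Local Notation mu := (@lebesgue_measure R).
Local Notation "'Int' a b f" := (\int[mu]_(t in `[a, b]) f t)
  (at level 10, a at level 8, b at level 8, f at level 8).

Lemma expc_period (z : Cx R) : expc (z + mkC 0 (pi + pi)) = expc z.
Proof.
rewrite expcD; have -> : expc (mkC 0 (pi + pi) : Cx R) = 1; last by rewrite mulr1.
by apply: Cx_ext; rewrite /expc !ReImE expR0 ?cosDpi ?sinDpi ?cospi ?sinpi; ring.
Qed.

Lemma expc_period' (z : Cx R) : expc (z - mkC 0 (pi + pi)) = expc z.
Proof. by rewrite -(expc_period (z - _)) subrK. Qed.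

Definition cderiv0 (g : Cx R -> Cx R) (K : Cx R) := forall e, 0 < e ->
  exists2 d : R, 0 < d & forall h, cabs h < d ->
    cabs (g h - g 0 - K * h) <= e * cabs h.

(* With F w = (g (e^w) - g 0) e^-w, the integral of Re F over a vertical segment
   of length 2 pi does not depend on Re w; as Re w tends to -oo, F tends to K. *)
Lemma cauchy_estimate_Re (g : Cx R -> Cx R) (K : Cx R) (r M : R) : 0 < r ->
  cderiv0 g K ->
  (forall z, cabs z <= r -> differentiable g z) ->
  (forall z, cabs z <= r -> cabs (g z - g 0) <= M) ->
  `|ReC K| <= M / r.
Proof.
move=> r0 gK dg gM.
pose L : R := pi + pi; have Lp : 0 < L by rewrite addr_gt0 // pi_gt0.
pose F w := (g (expc w) - g 0) * expc (- w).
have ex u v : u <= ln r -> cabs (expc (mkC u v)) <= r.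
  by rewrite cabs_expc /= => h; rewrite -(lnK r0) ler_expR.
have dF u v : u <= ln r -> differentiable F (mkC u v).
  move=> /(ex u v) h; apply: differentiableM.
    apply: differentiableB; last exact: differentiable_cst.
    apply: differentiable_comp; first exact: expc_differentiable.
    exact: dg.
  apply: (@differentiable_comp _ _ _ _ -%R (@expc R)); last exact: expc_differentiable.
  by apply: differentiableN; exact: ex_diff.
pose P u v := ImC (F (mkC u v)); pose Q u v := ReC (F (mkC u v)).
have cl u v : u <= ln r -> closed_form_at P Q u v by move=> /(dF u v)/holomorphic_closed.
have per u v : F (mkC u (v + L)) = F (mkC u v).
  have -> : mkC u (v + L) = mkC u v + mkC 0 L by apply: Cx_ext; rewrite !ReImE ?addr0.
  by rewrite /F opprD expc_period expc_period'.
have P0L u : P u L = P u 0 by rewrite /P -(per u 0) add0r.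
have cQ u v : u <= ln r -> {for v, continuous (Q u)}.
  by move=> /(cl u v) [a [b [c [_ /diff_at_cont [_ ?]]]]].
pose I x := Int 0 L (Q x).
(* Goursat on a square whose side is the period 2 pi: the horizontal sides cancel by periodicity, so
   the two vertical integrals agree. Squares suffice because Re w may go to -oo in steps of 2 pi. *)
have I1 x : x + L <= ln r -> I (x + L) = I x.
  move=> hx; have := @goursat _ P Q x 0 L Lp.
  rewrite /circ => H; have {H} := H _; rewrite add0r.
  have -> : Int x (x + L) (fun u => P u 0 - P u L) = 0.
    apply/eqP; rewrite -normr_le0.
    have := @Int_bound _ x (x + L) (fun u => P u 0 - P u L) 0 0.
    rewrite !mul0r subr0; apply; first by rewrite lerDl ltW.
      move=> t _; have -> : (fun u => P u 0 - P u L) = fun=> 0.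
        by apply/funext => u; rewrite P0L subrr.
      exact: cst_continuous.
    by move=> t _; rewrite P0L !subrr normr0.
  rewrite add0r Int_sub; last 2 first.
    by move=> t _; apply: cQ.
    by move=> t _; apply: cQ; apply: le_trans hx; rewrite lerDl ltW.
  move=> H; apply/eqP; rewrite -subr_eq0; apply/eqP/H.
  move=> u v /and4P[a1 a2 a3 a4]; apply: cl; exact: le_trans hx.
have I2 k : I (ln r - L *+ k) = I (ln r).
  elim: k => [|k IH]; first by rewrite mulr0n subr0.
  rewrite -IH -I1; first by congr I; rewrite mulrS; ring.
  rewrite mulrS; have -> : ln r - (L + L *+ k) + L = ln r - L *+ k by ring.
  by rewrite gerBl; apply: mulrn_wge0; exact: ltW.
have FM v : cabs (F (mkC (ln r) v)) <= M / r.
  rewrite /F cabsM cabs_expc ReCN ReCmk expRN lnK // ler_pM2r ?invr_gt0 //.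
  exact/gM/ex.
have c0 u : u <= ln r -> cont_on 0 L (Q u) by move=> h t _; exact: cQ.
have B1 : `|I (ln r)| <= M / r * L.
  have := @Int_bound _ 0 L (Q (ln r)) 0 (M / r) (ltW Lp).
  rewrite mul0r !subr0; apply; first exact: c0.
  by move=> t _; rewrite subr0; apply: le_trans (ReC_le _) (FM t).
apply/ler_addgt0Pl => e e0.
have [d d0 hd] := gK e e0.
have [k hk] : exists k, expR (ln r - L *+ k) < d.
  exists (Num.truncn ((ln r - ln d) / L)).+1.
  rewrite -[ltRHS](lnK d0) ltr_expR ltrBlDr -ltrBlDl -mulr_natr mulrC -ltr_pdivrMr //.
  exact: truncnS_gt.
have := I2 k; set x := ln r - L *+ k => Ix.
have xr : x <= ln r by rewrite gerBl; apply: mulrn_wge0; exact: ltW.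
have B2 : `|I x - ReC K * L| <= e * L.
  have := @Int_bound _ 0 L (Q x) (ReC K) e (ltW Lp) (c0 x xr).
  rewrite !subr0; apply => t _.
  rewrite /Q -ReCN -ReCD; apply: le_trans (ReC_le _) _.
  have ed : cabs (expc (mkC x t)) < d by rewrite cabs_expc.
  have H := hd _ ed.
  have ep : 0 < cabs (expc (mkC x t)) by rewrite cabs_expc expR_gt0.
  rewrite -(ler_pM2r ep) -cabsM mulrBl /F -mulrA [expc (- _) * _]mulrC expcNM mulr1.
  exact: H.
rewrite -(ler_pM2r Lp) -{1}(ger0_norm (ltW Lp)) -normrM.
have -> : ReC K * L = I (ln r) - (I x - ReC K * L).
  by rewrite Ix; ring.
apply: le_trans (ler_normB _ _) _; rewrite mulrDl [leRHS]addrC.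
exact: lerD.
Qed.

(** The imaginary part of K is, up to sign, the real part of the derivative i K of i g; the
    resulting factor 2 is harmless. *)
Lemma cauchy_estimate (g : Cx R -> Cx R) (K : Cx R) (r M : R) : 0 < r ->
  cderiv0 g K ->
  (forall z, cabs z <= r -> differentiable g z) ->
  (forall z, cabs z <= r -> cabs (g z - g 0) <= M) ->
  cabs K <= M / r + M / r.
Proof.
move=> r0 gK dg gM; apply: le_trans (cabs_le _) _; apply: lerD.
  exact: (cauchy_estimate_Re r0 gK).
pose i : Cx R := mkC 0 1; have ci : cabs i = 1 by rewrite cabs_imag normr1.
have -> : `|ImC K| = `|ReC (i * K)| by rewrite ReCM mul0r mul1r sub0r normrN.
apply: (@cauchy_estimate_Re (fun z => i * g z)) => // [e e0|z /dg h|z /gM h].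
- have [d d0 hd] := gK e e0; exists d => // h /hd.
  by rewrite -mulrA -!mulrBr cabsM ci mul1r.
- by apply: differentiableM => //; exact: differentiable_cst.
- by rewrite -mulrBr cabsM ci mul1r.
Qed.

End CauchyEstimate.

(** * Continuity of the tangent changes of coordinates *)

Section JacobianContinuity.
Variables (R : realType) (n : nat).

Lemma cderiv0B (g1 g2 : Cx R -> Cx R) K1 K2 : cderiv0 g1 K1 -> cderiv0 g2 K2 ->
  cderiv0 (fun t => g1 t - g2 t) (K1 - K2).
Proof.
move=> c1 c2 s s0; have s2 : 0 < s / 2 by rewrite divr_gt0.
have [d1 d10 h1] := c1 _ s2; have [d2 d20 h2] := c2 _ s2.
exists (Num.min d1 d2); first by rewrite lt_min d10.
move=> h; rewrite lt_min => /andP[/h1 k1 /h2 k2].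
have -> : g1 h - g2 h - (g1 0 - g2 0) - (K1 - K2) * h =
  (g1 h - g1 0 - K1 * h) - (g2 h - g2 0 - K2 * h) by ring.
apply: le_trans (cabsB _ _) _; apply: le_trans (lerD k1 k2) _.
by rewrite -mulrDl -splitr.
Qed.

Lemma cvg_affine T (F : set_system T) (FF : Filter F) (f : T -> 'rV[Cx R]_n)
    (s : T -> Cx R) (e a : 'rV[Cx R]_n) (k : Cx R) :
  f @ F --> a -> s @ F --> k -> (fun t => f t + s t *: e) @ F --> a + k *: e.
Proof.
move=> cf cs; have h := @cvgZr_tmp _ _ _ F FF s k e cs.
have h2 := cvgD cf h; exact: h2.
Qed.

Lemma partial_cderiv0 (f : 'rV[Cx R]_n -> 'rV[Cx R]_n) (z e : 'rV[Cx R]_n) j :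
  differentiable f z ->
  cderiv0 (fun t => f (z + t *: e) 0 j) ('d f z e 0 j).
Proof.
move=> df eps eps0; have dv : derivable f z e by exact: diff_derivable.
have cv : h^-1 *: (f (h *: e + z) - f z) @[h --> 0^'] --> 'd f z e.
  by rewrite -deriveE.
have : (h^-1 *: (f (h *: e + z) - f z)) 0 j @[h --> 0^'] --> 'd f z e 0 j.
  apply: (@continuous_cvg _ _ _ _ _ _ (fun M : 'rV[Cx R]_n => M 0 j)) cv.
  exact: coord_continuous.
move=> /cvgCx_abs /(_ _ eps0) [d' /= /Cx_pos [d d0 ->] hd]; exists d => // t td.
have [->|t0] := eqVneq t 0; first by rewrite mulr0 scale0r addr0 subrr subr0 cabs0 mulr0.
have := hd t; rewrite /= sub0r normrN normCxE mkC_lt => /(_ td t0).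
rewrite cabsBC !mxE => k; rewrite scale0r addr0.
have -> : f (z + t *: e) 0 j - f z 0 j - 'd f z e 0 j * t =
    (t^-1 * (f (t *: e + z) 0 j - f z 0 j) - 'd f z e 0 j) * t.
  by rewrite mulrBl [t^-1 * _]mulrC divfK // [z + _]addrC.
by rewrite cabsM ler_wpM2r ?cabs_ge0 // ltW.
Qed.

Lemma partial_differentiable (f : 'rV[Cx R]_n -> 'rV[Cx R]_n) (z e : 'rV[Cx R]_n) j (t : Cx R) :
  differentiable f (z + t *: e) ->
  differentiable (fun t : Cx R => f (z + t *: e) 0 j) t.
Proof.
move=> df; pose a (t : Cx R) := z + t *: e.
have da : differentiable a t.
  apply: differentiableD; first exact: differentiable_cst.
  by apply: ex_diff.
have dfa : differentiable (f \o a) t by apply: differentiable_comp.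
exact: (differentiable_comp dfa (differentiable_coord _ 0 j)).
Qed.

Lemma compact_Csquare (r : R) : compact [set z : Cx R | `|ReC z| <= r /\ `|ImC z| <= r].
Proof.
pose g (p : R * R) := mkC p.1 p.2 : Cx R.
have -> : [set z : Cx R | `|ReC z| <= r /\ `|ImC z| <= r] =
    g @` (`[- r, r] `*` `[- r, r]).
  apply/seteqP; split=> [z [h1 h2]|_ [[a b] /= [h1 h2] <-]].
    by exists (ReC z, ImC z); rewrite ?/g ?mkCE //=; split; rewrite /= in_itv /= -ler_norml.
  by move: h1 h2; rewrite !in_itv /= -!ler_norml.
apply: continuous_compact; last by apply: compact_setX; exact: segment_compact.
apply: continuous_subspaceT => p; apply/cvgCx; split; rewrite /=; [exact: cvg_fst|exact: cvg_snd].
Qed.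

(* Cauchy's estimate for the difference of the restrictions of f to two
   parallel lines. *)
Lemma partial_continuous (f : 'rV[Cx R]_n -> 'rV[Cx R]_n) (U : set 'rV[Cx R]_n) z0
    (e : 'rV[Cx R]_n) j :
  open U -> (forall z, U z -> differentiable f z) -> U z0 ->
  (fun z => 'd f z e 0 j) @ z0 --> 'd f z0 e 0 j.
Proof.
move=> oU df Uz0.
have [r r0 hr] : exists2 r : R, 0 < r & forall t, `|ReC t| <= r /\ `|ImC t| <= r -> U (z0 + t *: e).
  have h : \forall t \near (0 : Cx R), U (z0 + t *: e).
    have c1 : (fun t : Cx R => z0 + t *: e) @ (0 : Cx R) --> z0 + 0 *: e.
      by apply: (@cvg_affine _ _ (nbhs_filter (0 : Cx R)) (fun=> z0) id); [exact: cvg_cst|exact: cvg_id].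
    by apply: c1; rewrite scale0r addr0; exact: open_nbhs_nbhs.
  have [d' /= /Cx_pos [d d0 ->] hd] := h.
  exists (d / 4); first by rewrite divr_gt0.
  move=> t [t1 t2]; apply: (hd t); rewrite /= sub0r normrN normCxE mkC_lt.
  by apply: le_lt_trans (cabs_le _) _; clear -t1 t2 d0; lra.
apply/(cvgCx_abs (nbhs_filter z0)) => eps eps0.
(* The difference g of the two restrictions varies by at most 2 eta, so Cauchy's estimate yields 4
   eta / r = eps / 2. *)
pose eta := eps * r / 8.
have eta0 : 0 < eta by rewrite divr_gt0 // mulr_gt0.
pose Q z t := U (z + t *: e) /\ cabs (f (z + t *: e) 0 j - f (z0 + t *: e) 0 j) < eta.
(* Compactness of the parameter square makes the closeness of the two restrictions uniform in t. *)
have : \forall z \near z0, [set t : Cx R | `|ReC t| <= r /\ `|ImC t| <= r] `<=` Q z.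
  have /compact_near_coveringP/near_covering_withinP := @compact_Csquare r.
  move=> /(_ _ (nbhs z0) Q); apply => t /hr Ut.
  have c2 : {for (t, z0), continuous (fun p : Cx R * 'rV[Cx R]_n => p.2 + p.1 *: e)}.
    by apply: (@cvg_affine _ _ (nbhs_filter (t, z0)) snd fst); [exact: cvg_snd|exact: cvg_fst].
  have cf z : U z -> {for z, continuous (fun w => f w 0 j)}.
    move=> /df/differentiable_continuous cz.
    apply: (@continuous_comp _ _ _ f (fun M : 'rV[Cx R]_n => M 0 j)) => //.
    exact: coord_continuous.
  have c3 : (fun p : Cx R * 'rV[Cx R]_n => f (p.2 + p.1 *: e) 0 j) @ (t, z0) --> f (z0 + t *: e) 0 j.
    exact: (continuous_comp c2 (cf _ Ut)).
  have c4 : (fun p : Cx R * 'rV[Cx R]_n => f (z0 + p.1 *: e) 0 j) @ (t, z0) --> f (z0 + t *: e) 0 j.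
    have c5 : {for (t, z0), continuous (fun p : Cx R * 'rV[Cx R]_n => z0 + p.1 *: e)}.
      by apply: (@cvg_affine _ _ (nbhs_filter (t, z0)) (fun=> z0) fst); [exact: cvg_cst|exact: cvg_fst].
    exact: (continuous_comp c5 (cf _ Ut)).
  have k1 : \forall p \near (t, z0), U (p.2 + p.1 *: e).
    by apply: c2; exact: open_nbhs_nbhs.
  have eta2 : 0 < eta / 2 by rewrite divr_gt0.
  have k2 := proj1 (cvgCx_abs (nbhs_filter (t, z0)) _ _) c3 _ eta2.
  have k3 := proj1 (cvgCx_abs (nbhs_filter (t, z0)) _ _) c4 _ eta2.
  apply: filterS3 k1 k2 k3 => -[w z] /= q1 q2 q3 _; split=> //.
  set A := f _ 0 j in q2 *; set B := f _ 0 j in q3 *; set C := f _ 0 j in q2 q3.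
  have -> : A - B = (C - B) - (C - A) by ring.
  by apply: le_lt_trans (cabsB _ _) _; clear -q2 q3; lra.
apply: filterS => z hz.
rewrite cabsBC.
have hs t : cabs t <= r -> `|ReC t| <= r /\ `|ImC t| <= r.
  by move=> h; split; [exact: le_trans (ReC_le _) h|exact: le_trans (ImC_le _) h].
pose g t := f (z + t *: e) 0 j - f (z0 + t *: e) 0 j.
have : cabs ('d f z e 0 j - 'd f z0 e 0 j) <= (eta + eta) / r + (eta + eta) / r.
  apply: (@cauchy_estimate _ g) => //.
  - have Uz : U z by have := (hz 0 (hs 0 _)).1; rewrite scale0r addr0 cabs0; apply; exact: ltW.
    exact: cderiv0B (partial_cderiv0 e j (df z Uz)) (partial_cderiv0 e j (df z0 Uz0)).
  - move=> t ht; apply: differentiableB; apply: partial_differentiable; apply: df.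
      exact: (hz t (hs t ht)).1.
    exact: hr (hs t ht).
  move=> t ht; apply: le_trans (cabsB _ _) _; apply: lerD; apply: ltW.
    exact: (hz t (hs t ht)).2.
  by apply: (hz 0 (hs 0 _)).2; rewrite cabs0 ltW.
move=> h; apply: le_lt_trans h _; rewrite /eta.
have -> : (eps * r / 8 + eps * r / 8) / r + (eps * r / 8 + eps * r / 8) / r = eps / 2.
  by field; rewrite gt_eqF.
by clear -eps0; lra.
Qed.

Lemma jacobian_continuous (f : 'rV[Cx R]_n -> 'rV[Cx R]_n) (U : set 'rV[Cx R]_n) z0 i j :
  open U -> (forall z, U z -> differentiable f z) -> U z0 ->
  (fun z => 'J f z i j) @ z0 --> 'J f z0 i j.
Proof.
move=> oU df Uz0.
have JE : (fun z => 'd f z (delta_mx 0 i) 0 j) = (fun z => 'J f z i j).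
  by apply/funext => z; rewrite /jacobian mxE.
have eqc (g1 g2 : 'rV[Cx R]_n -> Cx R) : g1 = g2 ->
    {for z0, continuous g1} -> {for z0, continuous g2} by move=> ->.
exact: eqc JE (@partial_continuous f U z0 (delta_mx 0 i) j oU df Uz0).
Qed.

End JacobianContinuity.

Section CvgAlgebra.
Variables (R : realType) (T : Type) (F : set_system T).
Context {FF : Filter F}.

Lemma cvgCxM (f g : T -> Cx R) (a b : Cx R) :
  f @ F --> a -> g @ F --> b -> (fun t => f t * g t) @ F --> a * b.
Proof. by move=> cf cg; have h := cvgM cf cg; exact: h. Qed.

Lemma cvgCx_sum I (r : seq I) (f : I -> T -> Cx R) (a : I -> Cx R) :
  (forall i, f i @ F --> a i) ->
  (fun t => \sum_(i <- r) f i t) @ F --> \sum_(i <- r) a i.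
Proof.
move=> h; elim: r => [|i r IH].
  rewrite big_nil (_ : (fun t => _) = fun=> 0); first exact: cvg_cst.
  by apply/funext => t; rewrite big_nil.
rewrite big_cons (_ : (fun t => _) = fun t => f i t + \sum_(j <- r) f j t).
  by have hi := cvgD (h i) IH; exact: hi.
by apply/funext => t; rewrite big_cons.
Qed.

Lemma cvgCx_prod I (r : seq I) (f : I -> T -> Cx R) (a : I -> Cx R) :
  (forall i, f i @ F --> a i) ->
  (fun t => \prod_(i <- r) f i t) @ F --> \prod_(i <- r) a i.
Proof.
move=> h; elim: r => [|i r IH].
  rewrite big_nil (_ : (fun t => _) = fun=> 1); first exact: cvg_cst.
  by apply/funext => t; rewrite big_nil.
rewrite big_cons (_ : (fun t => _) = fun t => f i t * \prod_(j <- r) f j t).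
  exact: cvgCxM (h i) IH.
by apply/funext => t; rewrite big_cons.
Qed.

Lemma cvgCx_det n (M : T -> 'M[Cx R]_n) (M0 : 'M[Cx R]_n) :
  (forall i j, (fun t => M t i j) @ F --> M0 i j) ->
  (fun t => \det (M t)) @ F --> \det M0.
Proof.
move=> h; apply: cvgCx_sum => s; apply: cvgCxM; first exact: cvg_cst.
by apply: cvgCx_prod => i; exact: h.
Qed.

End CvgAlgebra.

(** * Charts and the cocycle of Jacobians *)

Section Charts.
Variables (R : realType) (n : nat) (X : topologicalType) (A : set (chart R n X)).
Hypothesis cm : complex_manifold A.
Implicit Types (phi psi chi : chart R n X) (x : X).

Lemma chart_open phi : A phi -> open (cdom phi).
Proof. by move=> /(cm_chart cm) []. Qed.
Lemma chart_codom_open phi : A phi -> open (ccod phi).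
Proof. by move=> /(cm_chart cm) []. Qed.
Lemma chart_cmap_cont phi x : A phi -> cdom phi x -> cmap phi @ x --> cmap phi x.
Proof.
move=> /(cm_chart cm) [op _ c1 _ _] hx.
by move: c1; rewrite continuous_open_subspace // => /(_ x); apply; rewrite inE.
Qed.
Lemma chart_cinv_cont phi z : A phi -> ccod phi z -> cinv phi @ z --> cinv phi z.
Proof.
move=> /(cm_chart cm) [_ op _ c1 _] hx.
by move: c1; rewrite continuous_open_subspace // => /(_ z); apply; rewrite inE.
Qed.
Lemma chart_cmapK phi x : A phi -> cdom phi x -> cinv phi (cmap phi x) = x.
Proof. by move=> /(cm_chart cm) [_ _ _ _ +] hx; apply. Qed.
Lemma chart_near phi x : A phi -> cdom phi x -> \forall y \near x, cdom phi y.
Proof. by move=> /chart_open o hx; exact: open_nbhs_nbhs. Qed.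

Definition overlap phi psi : set 'rV[Cx R]_n :=
  [set z | ccod phi z /\ cdom psi (cinv phi z)].

Lemma overlap_open phi psi : A phi -> A psi -> open (overlap phi psi).
Proof.
move=> Ap As; rewrite openE => z [hz hs]; rewrite /interior.
apply: filterS2 (open_nbhs_nbhs (conj (chart_codom_open Ap) hz)) _; last first.
  exact: (chart_cinv_cont Ap hz (open_nbhs_nbhs (conj (chart_open As) hs))).
by move=> w.
Qed.

Lemma overlap_cmap phi psi x : A phi -> cdom phi x -> cdom psi x ->
  overlap phi psi (cmap phi x).
Proof. by move=> Ap h1 h2; split; [exists x|rewrite chart_cmapK]. Qed.

Lemma overlap_diff phi psi z : A phi -> A psi -> overlap phi psi z ->
  differentiable (transition phi psi) z.
Proof.
move=> Ap As [[x hx <-] h]; rewrite chart_cmapK // in h.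
exact: (cm_compatible cm).
Qed.

Lemma row_jacobian (f : 'rV[Cx R]_n -> 'rV[Cx R]_n) z i : differentiable f z ->
  row i ('J f z) = 'D_(delta_mx 0 i) f z.
Proof. by move=> df; rewrite rowE deriveEjacobian. Qed.

(** Composites of transition maps agree with transition maps only near the point in question, so the
    chain rule has to be applied to germs. *)
Lemma jacobian_near (f g : 'rV[Cx R]_n -> 'rV[Cx R]_n) z :
  differentiable f z -> differentiable g z -> (\forall w \near z, f w = g w) ->
  'J f z = 'J g z.
Proof.
move=> df dg fg; apply/row_matrixP => i.
apply: etrans (row_jacobian i df) _; apply: etrans _ (esym (row_jacobian i dg)).
exact: near_eq_derive.
Qed.

Lemma jacobian_comp (f g : 'rV[Cx R]_n -> 'rV[Cx R]_n) z :
  differentiable f z -> differentiable g (f z) ->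
  'J (g \o f) z = 'J f z *m 'J g (f z).
Proof.
move=> df dg; have dgf := differentiable_comp df dg.
apply/row_matrixP => i; apply: etrans (row_jacobian i dgf) _.
apply: etrans _ (esym (row_mul _ _ _)).
apply: etrans _ (congr1 (fun v => v *m 'J g (f z)) (esym (row_jacobian i df))).
apply: etrans _ (deriveEjacobian _ dg).
apply: etrans (deriveE _ dgf) _; apply: etrans _ (esym (deriveE _ dg)).
rewrite (deriveE _ df).
exact: (congr1 (fun h => h (delta_mx 0 i)) (diff_comp df dg)).
Qed.

Lemma tangent_changeM phi psi chi x : A phi -> A psi -> A chi ->
  cdom phi x -> cdom psi x -> cdom chi x ->
  tangent_change phi chi x = tangent_change phi psi x *m tangent_change psi chi x.
Proof.
move=> Ap As Ac hp hs hc; rewrite /tangent_change.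
have e1 : transition phi psi (cmap phi x) = cmap psi x.
  by rewrite /transition /= chart_cmapK.
have d1 : differentiable (transition phi psi) (cmap phi x).
  exact: (cm_compatible cm).
have d2 : differentiable (transition psi chi) (transition phi psi (cmap phi x)).
  by rewrite e1; exact: (cm_compatible cm).
have d0 : differentiable (transition phi chi) (cmap phi x) by exact: (cm_compatible cm).
have d3 := differentiable_comp d1 d2.
apply: etrans (jacobian_near d0 d3 _) _; last first.
  by apply: etrans (jacobian_comp d1 d2) _; rewrite e1.
have := open_nbhs_nbhs (conj (overlap_open Ap As) (overlap_cmap Ap hp hs)).
apply: filterS => w [[y hy <-]]; rewrite /transition /= chart_cmapK // => hy'.
by rewrite chart_cmapK.
Qed.

Lemma tangent_change1 phi x : A phi -> cdom phi x -> tangent_change phi phi x = 1%:M.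
Proof.
move=> Ap hx; rewrite /tangent_change.
have d0 : differentiable (transition phi phi) (cmap phi x) by exact: (cm_compatible cm).
have d1 : differentiable (@id 'rV[Cx R]_n) (cmap phi x) by exact: ex_diff.
apply: etrans (jacobian_near d0 d1 _) _; last first.
  apply/row_matrixP => i; apply: etrans (row_jacobian i d1) _.
  by rewrite derive_id rowE mulmx1.
have := open_nbhs_nbhs (conj (chart_codom_open Ap) _ : open_nbhs (cmap phi x) (ccod phi)).
move=> /(_ (ex_intro2 _ _ x hx erefl)).
by apply: filterS => w [y hy <-]; rewrite /transition /= chart_cmapK.
Qed.

Lemma tangent_change_cont phi psi x i j : A phi -> A psi -> cdom phi x -> cdom psi x ->
  (fun y => tangent_change phi psi y i j) @ x --> tangent_change phi psi x i j.
Proof.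
move=> Ap As hp hs.
have c := @jacobian_continuous _ _ (transition phi psi) (overlap phi psi) (cmap phi x) i j
  (overlap_open Ap As) (fun z => overlap_diff Ap As) (overlap_cmap Ap hp hs).
exact: (cvg_comp _ _ (chart_cmap_cont Ap hp) c).
Qed.

Lemma det_tangent_change_cont phi psi x : A phi -> A psi -> cdom phi x -> cdom psi x ->
  (fun y => \det (tangent_change phi psi y)) @ x --> \det (tangent_change phi psi x).
Proof.
move=> Ap As hp hs; apply: cvgCx_det => i j; exact: tangent_change_cont.
Qed.

End Charts.

(** * The determinant bundle *)

Section DetBundle.
Variables (R : realType) (n : nat) (X : topologicalType) (A : set (chart R n X)).
Hypothesis cm : complex_manifold A.
Implicit Types (phi psi chi : chart R n X) (x : X) (y : det_bundle A).
#[local] Opaque tangent_change.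

Lemma det_tangent_changeM phi psi chi x : A phi -> A psi -> A chi ->
  cdom phi x -> cdom psi x -> cdom chi x ->
  \det (tangent_change phi chi x) =
  \det (tangent_change psi chi x) * \det (tangent_change phi psi x).
Proof.
move=> Ap As Ac hp hs hc.
apply: etrans (congr1 determinant (tangent_changeM cm Ap As Ac hp hs hc)) _.
by apply: etrans (det_mulmx _ _) _; exact: mulrC.
Qed.

Lemma det_bundle_eq y1 y2 : dbase y1 = dbase y2 ->
  (forall phi, dcoord y1 phi = dcoord y2 phi) -> y1 = y2.
Proof.
case: y1 => x1 c1 p1 q1; case: y2 => x2 c2 p2 q2 /= hx hc.
move: p1 q1 p2 q2; rewrite hx (funext hc) => p1 q1 p2 q2.
by rewrite (Prop_irrelevance p1 p2) (Prop_irrelevance q1 q2).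
Qed.

Lemma det_bundle_ext phi y1 y2 : A phi -> cdom phi (dbase y1) ->
  dbase y1 = dbase y2 -> dcoord y1 phi = dcoord y2 phi -> y1 = y2.
Proof.
move=> Ap h1 hx hc; apply: det_bundle_eq => // psi.
have [[As hs]|ns] := pselect (A psi /\ cdom psi (dbase y1)); last first.
  by rewrite !dout // -hx.
by rewrite (dchange Ap As) // [RHS](dchange Ap As) -?hx // hc.
Qed.

Lemma dscale_change (c : Cx R) y phi psi : A phi -> A psi ->
    cdom phi (dbase y) -> cdom psi (dbase y) ->
  c * dcoord y psi = \det (tangent_change phi psi (dbase y)) * (c * dcoord y phi).
Proof. by move=> Ap As hp hs; rewrite (dchange Ap As hp hs) mulrCA. Qed.

Lemma dscale_out (c : Cx R) y phi : ~ (A phi /\ cdom phi (dbase y)) -> c * dcoord y phi = 0.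
Proof. by move=> h; rewrite dout // mulr0. Qed.

Definition dscale (c : Cx R) y : det_bundle A :=
  @DetBundle R n X A (dbase y) (fun phi => c * dcoord y phi)
    (@dscale_change c y) (@dscale_out c y).

Lemma dcoord_scale c y phi : dcoord (dscale c y) phi = c * dcoord y phi.
Proof. by []. Qed.
Lemma dscale1 y : dscale 1 y = y.
Proof. by apply: det_bundle_eq => //= phi; rewrite mul1r. Qed.
Lemma dscaleA a b y : dscale a (dscale b y) = dscale (a * b) y.
Proof. by apply: det_bundle_eq => //= phi; rewrite mulrA. Qed.
Lemma dscale0 y : dscale 0 y = zero_section A (dbase y).
Proof. by apply: det_bundle_eq => //= phi; rewrite mul0r. Qed.

Section Fibre.
Variables (phi : chart R n X) (x : X) (Ap : A phi) (hx : cdom phi x).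

Definition fibre_coord (z : Cx R) psi : Cx R :=
  if `[< A psi /\ cdom psi x >] then \det (tangent_change phi psi x) * z else 0.

Lemma fibre_change z chi psi : A chi -> A psi -> cdom chi x -> cdom psi x ->
  fibre_coord z psi = \det (tangent_change chi psi x) * fibre_coord z chi.
Proof.
move=> Ac As hc hs; rewrite /fibre_coord !asboolT //.
apply: etrans _ (esym (mulrA _ _ _)); apply: (congr1 (fun a : Cx R => a * z)).
exact: det_tangent_changeM.
Qed.

Lemma fibre_out z psi : ~ (A psi /\ cdom psi x) -> fibre_coord z psi = 0.
Proof. by move=> h; rewrite /fibre_coord asboolF. Qed.

Definition fibre (z : Cx R) : det_bundle A :=
  @DetBundle R n X A x (fibre_coord z) (@fibre_change z) (@fibre_out z).

Lemma dcoord_fibre z : dcoord (fibre z) phi = z.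
Proof.
rewrite /= /fibre_coord asboolT //.
by rewrite (tangent_change1 cm Ap hx) det1 mul1r.
Qed.

Lemma dscale_fibre c z : dscale c (fibre z) = fibre (c * z).
Proof.
apply: (@det_bundle_ext phi); [done|done|done|].
rewrite dcoord_scale.
by rewrite !dcoord_fibre.
Qed.

End Fibre.

Lemma det_nonzeroP y phi : A phi -> cdom phi (dbase y) ->
  det_nonzero y <-> dcoord y phi != 0.
Proof.
move=> Ap hp; split.
  move=> h; apply/eqP => h0; apply: h; exists (dbase y) => //.
  by apply: (@det_bundle_ext phi).
by move=> /eqP h [x _ e]; apply: h; rewrite -e.
Qed.

Lemma dbase_cont y : @dbase R n X A @ y --> dbase y.
Proof.
move=> V; rewrite nbhsE => -[V' [oV' V'y] sub].
have oW : open [set g : det_bundle A | V' (dbase g)].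
  move=> g gV phi Ap hp.
  have : \forall z \near (dbase g : X, dcoord g phi : Cx R), V' z.1.
    exact: (cvg_fst (open_nbhs_nbhs (conj oV' gV))).
  by apply: filterS => z hz g' e1 _; rewrite /= e1.
by apply: filterS (open_nbhs_nbhs (conj oW V'y)) => g; exact: sub.
Qed.

(** Openness in the total space is tested in every trivialization, so a set described through [phi]
    must be transported to each [psi]. This is where continuity of the Jacobian determinants
    enters. *)
Lemma dcoord_cont y phi : A phi -> cdom phi (dbase y) ->
  (fun g : det_bundle A => dcoord g phi) @ y --> dcoord y phi.
Proof.
move=> Ap hp V; rewrite nbhsE => -[V' [oV' V'y] sub].
have oW : open [set g : det_bundle A | cdom phi (dbase g) /\ V' (dcoord g phi)].
  move=> g [gp gV] psi As hs.
  pose G (z : X * Cx R) := \det (tangent_change psi phi z.1) * z.2.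
  have cG : G @ (dbase g : X, dcoord g psi : Cx R) --> dcoord g phi.
    rewrite (dchange As Ap hs gp); apply: cvgCxM; last exact: cvg_snd.
    exact: (cvg_comp _ _ cvg_fst (det_tangent_change_cont cm As Ap hs gp)).
  have k1 : \forall z \near (dbase g : X, dcoord g psi : Cx R), cdom phi z.1.
    exact: (cvg_fst (chart_near cm Ap gp)).
  have k2 : \forall z \near (dbase g : X, dcoord g psi : Cx R), cdom psi z.1.
    exact: (cvg_fst (chart_near cm As hs)).
  have k3 := cG _ (open_nbhs_nbhs (conj oV' gV)).
  apply: filterS3 k1 k2 k3 => z z1 z2 z3 g' e1 e2 /=; rewrite e1; split=> //.
  by rewrite (dchange As Ap) e1 // e2.
apply: filterS (open_nbhs_nbhs (conj oW (conj hp V'y))) => g [_]; exact: sub.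
Qed.

Lemma cvg_det_bundle T (F : set_system T) (FF : Filter F) (f : T -> det_bundle A) y phi :
  A phi -> cdom phi (dbase y) ->
  (fun t => dbase (f t)) @ F --> dbase y ->
  (fun t => dcoord (f t) phi) @ F --> dcoord y phi -> f @ F --> y.
Proof.
move=> Ap hp c1 c2 W; rewrite nbhsE => -[W' [oW' W'y] sub].
have h := oW' y W'y phi Ap hp.
have cp : (fun t => (dbase (f t) : X, dcoord (f t) phi : Cx R)) @ F --> (dbase y, dcoord y phi).
  exact: (cvg_pair c1 c2).
apply: (@filterS _ F _ _ _ _ (cp _ h)) => t ht; apply: sub; exact: ht.
Qed.

Lemma cvg_dscale T (F : set_system T) (FF : Filter F) (c : T -> Cx R) (f : T -> det_bundle A)
    (c0 : Cx R) y :
  c @ F --> c0 -> f @ F --> y -> (fun t => dscale (c t) (f t)) @ F --> dscale c0 y.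
Proof.
move=> cc cf.
have [phi Ap hp] := cm_cover cm (dbase y).
apply: (@cvg_det_bundle _ F FF (fun t => dscale (c t) (f t)) (dscale c0 y) phi Ap hp).
  exact: (cvg_comp _ _ cf (@dbase_cont y)).
exact: (cvgCxM cc (cvg_comp _ _ cf (dcoord_cont Ap hp))).
Qed.

Lemma fibre_continuous phi x (Ap : A phi) (hx : cdom phi x) : continuous (fibre Ap hx).
Proof.
move=> z; apply: (@cvg_det_bundle _ (nbhs z) (nbhs_filter z) (fibre Ap hx) (fibre Ap hx z) phi Ap hx).
  exact: cvg_cst.
rewrite dcoord_fibre (_ : (fun t => _) = id); first exact: cvg_id.
by apply/funext => t; rewrite dcoord_fibre.
Qed.

End DetBundle.

(** * Lifting Lagrangian planes to the determinant bundle *)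

Lemma cvg_mx (K : topologicalType) (m n : nat) T (F : set_system T) (FF : Filter F)
    (f : T -> 'M[K]_(m, n)) (M : 'M[K]_(m, n)) :
  (forall i j, (fun t => f t i j) @ F --> M i j) -> f @ F --> M.
Proof.
move=> h V [P hP sub].
have : \forall t \near F, forall ij : 'I_m * 'I_n, P ij.1 ij.2 (f t ij.1 ij.2).
  by apply: filter_forall => -[i j]; exact: (h i j _ (hP i j)).
by apply: (@filterS _ F) => t ht; apply: sub => i j; exact: (ht (i, j)).
Qed.

Section LagrangianFrames.
Variables (R : realType) (n : nat) (X : topologicalType) (A : set (chart R n X)).
Hypothesis cm : complex_manifold A.
Variable h : metric R n X.
Hypothesis hh : kaehler A h.
Implicit Types (phi psi chi : chart R n X) (x : X) (y : det_bundle A).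
#[local] Opaque tangent_change.

Lemma adjointM p q r (M : 'M[Cx R]_(p, q)) (N : 'M[Cx R]_(q, r)) :
  adjoint (M *m N) = adjoint N *m adjoint M.
Proof. by rewrite /adjoint trmx_mul map_mxM. Qed.

Lemma det_adjoint p (M : 'M[Cx R]_p) : \det (adjoint M) = Num.conj (\det M).
Proof. by rewrite /adjoint det_map_mx det_tr. Qed.

Lemma cabs_conj (z : Cx R) : cabs (Num.conj z) = cabs z.
Proof. by rewrite /cabs !ReImE sqrrN. Qed.

Lemma adjoint_real p q (M : 'M[R]_(p, q)) : adjoint (realmx M) = realmx M^T.
Proof.
by apply/matrixP => i j; rewrite !mxE; apply: Cx_ext; rewrite !ReImE ?oppr0.
Qed.

Lemma realmxM p q r (M : 'M[R]_(p, q)) (N : 'M[R]_(q, r)) :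
  realmx (M *m N) = realmx M *m realmx N.
Proof. exact: (map_mxM (real_complex R)). Qed.

Lemma det_realmx p (M : 'M[R]_p) : \det (realmx M) = mkC (\det M) 0.
Proof. exact: (det_map_mx (real_complex R)). Qed.

Lemma ImC_sum I (r : seq I) (f : I -> Cx R) : ImC (\sum_(i <- r) f i) = \sum_(i <- r) ImC (f i).
Proof. by elim/big_ind2: _ => [|a b c d|i _] //; rewrite ImCD => -> ->. Qed.

Lemma real_form p (G : 'M[Cx R]_p) (a b : 'rV[R]_p) :
  (forall j k, ImC (G j k) = 0) ->
  ImC ((realmx a *m G *m realmx b^T) 0 0) = 0.
Proof.
move=> hG; rewrite mxE ImC_sum big1 // => k _.
rewrite ImCM !mxE !ReImE mulr0 add0r ImC_sum big1 ?mul0r // => j _.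
by rewrite ImCM !mxE hG !ReImE; ring.
Qed.

(** Lagrangian planes are totally real: if w and -i w both lie in one, omega of the two is, up to
    sign, the squared length of w, so w = 0. A complex relation a + i b between the rows of F gives
    such a pair, aF = -i bF. *)
Lemma lagrangian_det_neq0 phi x F : A phi -> cdom phi x ->
  lagrangian_frame h phi x F -> \det F != 0.
Proof.
move=> Ap hx [F1 F2]; apply/negP => /det0P [v v0 vF].
pose a : 'rV[R]_n := \row_j ReC (v 0 j); pose b : 'rV[R]_n := \row_j ImC (v 0 j).
have vE : v = realmx a + (mkC 0 1 : Cx R) *: realmx b.
  by apply/rowP => j; rewrite !mxE; apply: Cx_ext; rewrite !ReImE; ring.
pose u := realmx a *m F; pose w := realmx b *m F.
have uw : u = (mkC 0 (-1) : Cx R) *: w.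
  move: vF; rewrite vE mulmxDl -scalemxAl -/u -/w => /eqP; rewrite addr_eq0 => /eqP ->.
  by rewrite -scaleNr; congr (_ *: _); apply: Cx_ext; rewrite !ReImE ?oppr0.
have form c d : (realmx c *m F) *m h phi x *m adjoint (realmx d *m F) =
    realmx c *m (F *m h phi x *m adjoint F) *m realmx d^T.
  by rewrite adjointM adjoint_real !mulmxA.
have S1 : ImC ((w *m h phi x *m adjoint w) 0 0) = 0 by rewrite form real_form.
have S2 : ImC ((u *m h phi x *m adjoint w) 0 0) = 0 by rewrite form real_form.
have w0 : w = 0.
  apply/eqP/negPn/negP => wn; have := kaehler_pos hh Ap hx wn.
  suff -> : (w *m h phi x *m adjoint w) 0 0 = 0 by rewrite ltxx.
  apply: Cx_ext; rewrite ?S1 //.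
  move: S2; rewrite uw -!scalemxAl mxE ImCM !ReImE S1 mulr0 add0r mulN1r.
  by move=> /eqP; rewrite oppr_eq0 => /eqP.
have b0 : b = 0 by apply: F1.
have a0 : a = 0 by apply: F1; rewrite -/u uw w0 scaler0.
move/eqP: v0; apply; rewrite vE a0 b0.
by apply/rowP => j; rewrite !mxE; apply: Cx_ext; rewrite !ReImE; ring.
Qed.

(** Frames of one plane are related by a real matrix, so the real line spanned by the determinant
    depends on the plane alone. *)
Lemma rspan_det (F F' : 'M[Cx R]_n) : rspan F' `<=` rspan F ->
  exists r : R, \det F' = mkC r 0 * \det F.
Proof.
move=> sub.
have /choice [c hc] : forall j, exists c : 'rV[R]_n, row j F' = realmx c *m F.
  move=> j; apply: sub; exists (delta_mx 0 j).
  apply/rowP => k; rewrite !mxE (bigD1 j) //= !mxE !eqxx big1 ?addr0.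
    by rewrite (_ : mkC _ _ = 1) ?mul1r.
  by move=> i /negPf ij; rewrite !mxE ij andbF (_ : mkC _ _ = 0) ?mul0r.
exists (\det (\matrix_j c j)); rewrite -det_realmx -det_mulmx; congr (\det _).
apply/row_matrixP => j; rewrite hc row_mul; congr (_ *m _).
by apply/rowP => k; rewrite !mxE.
Qed.

Lemma metric_det_neq0 phi x : A phi -> cdom phi x -> \det (h phi x) != 0.
Proof.
move=> Ap hx; apply/negP => /det0P [v v0 vh].
by have := kaehler_pos hh Ap hx v0; rewrite vh mul0mx mxE ltxx.
Qed.

(** Together with [dchange] this says that |d|^2 |det h| is a well-defined squared length on det TX.
    Taking the modulus of det h avoids showing that it is a positive real. *)
Lemma metric_det_change phi psi x : A phi -> A psi -> cdom phi x -> cdom psi x ->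
  cabs (\det (h phi x)) = cabs (\det (tangent_change phi psi x)) ^+ 2 * cabs (\det (h psi x)).
Proof.
move=> Ap As hp hs; rewrite (kaehler_change hh Ap As hp hs) !det_mulmx det_adjoint.
by rewrite !cabsM cabs_conj; ring.
Qed.

Lemma decplx_cont (z : 'rV[Cx R]_n) : @decplx R n @ z --> decplx z.
Proof.
apply: (cvg_mx (nbhs_filter z)) => i j.
have cz k : (fun w : 'rV[Cx R]_n => w 0 k) @ z --> z 0 k by exact: coord_continuous.
case: (split_ordP j) => k ->.
  rewrite (_ : (fun t => _) = fun w : 'rV[Cx R]_n => ReC (w 0 k)); last first.
    by apply/funext => w; rewrite row_mxEl mxE.
  by rewrite row_mxEl mxE; exact: (proj1 (proj1 (cvgCx (nbhs_filter z) _ _) (cz k))).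
rewrite (_ : (fun t => _) = fun w : 'rV[Cx R]_n => ImC (w 0 k)); last first.
  by apply/funext => w; rewrite row_mxEr mxE.
by rewrite row_mxEr mxE; exact: (proj2 (proj1 (cvgCx (nbhs_filter z) _ _) (cz k))).
Qed.

Lemma decplxK (z : 'rV[Cx R]_n) : cplx (decplx z) = z.
Proof.
by apply/rowP => j; rewrite mxE row_mxKl row_mxKr !mxE mkCE.
Qed.

Lemma metric_cont phi (x : X) i j : A phi -> cdom phi x ->
  (fun x' => h phi x' i j) @ x --> h phi x i j.
Proof.
move=> Ap hx; have [sr si] := kaehler_smooth hh i j Ap.
pose w := decplx (cmap phi x).
have hw : ccod phi (cplx w) by rewrite decplxK; exists x.
have cw : (fun y : X => decplx (cmap phi y)) @ x --> w.
  exact: (cvg_comp _ _ (chart_cmap_cont cm Ap hx) (@decplx_cont _)).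
have e (f : Cx R -> R) : \forall p \near x,
    f (h phi (cinv phi (cplx (decplx (cmap phi p)))) i j) = f (h phi p i j).
  by apply: filterS (chart_near cm Ap hx) => y hy; rewrite decplxK (chart_cmapK cm).
have ew : cinv phi (cplx w) = x by rewrite decplxK (chart_cmapK cm).
apply/(cvgCx (nbhs_filter x)); split.
  apply: cvg_trans (near_eq_cvg (e (@ReC R))) _.
  have := cvg_comp _ _ cw (sr 0%N w hw); rewrite /re_coef ew; exact.
apply: cvg_trans (near_eq_cvg (e (@ImC R))) _.
have := cvg_comp _ _ cw (si 0%N w hw); rewrite /im_coef ew; exact.
Qed.

Lemma metric_det_cont phi (x : X) : A phi -> cdom phi x ->
  (fun x' => \det (h phi x')) @ x --> \det (h phi x).
Proof. by move=> Ap hx; apply: cvgCx_det => i j; exact: metric_cont. Qed.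

(* The lifts of the span of a frame F are the two real multiples of det F of
   length 1. *)
Definition is_lift (g : lagr A h) y : Prop := dbase y = gbase g /\
  forall phi F, A phi -> cdom phi (gbase g) -> gplane g phi = rspan F ->
    lagrangian_frame h phi (gbase g) F ->
    (exists r : R, dcoord y phi = mkC r 0 * \det F) /\
    cabs (dcoord y phi) ^+ 2 * cabs (\det (h phi (gbase g))) = 1.

End LagrangianFrames.

Lemma cvgCx_sqr (R : realType) T (F : set_system T) {FF : Filter F} (f : T -> Cx R) (a : Cx R) :
  f @ F --> a -> (fun t => f t ^+ 2) @ F --> a ^+ 2.
Proof. by move=> cf; have c2 := cvgCxM cf cf; exact: c2. Qed.

Section LagrangianLifts.
Variables (R : realType) (n : nat) (X : topologicalType) (A : set (chart R n X)).
Hypothesis cm : complex_manifold A.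
Variable h : metric R n X.
Hypothesis hh : kaehler A h.
Implicit Types (phi psi chi : chart R n X) (y : det_bundle A) (g : lagr A h).
#[local] Opaque tangent_change.
Local Notation metdet phi x := (cabs (\det (h phi x))).

Lemma lagr_ext phi g1 g2 : A phi -> cdom phi (gbase g1) ->
  gbase g1 = gbase g2 -> gplane g1 phi = gplane g2 phi -> g1 = g2.
Proof.
move=> Ap h1 hx hc.
have hp : gplane g1 = gplane g2.
  apply/funext => psi.
  have [[As hs]|ns] := pselect (A psi /\ cdom psi (gbase g1)); last first.
    by rewrite !gout // -hx.
  by rewrite (gchange Ap As) // [RHS](gchange Ap As) -?hx // hc.
case: g1 h1 hx hc hp => x1 c1 p1 q1 r1; case: g2 => x2 c2 p2 q2 r2 /= _ hx _ hc.
move: p1 q1 r1 p2 q2 r2; rewrite hx hc => p1 q1 r1 p2 q2 r2.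
by rewrite (Prop_irrelevance p1 p2) (Prop_irrelevance q1 q2) (Prop_irrelevance r1 r2).
Qed.

Lemma mkC0M (a b : R) (z : Cx R) : mkC a 0 * (mkC b 0 * z) = mkC (a * b) 0 * z.
Proof. by rewrite mulrA -mkCr0M. Qed.

(** One chart and one frame suffice: a change of frame multiplies the determinant by a real number,
    and the length does not depend on the chart. *)
Lemma is_lift_chart g y phi F : A phi -> cdom phi (gbase g) ->
  gplane g phi = rspan F -> lagrangian_frame h phi (gbase g) F -> dbase y = gbase g ->
  (exists r : R, dcoord y phi = mkC r 0 * \det F) ->
  cabs (dcoord y phi) ^+ 2 * metdet phi (gbase g) = 1 -> is_lift g y.
Proof.
move=> Ap hp gF lF yg [r hr] hN; split; first by [].
move=> psi F' As hs gF' lF'.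
have dy : dcoord y psi = \det (tangent_change phi psi (gbase g)) * dcoord y phi.
  by rewrite -yg; apply: dchange => //; rewrite yg.
split.
  have [r' hr'] : exists r' : R, \det (F *m tangent_change phi psi (gbase g)) = mkC r' 0 * \det F'.
    apply: rspan_det; rewrite -gF' (gchange Ap As hp hs) gF => v [c ->].
    by exists (realmx c *m F); [exists c|rewrite mulmxA].
  exists (r * r'); rewrite -mkC0M -hr' det_mulmx dy hr; ring.
by rewrite dy cabsM exprMn -hN (metric_det_change hh Ap As hp hs); ring.
Qed.

Lemma is_liftE g y phi F : is_lift g y -> A phi -> cdom phi (gbase g) ->
  gplane g phi = rspan F -> lagrangian_frame h phi (gbase g) F ->
  exists r : R, dcoord y phi = mkC r 0 * \det F /\
    r ^+ 2 = (cabs (\det F) ^+ 2 * metdet phi (gbase g))^-1.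
Proof.
move=> [yg /(_ phi F) hy] Ap hp gF lF; have [[r hr] hN] := hy Ap hp gF lF.
exists r; split=> //.
move: hN; rewrite hr cabsM cabs_real exprMn real_normK ?num_real // -mulrA => hN.
by rewrite -[RHS]mul1r -hN mulfK //; apply/eqP => e0; move/eqP: hN; rewrite e0 mulr0 eq_sym oner_eq0.
Qed.

Lemma lift_exists g : exists y, is_lift g y.
Proof.
have [phi Ap hp] := cm_cover cm (gbase g).
have [F lF gF] := glagr Ap hp.
have dF := lagrangian_det_neq0 hh Ap hp lF.
have N0 : 0 < cabs (\det F) ^+ 2 * metdet phi (gbase g).
  by rewrite mulr_gt0 ?exprn_gt0 ?cabs_gt0 //; exact: (metric_det_neq0 hh).
pose r := (Num.sqrt (cabs (\det F) ^+ 2 * metdet phi (gbase g)))^-1.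
exists (fibre cm Ap hp (mkC r 0 * \det F)).
apply: (is_lift_chart Ap hp gF lF) => //; rewrite dcoord_fibre; first by exists r.
rewrite cabsM cabs_real exprMn real_normK ?num_real // -mulrA /r exprVn sqr_sqrtr ?(ltW N0) //.
by rewrite mulVf // gt_eqF.
Qed.

Lemma is_liftN g y : is_lift g y -> is_lift g (dscale (-1) y).
Proof.
move=> [yg hy]; split=> // phi F Ap hp gF lF; have [[r hr] hN] := hy phi F Ap hp gF lF.
rewrite dcoord_scale mulN1r cabsN; split=> //; exists (- r); rewrite hr -mulNr; congr (_ * _).
by apply: Cx_ext; rewrite !ReImE ?oppr0.
Qed.

Lemma is_lift_unique g y1 y2 : is_lift g y1 -> is_lift g y2 ->
  y2 = y1 \/ y2 = dscale (-1) y1.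
Proof.
move=> l1 l2; have [phi Ap hp] := cm_cover cm (gbase g).
have [F lF gF] := glagr Ap hp.
have [r1 [d1 s1]] := is_liftE l1 Ap hp gF lF.
have [r2 [d2 s2]] := is_liftE l2 Ap hp gF lF.
have [b1 _] := l1; have [b2 _] := l2.
have /eqP : r2 ^+ 2 = r1 ^+ 2 by rewrite s1 s2.
rewrite eqf_sqr => /orP[/eqP e|/eqP e]; [left|right].
  by apply: (@det_bundle_ext _ _ _ _ phi) => //; rewrite ?b1 ?b2 // d1 d2 e.
apply: (@det_bundle_ext _ _ _ _ phi) => //; rewrite ?b2 ?b1 // dcoord_scale d1 d2 e mulN1r -mulNr.
by congr (_ * _); apply: Cx_ext; rewrite !ReImE ?oppr0.
Qed.

Lemma is_lift_coord_neq0 g y phi : is_lift g y -> A phi -> cdom phi (gbase g) ->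
  dcoord y phi != 0.
Proof.
move=> [yg hy] Ap hp; have [F lF gF] := glagr Ap hp.
have [_ hN] := hy phi F Ap hp gF lF.
apply/eqP => e; move/eqP: hN; rewrite e cabs0 expr0n mul0r eq_sym oner_eq0 //.
Qed.

Lemma is_lift_nonzero g y : is_lift g y -> det_nonzero y.
Proof.
move=> l; have [phi Ap hp] := cm_cover cm (gbase g); have [yg _] := l.
by apply/(det_nonzeroP (y := y) Ap); [rewrite yg|exact: is_lift_coord_neq0 l Ap hp].
Qed.

Definition some_lift g : det_bundle A := projT1 (cid (lift_exists g)).
Lemma some_liftP g : is_lift g (some_lift g).
Proof. exact: projT2 (cid (lift_exists g)). Qed.

(** The square does not see the sign of the lift, so it is a true function of the plane, the
    squared-determinant map behind the Maslov index. Continuity is proved for it, and continuous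
    lifts are recovered as its square roots. *)
Definition lift_sqr phi g : Cx R := dcoord (some_lift g) phi ^+ 2.

Lemma lift_sqrE phi g y : is_lift g y -> dcoord y phi ^+ 2 = lift_sqr phi g.
Proof.
move=> l; rewrite /lift_sqr; have [->|->] := is_lift_unique (some_liftP g) l => //.
by rewrite dcoord_scale mulN1r sqrrN.
Qed.

Lemma lift_sqr_frame phi g F : A phi -> cdom phi (gbase g) ->
  gplane g phi = rspan F -> lagrangian_frame h phi (gbase g) F ->
  lift_sqr phi g =
  mkC (cabs (\det F) ^+ 2 * metdet phi (gbase g))^-1 0 * \det F ^+ 2.
Proof.
move=> Ap hp gF lF; have [r [d s]] := is_liftE (some_liftP g) Ap hp gF lF.
by rewrite /lift_sqr d exprMn -s expr2 -mkCr0M -expr2.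
Qed.

Lemma lift_sqr_change phi psi g : A phi -> A psi -> cdom phi (gbase g) -> cdom psi (gbase g) ->
  lift_sqr psi g = \det (tangent_change phi psi (gbase g)) ^+ 2 * lift_sqr phi g.
Proof.
move=> Ap As hp hs; rewrite /lift_sqr -exprMn; congr (_ ^+ 2).
by have [<- _] := some_liftP g; apply: dchange => //; have [-> _] := some_liftP g.
Qed.

Lemma gbase_cont g : @gbase R n X A h @ g --> gbase g.
Proof.
move=> V; rewrite nbhsE => -[V' [oV' V'y] sub].
have oW : open [set g : lagr A h | V' (gbase g)].
  move=> g' gV phi Ap hp F lF gF.
  have : \forall z \near (gbase g' : X, F : 'M[Cx R]_n), V' z.1.
    exact: (cvg_fst (open_nbhs_nbhs (conj oV' gV))).
  by apply: filterS => z hz g'' e1 _; rewrite /= e1.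
by apply: filterS (open_nbhs_nbhs (conj oW V'y)) => g'; exact: sub.
Qed.

(** In terms of a frame the function is (det F)^2 / (|det F|^2 |det h|), continuous in the base
    point and the frame, and the topology of the planes is the quotient of that of the frames. *)
Lemma lift_sqr_cont phi g : A phi -> cdom phi (gbase g) ->
  lift_sqr phi @ g --> lift_sqr phi g.
Proof.
move=> Ap hp V; rewrite nbhsE => -[V' [oV' V'y] sub].
have oW : open [set g' : lagr A h | cdom phi (gbase g') /\ V' (lift_sqr phi g')].
  move=> g' [gp gV] psi As hs F lF gF.
  pose b : X * 'M[Cx R]_n := (gbase g', F).
  pose G (z : X * 'M[Cx R]_n) : Cx R := \det (tangent_change psi phi z.1) ^+ 2 *
    (mkC (cabs (\det z.2) ^+ 2 * metdet psi z.1)^-1 0 * \det z.2 ^+ 2).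
  have c1 : (fun z : X * 'M[Cx R]_n => \det (tangent_change psi phi z.1)) @ b -->
      \det (tangent_change psi phi (gbase g')).
    exact: (cvg_comp _ _ cvg_fst (det_tangent_change_cont cm As Ap hs gp)).
  have c2 : (fun z : X * 'M[Cx R]_n => \det z.2) @ b --> \det F.
    have cd : (fun M : 'M[Cx R]_n => \det M) @ F --> \det F.
      by apply: (cvgCx_det (FF := nbhs_filter F)) => i j; exact: coord_continuous.
    exact: (cvg_comp _ _ cvg_snd cd).
  have c3 : (fun z : X * 'M[Cx R]_n => metdet psi z.1) @ b --> metdet psi (gbase g').
    have ch : (fun z : X * 'M[Cx R]_n => \det (h psi z.1)) @ b --> \det (h psi (gbase g')).
      exact: (cvg_comp _ _ cvg_fst (metric_det_cont cm hh As hs)).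
    exact: (cvg_comp _ _ ch (@continuous_cabs R _)).
  have N0 : cabs (\det F) ^+ 2 * metdet psi (gbase g') != 0.
    rewrite mulf_neq0 ?expf_neq0 ?cabs_eq0 //; first exact: (lagrangian_det_neq0 hh As hs lF).
    exact: (metric_det_neq0 hh).
  have c4 : (fun z : X * 'M[Cx R]_n => (cabs (\det z.2) ^+ 2 * metdet psi z.1)^-1) @ b -->
      (cabs (\det F) ^+ 2 * metdet psi (gbase g'))^-1.
    apply: cvgV => //; apply: cvgM => //.
    have ca := cvg_comp _ _ c2 (@continuous_cabs R _).
    exact: (cvg_comp _ _ ca (@exprn_continuous _ 2 _)).
  have cG : G @ b --> lift_sqr phi g'.
    rewrite (lift_sqr_change As Ap hs gp) (lift_sqr_frame As hs gF lF).
    have c5 : (fun z : X * 'M[Cx R]_n => (mkC (cabs (\det z.2) ^+ 2 * metdet psi z.1)^-1 0 : Cx R)) @ b -->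
        (mkC (cabs (\det F) ^+ 2 * metdet psi (gbase g'))^-1 0 : Cx R).
      by apply/(cvgCx (nbhs_filter b)); split => //; exact: cvg_cst.
    exact: (cvgCxM (cvgCx_sqr c1) (cvgCxM c5 (cvgCx_sqr c2))).
  have k1 : \forall z \near b, cdom phi z.1 by exact: (cvg_fst (chart_near cm Ap gp)).
  have k2 : \forall z \near b, cdom psi z.1 by exact: (cvg_fst (chart_near cm As hs)).
  have k3 := cG _ (open_nbhs_nbhs (conj oV' gV)).
  apply: filterS3 k1 k2 k3 => z z1 z2 z3 g'' e1 e2 e3 /=; rewrite e1; split=> //.
  rewrite (lift_sqr_change As Ap) ?e1 // (lift_sqr_frame As (F := z.2)) ?e1 //.
apply: filterS (open_nbhs_nbhs (conj oW (conj hp V'y))) => g' [_]; exact: sub.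
Qed.

End LagrangianLifts.

(** * Existence and uniqueness of continuous lifts *)

Section ContinuousLifts.
Variables (R : realType) (n : nat) (X : topologicalType) (A : set (chart R n X)).
Hypothesis cm : complex_manifold A.
Variable h : metric R n X.
Hypothesis hh : kaehler A h.
Implicit Types (phi psi chi : chart R n X) (y : det_bundle A) (g : lagr A h).
#[local] Opaque tangent_change.

(** Continuity of a branch of the square root: if d and d1 lie on the same side of a line, d1 + d is
    at least as far from 0 as the side coordinate of d1 demands. *)
Lemma sqrt_close (d d1 c0 : Cx R) : 0 <= ReC (d * c0) ->
  cabs (d1 - d) * ReC (d1 * c0) <= cabs (d1 ^+ 2 - d ^+ 2) * cabs c0.
Proof.
move=> hd; have -> : d1 ^+ 2 - d ^+ 2 = (d1 - d) * (d1 + d) by ring.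
rewrite cabsM -mulrA ler_wpM2l ?cabs_ge0 // -cabsM.
apply: le_trans (ReC_le _); apply: le_trans (ler_norm _).
by rewrite mulrDl ReCD lerDl.
Qed.

Lemma ReC_sqr_gt0 (w : Cx R) : 0 < ReC (w ^+ 2) -> ReC w != 0.
Proof.
rewrite expr2 ReCM => hw; apply/eqP => w0; move: hw; rewrite w0 mul0r sub0r.
by rewrite oppr_gt0 ltNge -expr2 sqr_ge0.
Qed.

Lemma ReC_norm_sqr (d : Cx R) : d != 0 -> 0 < ReC ((d * Num.conj d) ^+ 2).
Proof.
move=> d0; have -> : d * Num.conj d = mkC (cabs d ^+ 2) 0.
  by rewrite cabs_sqr; apply: Cx_ext; rewrite !ReImE; ring.
by rewrite expr2 -mkCr0M /= mulr_gt0 // exprn_gt0 ?cabs_gt0.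
Qed.

(** The sign is fixed by staying in the open half plane around the lift at t0. On [O] the square of
    (lift times [c0]) has positive real part, so the lift never meets the boundary line of that half
    plane. *)
Lemma local_lift (T : topologicalType) (s : T -> lagr A h) t0 : continuous s ->
  exists (f : T -> det_bundle A) (O : set T), [/\ open O, O t0 &
    forall t, O t -> is_lift (s t) (f t) /\ f @ t --> f t].
Proof.
move=> cs; have [phi Ap hp] := cm_cover cm (gbase (s t0)).
pose c0 := Num.conj (dcoord (some_lift cm hh (s t0)) phi).
have d00 : dcoord (some_lift cm hh (s t0)) phi != 0.
  exact: is_lift_coord_neq0 (some_liftP cm hh _) Ap hp.
pose O : set T := [set t | cdom phi (gbase (s t)) /\ 0 < ReC (lift_sqr cm hh phi (s t) * c0 ^+ 2)].
have cb t : (fun t => gbase (s t)) @ t --> gbase (s t).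
  exact: (cvg_comp _ _ (cs t) (@gbase_cont _ _ _ _ _ _)).
have cq t : cdom phi (gbase (s t)) ->
    (fun t => lift_sqr cm hh phi (s t)) @ t --> lift_sqr cm hh phi (s t).
  move=> ht; have cl := @lift_sqr_cont _ _ _ _ cm h hh phi (s t) Ap ht.
  have ct : s @ t --> s t := cs t.
  exact: (cvg_comp _ _ ct cl).
have oO : open O.
  rewrite openE => t [t1 t2]; rewrite /interior.
  have k1 : \forall t' \near t, cdom phi (gbase (s t')) by exact: cb (chart_near cm Ap t1).
  have c1 : (fun t => ReC (lift_sqr cm hh phi (s t) * c0 ^+ 2)) @ t -->
      ReC (lift_sqr cm hh phi (s t) * c0 ^+ 2).
    have c2 : (fun t => lift_sqr cm hh phi (s t) * c0 ^+ 2) @ t -->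
        lift_sqr cm hh phi (s t) * c0 ^+ 2.
      exact: (cvgCxM (cq t t1) (cvg_cst (c0 ^+ 2))).
    exact: (cvg_comp _ _ c2 (@continuous_ReC R _)).
  have k2 : \forall t' \near t, 0 < ReC (lift_sqr cm hh phi (s t') * c0 ^+ 2).
    exact: c1 (lt_nbhsr t2).
  by apply: filterS2 k1 k2 => t'.
pose f t := let y := some_lift cm hh (s t) in
  if 0 < ReC (dcoord y phi * c0) then y else dscale (-1) y.
have lf t : is_lift (s t) (f t).
  rewrite /f; case: ifP => _; first exact: some_liftP.
  exact: is_liftN (some_liftP cm hh _).
have pf t : O t -> 0 < ReC (dcoord (f t) phi * c0).
  move=> [t1 t2]; rewrite /f; case: ifPn => // hn.
  rewrite dcoord_scale mulN1r mulNr ReCN oppr_gt0 lt_neqAle leNgt hn andbT.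
  by apply: ReC_sqr_gt0; rewrite exprMn.
exists f, O; split=> //.
  split=> //; have -> : lift_sqr cm hh phi (s t0) * c0 ^+ 2 =
    (dcoord (some_lift cm hh (s t0)) phi * c0) ^+ 2 by rewrite exprMn.
  exact: ReC_norm_sqr.
move=> t Ot; split; first exact: lf.
have [t1 t2] := Ot; have [ft _] := lf t.
have hft : cdom phi (dbase (f t)) by rewrite ft.
apply: (@cvg_det_bundle _ _ _ _ _ (nbhs t) (nbhs_filter t) f (f t) phi Ap hft).
  rewrite ft (_ : (fun t => _) = fun t => gbase (s t)); first exact: cb.
  by apply/funext => t'; case: (lf t').
apply/(cvgCx_abs (nbhs_filter t)) => e e0.
have c1 := pf t Ot; set c := ReC _ in c1.
have C0 : 0 < cabs c0 by rewrite cabs_conj cabs_gt0.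
have k1 : \forall t' \near t, O t' by exact: open_nbhs_nbhs.
have /(cvgCx_abs (nbhs_filter t)) /(_ (e * c / cabs c0)) k2 := cq t t1.
have e1 : 0 < e * c / cabs c0 by rewrite divr_gt0 // mulr_gt0.
apply: filterS2 k1 (k2 e1) => t' o1 o2.
have := sqrt_close (dcoord (f t) phi) (ltW (pf t' o1)).
rewrite !(lift_sqrE cm hh phi (lf _)) -/c => H.
rewrite -(ltr_pM2r c1); apply: le_lt_trans H _.
by rewrite -ltr_pdivlMr.
Qed.

End ContinuousLifts.

Section GlobalLifts.
Variables (R : realType) (n : nat) (X : topologicalType) (A : set (chart R n X)).
Hypothesis cm : complex_manifold A.
Variable h : metric R n X.
Hypothesis hh : kaehler A h.
Implicit Types (phi psi chi : chart R n X) (y : det_bundle A) (g : lagr A h).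
#[local] Opaque tangent_change.

Lemma cvg_withinP (T U : topologicalType) (f : T -> U) (B : set T) (t : T) (z : U) :
  (f @ within B (nbhs t) --> z) <->
  (forall V, nbhs z V -> \forall t' \near t, B t' -> V (f t')).
Proof. by split=> H V /H. Qed.

Definition lift_on (T : topologicalType) (s : T -> lagr A h) (B : set T)
    (f : T -> det_bundle A) : Prop :=
  forall t, B t -> is_lift (s t) (f t) /\ f @ within B (nbhs t) --> f t.

Lemma cabs_split (a d : Cx R) : cabs (d - a) < cabs d / 2 -> cabs (d + a) < cabs d / 2 -> False.
Proof.
move=> h1 h2; have := cabsD (d - a) (d + a).
have -> : d - a + (d + a) = mkC 2 0 * d.
  by apply: Cx_ext; rewrite !ReImE; ring.
rewrite cabsM cabs_real ger0_norm //; have := cabs_ge0 d; lra.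
Qed.

(** At each time the lifts agree or are opposite. The sign [ep] is locally constant, because no
    coordinate is within half its size of both d and -d; being continuous and never 0, it cannot
    change, by the intermediate value theorem. *)
Lemma lift_path_unique (s : R -> lagr A h) (u v : R -> det_bundle A) :
  lift_on s `[0, 1] u -> lift_on s `[0, 1] v -> u 0 = v 0 -> u 1 = v 1.
Proof.
move=> lu lv uv0; apply: contrapT => uv1.
pose ep t : R := if pselect (u t = v t) then 1 else -1.
have ep1 t : u t = v t -> ep t = 1 by rewrite /ep; case: pselect.
have epN t : u t <> v t -> ep t = -1 by rewrite /ep; case: pselect.
have cep : {within `[0, 1], continuous ep}.
  apply/subspace_continuousP => t ht.
  suff : \forall t' \near within `[0, 1] (nbhs t), ep t = ep t'.
    move=> H; apply: cvg_trans (near_eq_cvg H) _; exact: cvg_cst.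
  have [phi Ap hp] := cm_cover cm (gbase (s t)).
  have [lut cut] := lu t ht; have [lvt cvt] := lv t ht.
  have [but _] := lut; have [bvt _] := lvt.
  have d0 := is_lift_coord_neq0 lut Ap hp.
  pose d := dcoord (u t) phi; have e0 : 0 < cabs d / 2 by rewrite divr_gt0 // cabs_gt0.
  have hpu : cdom phi (dbase (u t)) by rewrite but.
  have hpv : cdom phi (dbase (v t)) by rewrite bvt.
  have ku := cvg_comp _ _ cut (dcoord_cont cm Ap hpu).
  have kv := cvg_comp _ _ cvt (dcoord_cont cm Ap hpv).
  have FF : Filter (within `[0, 1]%classic (nbhs t)) by exact: within_filter.
  move: ku => /cvgCx_abs /(_ _ e0) ku; move: kv => /cvgCx_abs /(_ _ e0) kv.
  have ki : \forall t' \near within `[0, 1]%classic (nbhs t), `[0, 1]%classic t'.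
    exact: withinT.
  apply: filterS3 ki ku kv => t' it /= q1 q2.
  have [lut' _] := lu t' it; have [lvt' _] := lv t' it.
  have [e1|e1] := pselect (u t = v t); have [e2|e2] := pselect (u t' = v t').
  - by rewrite !ep1.
  - exfalso; have [e3|e3] := is_lift_unique cm lut' lvt'; first by rewrite e3 in e2.
    apply: (@cabs_split (dcoord (u t') phi) d) => //.
    by move: q2; rewrite -e1 e3 dcoord_scale mulN1r opprK.
  - exfalso; have [e3|e3] := is_lift_unique cm lut lvt; first by rewrite e3 in e1.
    apply: (@cabs_split (dcoord (u t') phi) d) => //.
    move: q2; rewrite -e2 e3 dcoord_scale mulN1r -/d => q2.
    by rewrite -cabsN opprD.
  - by rewrite !epN.
have := @IVT R ep 0 1 0 ler01 cep.
rewrite (ep1 0 uv0) (epN 1 uv1) => -[|c _].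
  by rewrite ge_min lerN10 orbT le_max ler01.
by rewrite /ep; case: pselect => _ /eqP; rewrite ?oppr_eq0 oner_eq0.
Qed.

Lemma lift_unique_along (T : topologicalType) (s : T -> lagr A h) (B : set T)
    (f1 f2 : T -> det_bundle A) (gam : R -> T) : lift_on s B f1 -> lift_on s B f2 ->
  continuous gam -> (forall t, 0 <= t <= 1 -> B (gam t)) ->
  f1 (gam 0) = f2 (gam 0) -> f1 (gam 1) = f2 (gam 1).
Proof.
move=> l1 l2 cg gB e0.
have key f : lift_on s B f -> lift_on (s \o gam) `[0, 1] (f \o gam).
  move=> l t; rewrite /= in_itv /= => ht; have [l3 c3] := l _ (gB t ht); split=> //.
  apply/cvg_withinP => V /(proj1 (cvg_withinP _ _ _ _) c3) hV; have := cg t _ hV.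
  apply: (@filterS _ (nbhs t)) => t' k.
  by rewrite /= in_itv /= => ht'; apply: k; exact: gB.
exact: (lift_path_unique (key _ l1) (key _ l2) e0).
Qed.

Lemma lift_onN (T : topologicalType) (s : T -> lagr A h) (B : set T) (f : T -> det_bundle A) :
  lift_on s B f -> lift_on s B (fun t => dscale (-1) (f t)).
Proof.
move=> l t ht; have [l1 c1] := l t ht; split; first exact: is_liftN.
have FF : Filter (within B (nbhs t)) by exact: within_filter.
exact: (cvg_dscale cm FF (cvg_cst (-1 : Cx R)) c1).
Qed.

(** Agreement at [c] spreads along paths inside the intersection, and functions that agree on the
    intersection of two closed sets can be pasted. *)
Lemma lift_glue (T : topologicalType) (s : T -> lagr A h) (B1 B2 : set T)
    (f1 f2 : T -> det_bundle A) c : closed B1 -> closed B2 -> B1 c -> B2 c ->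
  (forall p, B1 p -> B2 p -> exists gam : R -> T, [/\ continuous gam,
     forall t, 0 <= t <= 1 -> B1 (gam t) /\ B2 (gam t), gam 0 = c & gam 1 = p]) ->
  lift_on s B1 f1 -> lift_on s B2 f2 -> exists f, lift_on s (B1 `|` B2) f.
Proof.
move=> cB1 cB2 B1c B2c conn l1 l2.
(* If the lifts are opposite at [c], the second one is replaced by its negative. *)
wlog e0 : f2 l2 / f1 c = f2 c.
  have [l1c _] := l1 c B1c; have [l2c _] := l2 c B2c.
  have [e|e] := is_lift_unique cm l1c l2c => H; first exact: (H f2).
  apply: (H (fun t => dscale (-1) (f2 t))); first exact: lift_onN.
  by rewrite e dscaleA mulrNN mulr1 dscale1.
have sub (B B' : set T) f : B' `<=` B -> lift_on s B f -> lift_on s B' f.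
  move=> BB l t ht; have [l3 c3] := l t (BB t ht); split=> //.
  apply/cvg_withinP => V /(proj1 (cvg_withinP _ _ _ _) c3).
  by apply: filterS => t' k /BB; exact: k.
have e12 p : B1 p -> B2 p -> f1 p = f2 p.
  move=> h1 h2; have [gam [cg gB g0 g1]] := conn p h1 h2.
  rewrite -g1; apply: (@lift_unique_along _ s (B1 `&` B2) f1 f2 gam) => //.
  - exact: (sub B1).
  - exact: (sub B2).
  - by rewrite g0.
pose f p := if pselect (B1 p) then f1 p else f2 p.
have ff1 p : B1 p -> f p = f1 p by rewrite /f; case: pselect.
have ff2 p : B2 p -> f p = f2 p.
  by move=> h2; rewrite /f; case: pselect => // h1; exact: e12.
exists f => p hp; split.
  case: hp => hp; first by rewrite ff1 //; case: (l1 p hp).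
  by rewrite ff2 //; case: (l2 p hp).
have near_in (B : set T) (g : T -> det_bundle A) : closed B -> lift_on s B g -> (forall q, B q -> f q = g q) ->
    forall V, nbhs (f p) V -> \forall q \near p, B q -> V (f q).
  move=> cB l fg V hV; have [Bp|nB] := pselect (B p).
    have [_ c3] := l p Bp; rewrite fg // in hV; have := proj1 (cvg_withinP _ _ _ _) c3 V hV.
    by apply: filterS => q k Bq; rewrite fg //; exact: k.
  have : \forall q \near p, (~` B) q by apply: open_nbhs_nbhs; split=> //; exact: closed_openC.
  by apply: filterS => q nq /nq.
apply/cvg_withinP => V hV; have k1 := near_in B1 f1 cB1 l1 ff1 V hV; have k2 := near_in B2 f2 cB2 l2 ff2 V hV.
apply: filterS2 k1 k2 => q q1 q2 [|]; [exact: q1|exact: q2].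
Qed.

End GlobalLifts.

(** * Lifts of singular simplices *)

Section SimplexCoordinates.
Variable R : realType.
Implicit Types (n k : nat) (f : nat -> R).

(* Barycentric coordinates, extended by 0 outside of [0 .. n]. *)
Definition co n (t : simplex R n) (k : nat) : R :=
  if (k < n.+1)%N then (\val t : 'rV[R]_n.+1) 0 (inord k) else 0.

Definition is_bary n f := (forall k, (k <= n)%N -> 0 <= f k) /\ \sum_(k < n.+1) f k = 1.

Lemma co_ge0 n (t : simplex R n) k : 0 <= co t k.
Proof.
rewrite /co; case: ifP => // _; have := svalP t.
by rewrite inE => -[h _]; exact: h.
Qed.

Lemma co_sum n (t : simplex R n) : \sum_(k < n.+1) co t k = 1.
Proof.
have := svalP t; rewrite inE => -[_ <-].
by apply: eq_bigr => k _; rewrite /co ltn_ord inord_val.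
Qed.

Lemma co_out n (t : simplex R n) k : (n < k)%N -> co t k = 0.
Proof. by rewrite /co ltnS ltnNge => /negPf ->. Qed.

Lemma simplex_ext n (t t' : simplex R n) :
  (forall k, (k <= n)%N -> co t k = co t' k) -> t = t'.
Proof.
move=> h; apply: val_inj; apply/rowP => k.
by have := h k (ltn_ord k); rewrite /co ltn_ord inord_val.
Qed.

Fact vertex_subproof n : is_bary n (fun k => (k == 0%N)%:R).
Proof.
split=> [k _|]; first exact: ler0n.
by rewrite big_ord_recl big1 ?addr0.
Qed.

Fact bary_subproof n f : is_bary n f -> (\row_(k < n.+1) f k) \in @simplex_set R n.
Proof.
move=> [h1 h2]; rewrite inE; split=> [j|]; first by rewrite mxE; apply: h1; rewrite -ltnS.
by rewrite -[RHS]h2; apply: eq_bigr => k _; rewrite mxE.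
Qed.

(* The first vertex, if [f] is not a system of barycentric coordinates. *)
Definition mks n f : simplex R n :=
  match pselect (is_bary n f) with
  | left p => exist _ (\row_(k < n.+1) f k) (bary_subproof p)
  | right _ => exist _ (\row_(k < n.+1) (val k == 0%N)%:R) (bary_subproof (@vertex_subproof n))
  end.

Lemma co_mks n f k : is_bary n f -> (k <= n)%N -> co (mks n f) k = f k.
Proof.
move=> hf kn; rewrite /co ltnS kn /mks; case: pselect => // p /=.
by rewrite mxE inordK.
Qed.

Lemma co_cont n k : continuous (@co n ^~ k).
Proof.
have [kn|kn] := ltnP k n.+1.
  have -> : @co n ^~ k = fun t => (\val t : 'rV[R]_n.+1) 0 (inord k).
    by apply/funext => t; rewrite /co kn.
  move=> t.
  have h : (fun M : 'rV[R]_n.+1 => M 0 (inord k)) @ (\val t : 'rV[R]_n.+1) -->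
    (\val t : 'rV[R]_n.+1) 0 (inord k) by exact: coord_continuous.
  by apply: (cvg_comp _ _ _ h); exact: initial_continuous.
have -> : @co n ^~ k = fun=> 0 by apply/funext => t; rewrite co_out.
exact: cst_continuous.
Qed.

Lemma cvg_simplex n (T : Type) (F : set_system T) (FF : Filter F) (f : T -> simplex R n) t :
  (forall k, (k <= n)%N -> (fun x => co (f x) k) @ F --> co t k) -> f @ F --> t.
Proof.
move=> h V; rewrite nbhsE => -[V' [[U hU <-] V't] sub].
have cv : (fun x => \val (f x) : 'rV[R]_n.+1) @ F --> (\val t : 'rV[R]_n.+1).
  apply: (cvg_mx FF) => i k; rewrite (ord1 i).
  have e (t' : simplex R n) : (\val t' : 'rV[R]_n.+1) 0 k = co t' k.
    by rewrite /co ltn_ord inord_val.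
  rewrite e (_ : (fun x => _) = fun x => co (f x) k); first by apply: h; rewrite -ltnS.
  by apply/funext => x; exact: e.
by apply: (@filterS _ F _ _ _ _ (cv U (open_nbhs_nbhs (conj hU V't)))) => x; exact: sub.
Qed.

Lemma co_face n (i : 'I_n.+2) (t : simplex R n) k : (k <= n.+1)%N ->
  co (face i t) k = if (k < i)%N then co t k else if k == i :> nat then 0 else co t k.-1.
Proof.
move=> kn; rewrite {1}/co ltnS kn /= mxE.
case: unliftP => [j e|e]; last first.
  have -> : k = i :> nat by rewrite -e inordK.
  by rewrite ltnn eqxx.
have ej : k = bump i j by have /(congr1 val) := e; rewrite /= inordK.
have jn : (\val t : 'rV[R]_n.+1) 0 j = co t j by rewrite /co ltn_ord inord_val.
rewrite jn ej /bump; case: (leqP i j) => ij /=.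
  by rewrite add1n ltnNge (leq_trans ij (leqnSn _)) /= gtn_eqF.
by rewrite add0n ij.
Qed.

(** Retraction of the line onto [0, 1]. Through it, segments and retractions onto simplices become
    total maps, continuous on the whole line or plane. *)
Definition clamp (x : R) : R := Num.min 1 (Num.max 0 x).
Lemma clamp_in x : 0 <= clamp x <= 1.
Proof. by rewrite /clamp le_min ler01 le_max lexx /= ge_min lexx. Qed.
Lemma clampE x : 0 <= x <= 1 -> clamp x = x.
Proof. by move=> /andP[h0 h1]; rewrite /clamp (max_idPr h0) (min_idPr h1). Qed.
Lemma clamp_cont : continuous clamp.
Proof.
move=> x.
have h1 : {for x, continuous ((fun=> 0 : R^o) \max (id : R -> R^o))}.
  by apply: continuous_max; [exact: cst_continuous|exact: cvg_id].
exact: (@continuous_min R R (fun=> 1) _ x (@cst_continuous _ _ _ x) h1).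
Qed.

Lemma cvg_mks n (T : Type) (F : set_system T) (FF : Filter F) (g : T -> nat -> R) (g0 : nat -> R) :
  (forall x, is_bary n (g x)) -> is_bary n g0 ->
  (forall k, (k <= n)%N -> (fun x => g x k) @ F --> g0 k) ->
  (fun x => mks n (g x)) @ F --> mks n g0.
Proof.
move=> hg hg0 c; apply: cvg_simplex => k kn; rewrite co_mks //.
by rewrite (_ : (fun x => _) = fun x => g x k); [exact: c|apply/funext => x; rewrite co_mks].
Qed.

Definition segf n (t0 t : simplex R n) (x : R) (k : nat) : R :=
  (1 - clamp x) * co t0 k + clamp x * co t k.

Lemma segf_bary n (t0 t : simplex R n) x : is_bary n (segf t0 t x).
Proof.
have /andP[c0 c1] := clamp_in x.
split=> [k _|]; first by rewrite addr_ge0 // mulr_ge0 ?co_ge0 ?subr_ge0.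
by rewrite big_split /= -!mulr_sumr !co_sum; ring.
Qed.

Definition seg n (t0 t : simplex R n) (x : R) : simplex R n := mks n (segf t0 t x).

Lemma seg_cont n (t0 t : simplex R n) : continuous (seg t0 t).
Proof.
move=> x; apply: (cvg_mks (nbhs_filter x)) => [x'||k _]; try exact: segf_bary.
have c : clamp @ x --> clamp x by exact: clamp_cont.
have c1 : (fun x => 1 - clamp x) @ x --> 1 - clamp x.
  exact: (cvgB (cvg_cst (1 : R)) c).
exact: (cvgD (cvgM c1 (cvg_cst (co t0 k))) (cvgM c (cvg_cst (co t k)))).
Qed.

Lemma seg0 n (t0 t : simplex R n) : seg t0 t 0 = t0.
Proof.
apply: simplex_ext => k kn; rewrite co_mks //; last exact: segf_bary.
by rewrite /segf clampE ?lexx ?ler01 //; ring.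
Qed.

Lemma seg1 n (t0 t : simplex R n) : seg t0 t 1 = t.
Proof.
apply: simplex_ext => k kn; rewrite co_mks //; last exact: segf_bary.
by rewrite /segf clampE ?lexx ?ler01 //; ring.
Qed.

Definition fn1 (a b : R) (k : nat) : R := if k is 0%N then a else b.
Definition fn2 (a b c : R) (k : nat) : R := match k with 0 => a | 1 => b | _ => c end.

Lemma fn1_bary a b : 0 <= a -> 0 <= b -> a + b = 1 -> is_bary 1 (fn1 a b).
Proof.
by move=> a0 b0 ab; split=> [[|k] _|] //; rewrite !big_ord_recl big_ord0 /= addr0.
Qed.
Lemma fn2_bary a b c : 0 <= a -> 0 <= b -> 0 <= c -> a + b + c = 1 -> is_bary 2 (fn2 a b c).
Proof.
by move=> a0 b0 c0 ab; split=> [[|[|k]] _|] //; rewrite !big_ord_recl big_ord0 /= addr0 addrA.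
Qed.

Lemma co_sum1 (t : simplex R 1) : co t 0 + co t 1 = 1.
Proof. by rewrite -(co_sum t) !big_ord_recl big_ord0 addr0. Qed.
Lemma co_sum2 (t : simplex R 2) : co t 0 + co t 1 + co t 2 = 1.
Proof. by rewrite -(co_sum t) !big_ord_recl big_ord0 addr0 addrA. Qed.
End SimplexCoordinates.

Section SimplexLifts.
Variables (R : realType) (n : nat) (X : topologicalType) (A : set (chart R n X)).
Hypothesis cm : complex_manifold A.
Variable h : metric R n X.
Hypothesis hh : kaehler A h.
Implicit Types (phi psi chi : chart R n X) (y : det_bundle A) (g : lagr A h).
#[local] Opaque tangent_change.

Definition rect (a b c d : R) : set (R * R) := [set p | a <= p.1 <= b /\ c <= p.2 <= d].

Lemma rect_closed a b c d : closed (rect a b c d).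
Proof.
have -> : rect a b c d = (fst @^-1` `[a, b]) `&` (snd @^-1` `[c, d]).
  by apply/seteqP; split=> p; rewrite /rect /= !in_itv.
apply: closedI; apply: (proj1 (continuous_closedP _)); try exact: interval_closed.
  by move=> p; exact: cvg_fst.
by move=> p; exact: cvg_snd.
Qed.

Definition segp (p q : R * R) (t : R) : R * R :=
  (p.1 + t * (q.1 - p.1), p.2 + t * (q.2 - p.2)).

Lemma segp_cont p q : continuous (segp p q).
Proof.
move=> t; have c (a b : R) : (fun t => a + t * b) @ t --> a + t * b.
  have ct : (fun t : R => t) @ t --> t by exact: cvg_id.
  exact: (cvgD (cvg_cst a) (cvgM ct (cvg_cst b))).
exact: (cvg_pair (c _ _) (c _ _)).
Qed.

Lemma segp0 p q : segp p q 0 = p.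
Proof. by rewrite /segp !mul0r !addr0; case: p. Qed.
Lemma segp1 p q : segp p q 1 = q.
Proof. by rewrite /segp !mul1r ![_ + (_ - _)]addrC !subrK; case: q. Qed.

Lemma segp_rect a b c d p q t : rect a b c d p -> rect a b c d q -> 0 <= t <= 1 ->
  rect a b c d (segp p q t).
Proof.
move=> [/andP[p1 p2] /andP[p3 p4]] [/andP[q1 q2] /andP[q3 q4]] /andP[t0 t1].
have cvx (u v l : R) : u <= l -> v <= l -> u + t * (v - u) <= l.
  move=> ul vl; have -> : u + t * (v - u) = (1 - t) * u + t * v by ring.
  have -> : l = (1 - t) * l + t * l by ring.
  by apply: lerD; apply: ler_wpM2l => //; rewrite subr_ge0.
have cvx' (u v l : R) : l <= u -> l <= v -> l <= u + t * (v - u).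
  move=> ul vl; have -> : u + t * (v - u) = (1 - t) * u + t * v by ring.
  have -> : l = (1 - t) * l + t * l by ring.
  by apply: lerD; apply: ler_wpM2l => //; rewrite subr_ge0.
by split; apply/andP; split; [exact: cvx'|exact: cvx|exact: cvx'|exact: cvx].
Qed.

Lemma lift_glue_rect (s : R * R -> lagr A h) a b c d a' b' c' d' f1 f2 p :
  rect a b c d p -> rect a' b' c' d' p ->
  lift_on s (rect a b c d) f1 -> lift_on s (rect a' b' c' d') f2 ->
  exists f, lift_on s (rect a b c d `|` rect a' b' c' d') f.
Proof.
move=> h1 h2 l1 l2; apply: (lift_glue cm (c := p)) l1 l2 => //; try exact: rect_closed.
move=> q q1 q2; exists (segp p q); split; [exact: segp_cont| |exact: segp0|exact: segp1].
by move=> t ht; split; exact: segp_rect.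
Qed.

(** Four lifts are glued in two rounds, along vertical edges and then along the horizontal one.
    Intersections of rectangles are convex, so segments provide the paths that gluing asks for. *)
Lemma lift_square (s : R * R -> lagr A h) : continuous s ->
  exists f, lift_on s (rect 0 1 0 1) f.
Proof.
move=> cs.
pose P (x y L : R) := exists f, lift_on s (rect x (x + L) y (y + L)) f.
suff : P 0 0 1 by rewrite /P !add0r.
apply: square_bisection => // [x y L L0|u v _].
  move=> [f1 l1] [f2 l2] [f3 l3] [f4 l4].
  have i1 (z : R) : z <= z <= z + L by apply/andP; split; lra.
  have i2 (z : R) : z <= z + L <= z + L by apply/andP; split; lra.
  have i3 (z : R) : z <= z <= z + L + L by apply/andP; split; lra.
  have [g1 k1] := @lift_glue_rect s _ _ _ _ _ _ _ _ f1 f2 (x + L, y)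
    (conj (i2 x) (i1 y)) (conj (i1 (x + L)) (i1 y)) l1 l2.
  have [g2 k2] := @lift_glue_rect s _ _ _ _ _ _ _ _ f3 f4 (x + L, y + L)
    (conj (i2 x) (i1 (y + L))) (conj (i1 (x + L)) (i1 (y + L))) l3 l4.
  have U (c d : R) : rect x (x + L) c d `|` rect (x + L) (x + L + L) c d =
      rect x (x + L + L) c d.
    apply/seteqP; split=> p.
      by move=> [[/andP[p1 p2] p3]|[/andP[p1 p2] p3]]; split=> //; apply/andP; split; lra.
    move=> [/andP[p1 p2] p3]; case: (lerP p.1 (x + L)) => hp; [left|right].
      by split=> //; apply/andP; split; lra.
    by split=> //; apply/andP; split; lra.
  rewrite U in k1; rewrite U in k2.
  have [g k] := @lift_glue_rect s _ _ _ _ _ _ _ _ g1 g2 (x, y + L)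
    (conj (i3 x) (i2 y)) (conj (i3 x) (i1 (y + L))) k1 k2.
  exists g; rewrite !addrA.
  have <- : rect x (x + L + L) y (y + L) `|` rect x (x + L + L) (y + L) (y + L + L) =
      rect x (x + L + L) y (y + L + L).
    apply/seteqP; split=> p.
      by move=> [[p3 /andP[p1 p2]]|[p3 /andP[p1 p2]]]; split=> //; apply/andP; split; lra.
    move=> [p3 /andP[p1 p2]]; case: (lerP p.2 (y + L)) => hp; [left|right].
      by split=> //; apply/andP; split; lra.
    by split=> //; apply/andP; split; lra.
  exact: k.
have [f [U [hU Uuv hf]]] := local_lift cm hh (u, v) cs.
have /nbhs_ballP [d d0 hd] : nbhs (u, v) U by exact: open_nbhs_nbhs.
exists d => // x y L L0 Ld /and4P[a1 a2 a3 a4] _ _; exists f => p [/andP[p1 p2] /andP[p3 p4]].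
have Up : U p.
  apply: hd; split=> /=; rewrite /ball /= ltr_norml; apply/andP; split; lra.
have [l1 c1] := hf p Up; split=> //.
apply/cvg_withinP => V hV; have := c1 V hV.
by apply: (@filterS _ (nbhs p)) => q hq _.
Qed.

(* Retractions of the plane onto the standard simplices. *)
Definition cosimp1 (p : R * R) : simplex R 1 := mks 1 (fn1 (1 - clamp p.1) (clamp p.1)).
Definition cosimp2 (p : R * R) : simplex R 2 :=
  let b := Num.min (clamp p.2) (1 - clamp p.1) in
  mks 2 (fn2 (1 - clamp p.1 - b) (clamp p.1) b).

Lemma cosimp1_bary (p : R * R) : is_bary 1 (fn1 (1 - clamp p.1) (clamp p.1)).
Proof. have /andP[c0 c1] := clamp_in p.1; by apply: fn1_bary; lra. Qed.

Lemma cosimp2_bary (p : R * R) : let b := Num.min (clamp p.2) (1 - clamp p.1) in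
  is_bary 2 (fn2 (1 - clamp p.1 - b) (clamp p.1) b).
Proof.
move=> b; have /andP[c0 c1] := clamp_in p.1; have /andP[c2 c3] := clamp_in p.2.
have b0 : 0 <= b by rewrite /b le_min c2 subr_ge0.
have b1 : b <= 1 - clamp p.1 by rewrite /b ge_min lexx orbT.
by apply: fn2_bary; lra.
Qed.

Lemma cvg_clamp_comp T (F : set_system T) (FF : Filter F) (f : T -> R) (a : R) :
  f @ F --> a -> (fun t => clamp (f t)) @ F --> clamp a.
Proof. by move=> cf; exact: (cvg_comp _ _ cf (@clamp_cont R a)). Qed.

Lemma cosimp1_cont : continuous cosimp1.
Proof.
move=> p; have c1 : (fun q : R * R => clamp q.1) @ p --> clamp p.1.
  exact: (cvg_clamp_comp _ cvg_fst).
apply: (cvg_mks (nbhs_filter p)) => [q||[|k] _]; try exact: cosimp1_bary.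
  exact: (cvgB (cvg_cst (1 : R)) c1).
exact: c1.
Qed.

Lemma cosimp2_cont : continuous cosimp2.
Proof.
move=> p; have c1 : (fun q : R * R => clamp q.1) @ p --> clamp p.1.
  exact: (cvg_clamp_comp _ cvg_fst).
have c2 : (fun q : R * R => clamp q.2) @ p --> clamp p.2.
  exact: (cvg_clamp_comp _ cvg_snd).
have c3 : (fun q : R * R => 1 - clamp q.1) @ p --> 1 - clamp p.1.
  exact: (cvgB (cvg_cst (1 : R)) c1).
have c4 : (fun q : R * R => Num.min (clamp q.2) (1 - clamp q.1)) @ p -->
    Num.min (clamp p.2) (1 - clamp p.1) by exact: (continuous_min c2 c3).
apply: (cvg_mks (nbhs_filter p)) => [q||[|[|k]] _]; try exact: cosimp2_bary.
- exact: (cvgB c3 c4).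
- exact: c1.
exact: c4.
Qed.

(** Simplices of dimension 1 and 2 are retracts of the square: [s] composed with the retraction is
    lifted on the square, and the lift is restricted to the simplex by the section [j]. *)
Lemma simplex_lift m (s : simplex R m -> lagr A h) : (m == 1%N) || (m == 2%N) ->
  continuous s -> exists2 l : simplex R m -> det_bundle A, continuous l &
    forall t, is_lift (s t) (l t).
Proof.
move=> hm cs.
suff [r [j [cr cj rj jr]]] : exists (r : R * R -> simplex R m) (j : simplex R m -> R * R),
    [/\ continuous r, continuous j, cancel j r & forall t, rect 0 1 0 1 (j t)].
  have csr : continuous (s \o r) by move=> p; apply: continuous_comp; [exact: cr|exact: cs].
  have [f lf] := lift_square csr.
  exists (f \o j) => t; last by have [] := lf (j t) (jr t); rewrite /= rj.
  have [_ /cvg_withinP cf] := lf (j t) (jr t).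
  move=> V hV; have := cj t _ (cf V hV).
  by apply: (@filterS _ (nbhs t)) => t' /= k; apply: k.
case/orP: hm => /eqP e; subst m.
  exists cosimp1, (fun t => (co t 1, 0)); split; [exact: cosimp1_cont| | |] => t.
  - exact: (cvg_pair (@co_cont R 1 1 t) (cvg_cst (0 : R))).
  - have s1 := co_sum1 t; have t1 := co_ge0 t 1; have t0 := co_ge0 t 0.
    apply: simplex_ext => k kn; rewrite co_mks //; last exact: cosimp1_bary.
    rewrite /= clampE; last by apply/andP; split; lra.
    by case: k kn => [|[|k]] //= _; lra.
  have s1 := co_sum1 t; have t1 := co_ge0 t 1; have t0 := co_ge0 t 0.
  by split=> /=; apply/andP; split; lra.
exists cosimp2, (fun t => (co t 1, co t 2)); split; [exact: cosimp2_cont| | |] => t.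
- exact: (cvg_pair (@co_cont R 2 1 t) (@co_cont R 2 2 t)).
- have s1 := co_sum2 t; have t1 := co_ge0 t 1; have t0 := co_ge0 t 0; have t2 := co_ge0 t 2.
  apply: simplex_ext => k kn; rewrite co_mks //; last exact: cosimp2_bary.
  rewrite /= !clampE; try by apply/andP; split; lra.
  rewrite (min_idPl _); last by lra.
  by case: k kn => [|[|[|k]]] //= _; lra.
have s1 := co_sum2 t; have t1 := co_ge0 t 1; have t0 := co_ge0 t 0; have t2 := co_ge0 t 2.
by split=> /=; apply/andP; split; lra.
Qed.

Lemma simplex_lift_unique m (s : simplex R m -> lagr A h) (l l' : simplex R m -> det_bundle A) :
  continuous l -> (forall t, is_lift (s t) (l t)) ->
  continuous l' -> (forall t, is_lift (s t) (l' t)) ->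
  l' = l \/ l' = (fun t => dscale (-1) (l t)).
Proof.
move=> cl ll cl' ll'.
have on f : continuous f -> (forall t, is_lift (s t) (f t)) -> lift_on s setT f.
  move=> cf lf t _; split=> //; apply/cvg_withinP => V hV.
  by have := cf t V hV; apply: (@filterS _ (nbhs t)).
have key (f g : simplex R m -> det_bundle A) t0 : lift_on s setT f -> lift_on s setT g -> f t0 = g t0 -> f = g.
  move=> lf lg e0; apply/funext => t.
  have := @lift_unique_along _ _ _ _ cm _ _ s setT f g (seg t0 t) lf lg (@seg_cont _ _ t0 t).
  by rewrite seg0 seg1; apply.
(* The zero function is not a system of barycentric coordinates, so this is the first vertex, by the
   default of [mks]. *)
pose t0 : simplex R m := mks m (fun=> 0).
have [e|e] := is_lift_unique cm (ll t0) (ll' t0); [left|right].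
  by apply: key e; exact: on.
by apply: key e; [exact: on|apply: lift_onN => //; exact: on].
Qed.

End SimplexLifts.

(** * The Thom cocycle and prisms *)

Section Prism.
Variables (R : realType).

(** Barycentric coordinates of the j-th degeneracy, which merges the vertices j and j + 1. *)
Definition degf m (j : nat) (t : simplex R m.+1) (k : nat) : R :=
  if (k < j)%N then co t k else if k == j then co t j + co t j.+1 else co t k.+1.

Lemma degf_bary m j (t : simplex R m.+1) : (j <= m)%N -> is_bary m (degf j t).
Proof.
move=> jm; split=> [k _|].
  by rewrite /degf; case: ifP => _; [|case: ifP => _]; rewrite ?addr_ge0 ?co_ge0.
have nat_sum p (f : nat -> R) : \sum_(k < p) f k = \sum_(0 <= k < p) f k by rewrite big_mkord.
rewrite nat_sum -(co_sum t) nat_sum (big_cat_nat (n := j)) ?(leq_trans jm) //=.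
rewrite [in RHS](big_cat_nat (n := j)) ?(leq_trans jm) //=; last by rewrite leqW // leqW.
congr (_ + _).
  by rewrite big_nat [RHS]big_nat; apply: eq_bigr => k /andP[_ kj]; rewrite /degf kj.
rewrite big_ltn ?ltnS // [in RHS]big_ltn; last by rewrite ltnS leqW.
rewrite [in RHS]big_ltn // addrA {1}/degf ltnn eqxx; congr (_ + _).
rewrite [RHS]big_add1 /= big_nat [RHS]big_nat; apply: eq_bigr => k /andP[kj _].
by rewrite /degf ltnNge (ltnW kj) /= gtn_eqF.
Qed.

Definition degen m j (t : simplex R m.+1) : simplex R m := mks m (degf j t).

Lemma co_degen m j (t : simplex R m.+1) k : (j <= m)%N -> (k <= m)%N ->
  co (degen j t) k = degf j t k.
Proof. by move=> jm km; rewrite co_mks //; exact: degf_bary. Qed.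

Lemma degen_cont m j : (j <= m)%N -> continuous (@degen m j).
Proof.
move=> jm t; apply: (cvg_mks (nbhs_filter t)) => [x||k _]; try exact: degf_bary.
rewrite /degf; case: ifP => _; first exact: co_cont.
case: ifP => _; last exact: co_cont.
exact: (cvgD (@co_cont R _ j t) (@co_cont R _ j.+1 t)).
Qed.

(** The height in the prism: vertices 0 to j have height 1 and lie on the given simplex, the others
    have height 0 and lie in the zero section. *)
Definition lam m j (t : simplex R m) : R := \sum_(l < j.+1) co t l.

Lemma lam_cont m j : continuous (@lam m j).
Proof.
rewrite /lam; elim: j.+1 => [|p IH] t.
  have -> : (fun t : simplex R m => \sum_(l < 0) co t l) = fun=> 0.
    by apply/funext => x; rewrite big_ord0.
  exact: cst_continuous.
have -> : (fun t : simplex R m => \sum_(l < p.+1) co t l) = fun t => \sum_(l < p) co t l + co t p.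
  by apply/funext => x; rewrite big_ord_recr.
exact: (cvgD (IH t) (@co_cont R _ p t)).
Qed.

Lemma face_cont m (i : 'I_m.+2) : continuous (@face R m i).
Proof.
move=> t; apply: (cvg_simplex (nbhs_filter t)) => k kn.
rewrite co_face //.
have -> : (fun x : simplex R m => co (face i x) k) =
    fun x => if (k < i)%N then co x k else if k == i :> nat then 0 else co x k.-1.
  by apply/funext => x; rewrite co_face.
case: ifP => _; first exact: co_cont.
by case: ifP => _; [exact: cvg_cst|exact: co_cont].
Qed.

End Prism.

Section PrismDet.
Variables (R : realType) (n : nat) (X : topologicalType) (A : set (chart R n X)).
Hypothesis cm : complex_manifold A.
#[local] Opaque tangent_change.

(* The j-th simplex of the triangulation of the homotopy that contracts s to
   the zero section. *)
Definition prism m j (s : simplex R m -> det_bundle A) (t : simplex R m.+1) : det_bundle A :=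
  dscale (mkC (lam j t) 0) (s (degen j t)).

Lemma prism_cont m j (s : simplex R m -> det_bundle A) : (j <= m)%N ->
  continuous s -> continuous (prism j s).
Proof.
move=> jm cs t.
have c1 : (fun t : simplex R m.+1 => mkC (lam j t) 0 : Cx R) @ t --> (mkC (lam j t) 0 : Cx R).
  by apply/(cvgCx (nbhs_filter t)); split; [exact: lam_cont|exact: cvg_cst].
have c2 : (fun t => s (degen j t)) @ t --> s (degen j t).
  exact: (cvg_comp _ _ (@degen_cont R _ _ jm t) (cs (degen j t))).
exact: (cvg_dscale cm (nbhs_filter t) c1 c2).
Qed.

Lemma prism_eq m m' j j' (s : simplex R m -> det_bundle A) (s' : simplex R m' -> det_bundle A)
    (t : simplex R m.+1) (t' : simplex R m'.+1) :
  lam j t = lam j' t' -> s (degen j t) = s' (degen j' t') -> prism j s t = prism j' s' t'.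
Proof. by rewrite /prism => -> ->. Qed.

Variable T : cochain R (det_bundle A) int 2.
Hypothesis T_cocycle : T \in cocycles (R := R) (n := 2) [set: det_bundle A] (@det_nonzero R n X A).

Lemma T_nonzero (s : simplex R 2 -> det_bundle A) : continuous s ->
  (forall t, det_nonzero (s t)) -> T s = 0.
Proof. by move=> cs hs; case/cocyclesP: T_cocycle => h _; apply: h. Qed.

Lemma T_boundary (s : simplex R 3 -> det_bundle A) (i0 i1 i2 i3 : 'I_4) : continuous s ->
  val i0 = 0%N -> val i1 = 1%N -> val i2 = 2%N -> val i3 = 3%N ->
  T (s \o face i0) - T (s \o face i1) + T (s \o face i2) - T (s \o face i3) = 0.
Proof.
move=> cs e0 e1 e2 e3; case/cocyclesP: T_cocycle => _ /(_ s) h.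
have := h (conj cs (fun _ => Logic.I)); rewrite /= !big_ord_recl big_ord0 /=.
have -> : fintype.lift ord0 (fintype.lift ord0 (fintype.lift ord0 ord0)) = i3 by exact/val_inj.
have -> : fintype.lift ord0 (fintype.lift ord0 ord0) = i2 by exact/val_inj.
have -> : fintype.lift ord0 ord0 = i1 by exact/val_inj.
have -> : ord0 = i0 by exact/val_inj.
rewrite /bump /= !exprS expr0; lia.
Qed.

(** The homotopy operator dual to the prism triangulation, with its usual alternating signs,
    evaluated on a path. *)
Definition Tprism (f : simplex R 1 -> det_bundle A) : int := T (prism 0 f) - T (prism 1 f).

(** The homotopy formula: the cocycle identities of the three 3-simplices of the prism are added
    with alternating signs. The two end faces give the zero section and s, inner faces cancel in
    pairs ([same]), and the remaining ones form the prisms over the faces of s ([diff]). *)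
Lemma prism_formula (s : simplex R 2 -> det_bundle A) (i0 i1 i2 : 'I_3) : continuous s ->
  val i0 = 0%N -> val i1 = 1%N -> val i2 = 2%N ->
  T (fun t => zero_section A (dbase (s t))) - T s =
  Tprism (s \o face i0) - Tprism (s \o face i1) + Tprism (s \o face i2).
Proof.
move=> cs e0 e1 e2.
pose d k : 'I_4 := inord k.
have dE k : (k < 4)%N -> val (d k) = k by move=> h; rewrite /= inordK.
have B j : (j <= 2)%N -> T (prism j s \o face (d 0%N)) - T (prism j s \o face (d 1%N)) +
    T (prism j s \o face (d 2%N)) - T (prism j s \o face (d 3%N)) = 0.
  by move=> jm; apply: T_boundary; rewrite ?dE //; exact: prism_cont.
have E00 : prism 0 s \o face (d 0%N) = fun t => zero_section A (dbase (s t)).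
  apply/funext => t; rewrite -dscale0 /prism /=.
  have -> : lam 0 (face (d 0%N) t) = 0 by rewrite /lam big_ord_recl big_ord0 co_face // dE //= addr0.
  congr (dscale _ (s _)).
  by apply: simplex_ext => -[|[|[|k]]] // _; rewrite co_degen // /degf /= !co_face // !dE //= ?add0r.
have E23 : prism 2 s \o face (d 3%N) = s.
  apply/funext => t; rewrite /prism /=.
  have -> : lam 2 (face (d 3%N) t) = 1.
    by rewrite /lam !big_ord_recl big_ord0 !co_face // !dE //= addr0 addrA co_sum2.
  rewrite dscale1; congr (s _).
  by apply: simplex_ext => -[|[|[|k]]] // _; rewrite co_degen // /degf /= !co_face // !dE //= ?addr0.
have same (j i : nat) : (i == 0%N) || (i == 1%N) -> j = i -> prism j s \o face (d i.+1) = prism j.+1 s \o face (d i.+1).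
  move=> hi ->; apply/funext => t /=; apply: prism_eq.
    case/orP: hi => /eqP ->; rewrite /lam !big_ord_recl !big_ord0 !co_face // !dE //=; ring.
  congr (s _); apply: simplex_ext => -[|[|[|k]]] // _; case/orP: hi => /eqP ->;
    rewrite !co_degen // /degf /= !co_face // !dE //=; ring.
have diff (j i j' i' : nat) (k : 'I_3) : val k = i' -> ((j, i, j', i') \in [:: (0, 2, 0, 1); (0, 3, 0, 2); (1, 0, 0, 0);
    (1, 3, 1, 2); (2, 0, 1, 0); (2, 1, 1, 1)]%N) ->
    prism j s \o face (d i) = prism j' (s \o face k).
  move=> ek hi; apply/funext => t /=; apply: prism_eq.
    move: hi ek; rewrite !inE => /or4P[/eqP[-> -> -> ->]|/eqP[-> -> -> ->]|/eqP[-> -> -> ->]|/or3P[] /eqP[-> -> -> ->]] ek;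
    rewrite /lam !big_ord_recl !big_ord0 !co_face // !dE //=; ring.
  congr (s _); move: hi ek; rewrite !inE => /or4P[/eqP[-> -> -> ->]|/eqP[-> -> -> ->]|/eqP[-> -> -> ->]|/or3P[] /eqP[-> -> -> ->]] ek;
  apply: simplex_ext => -[|[|[|l]]] // _;
    rewrite !co_degen // /degf /= !co_face // ?ek !dE //= ?co_degen // /degf /=; ring.
have := B 0%N isT; have := B 1%N isT; have := B 2%N isT.
rewrite E00 E23 -(same 0%N 0%N isT erefl) -(same 1%N 1%N isT erefl) /Tprism.
rewrite (diff 0 2 0 1 i1 e1 isT)%N (diff 0 3 0 2 i2 e2 isT)%N (diff 1 0 0 0 i0 e0 isT)%N.
rewrite (diff 1 3 1 2 i2 e2 isT)%N (diff 2 0 1 0 i0 e0 isT)%N (diff 2 1 1 1 i1 e1 isT)%N.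
by clear; lia.
Qed.

End PrismDet.

(** * Winding numbers *)

Local Notation face20 := (face (@Ordinal 3 0 isT)).
Local Notation face21 := (face (@Ordinal 3 1 isT)).
Local Notation face22 := (face (@Ordinal 3 2 isT)).

Section Winding.
Variable R : realType.
Local Notation C := (Cx R).
Implicit Types (p q r z : C).

Lemma co_face20 (t : simplex R 1) : (co (face20 t) 0 = 0) * (co (face20 t) 1 = co t 0) *
  (co (face20 t) 2 = co t 1).
Proof. by rewrite !co_face. Qed.
Lemma co_face21 (t : simplex R 1) : (co (face21 t) 0 = co t 0) * (co (face21 t) 1 = 0) *
  (co (face21 t) 2 = co t 1).
Proof. by rewrite !co_face. Qed.
Lemma co_face22 (t : simplex R 1) : (co (face22 t) 0 = co t 0) * (co (face22 t) 1 = co t 1) *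
  (co (face22 t) 2 = 0).
Proof. by rewrite !co_face. Qed.

Definition rC (a : R) : C := mkC a 0.

Lemma cvg_rC T (F : set_system T) (FF : Filter F) (f : T -> R) (a : R) (g : T -> C) (b : C) :
  f @ F --> a -> g @ F --> b -> (fun t => rC (f t) * g t) @ F --> rC a * b.
Proof.
move=> cf cg; suff h : (fun t => rC (f t)) @ F --> rC a by exact: (cvgCxM h cg).
by apply/(cvgCx FF); split; [exact: cf|exact: cvg_cst].
Qed.

Lemma cvg_addC T (F : set_system T) (FF : Filter F) (f g : T -> C) (a b : C) :
  f @ F --> a -> g @ F --> b -> (fun t => f t + g t) @ F --> a + b.
Proof. by move=> cf cg; exact: (cvgD cf cg). Qed.

(* In the application, g : simplex R 2 -> C is a simplex of a fibre of the
   determinant bundle and tdeg is the Thom cocycle. *)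
Variable pdeg : (simplex R 1 -> C) -> int.
Variable tdeg : (simplex R 2 -> C) -> int.
Hypothesis pdeg_cobd : forall g : simplex R 2 -> C, continuous g ->
  pdeg (g \o face20) - pdeg (g \o face21) + pdeg (g \o face22) = tdeg g.
Hypothesis tdeg_neq0 : forall g : simplex R 2 -> C, continuous g -> (forall t, g t != 0) -> tdeg g = 0.
Hypothesis tdeg_triangle : tdeg (@triangle R) = 1.

(** An open half plane with inner normal (a, b). Half planes are convex and miss 0, so they take the
    place of continuous arguments: every comparison of paths below happens inside one of them. *)
Definition hplane (a b : R) z := 0 < a * ReC z + b * ImC z.

Lemma hplane_neq0 a b z : hplane a b z -> z != 0.
Proof. by apply: contraTneq => ->; rewrite /hplane !mulr0 addr0 ltxx. Qed.

Lemma hplane2 a b (x y : R) p q : 0 <= x -> 0 <= y -> x + y = 1 ->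
  hplane a b p -> hplane a b q -> hplane a b (rC x * p + rC y * q).
Proof.
rewrite /hplane => x0 y0 xy hp hq; rewrite !ReImE.
rewrite (_ : _ + _ = x * (a * ReC p + b * ImC p) + y * (a * ReC q + b * ImC q)); last by ring.
have [x1|x1] := ltP 0 x.
  by apply: ltr_wpDr; [apply: mulr_ge0 => //; exact: ltW|exact: mulr_gt0].
have -> : x = 0 by lra.
have -> : y = 1 by lra.
by rewrite mul0r add0r mul1r.
Qed.

Lemma pdeg_const z : z != 0 -> pdeg (fun=> z) = 0.
Proof.
move=> z0; have cg : continuous (fun _ : simplex R 2 => z) by exact: cst_continuous.
have := pdeg_cobd cg; rewrite tdeg_neq0 // => <-.
by rewrite subrr add0r.
Qed.

(** The square of the straight-line homotopy is cut into the triangles [g1] and [g2] with common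
    diagonal [d]. Both miss 0, and the sides at the fixed end points are constant paths, of degree
    0. *)
Lemma pdeg_homotopy a b (p q : simplex R 1 -> C) : continuous p -> continuous q ->
  (forall t, hplane a b (p t)) -> (forall t, hplane a b (q t)) ->
  (forall t, co t 1 = 0 -> p t = q t) -> (forall t, co t 0 = 0 -> p t = q t) ->
  pdeg p = pdeg q.
Proof.
move=> cp cq hp hq e0 e1.
pose v0 : simplex R 1 := mks 1 (fn1 1 0); pose v1 : simplex R 1 := mks 1 (fn1 0 1).
have b0 : is_bary 1 (fn1 1 (0 : R)) by apply: fn1_bary; rewrite ?addr0 ?ler01.
have b1 : is_bary 1 (fn1 (0 : R) 1) by apply: fn1_bary; rewrite ?add0r ?ler01.
pose d (t : simplex R 1) : C := rC (co t 0) * p t + rC (co t 1) * q t.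
pose g1 (t : simplex R 2) : C :=
  rC (co t 0 + co t 1) * p (degen 1 t) + rC (co t 2) * q (degen 1 t).
pose g2 (t : simplex R 2) : C :=
  rC (co t 0) * p (degen 0 t) + rC (co t 1 + co t 2) * q (degen 0 t).
have cd j (f : simplex R 1 -> C) : (j <= 1)%N -> continuous f -> continuous (f \o @degen R 1 j).
  by move=> jm cf t; exact: (cvg_comp _ _ (@degen_cont R _ _ jm t) (cf _)).
have cg1 : continuous g1.
  move=> t; apply: (cvg_addC (nbhs_filter t)).
    apply: (cvg_rC (nbhs_filter t)); last exact: (cd 1%N p isT cp t).
    exact: (cvgD (@co_cont R 2 0 t) (@co_cont R 2 1 t)).
  by apply: (cvg_rC (nbhs_filter t)); [exact: co_cont|exact: (cd 1%N q isT cq t)].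
have cg2 : continuous g2.
  move=> t; apply: (cvg_addC (nbhs_filter t)).
    by apply: (cvg_rC (nbhs_filter t)); [exact: co_cont|exact: (cd 0%N p isT cp t)].
  apply: (cvg_rC (nbhs_filter t)); last exact: (cd 0%N q isT cq t).
  exact: (cvgD (@co_cont R 2 1 t) (@co_cont R 2 2 t)).
have n1 t : g1 t != 0.
  apply: (@hplane_neq0 a b); have h0 := co_ge0 t 0; have h1 := co_ge0 t 1.
  by apply: hplane2; rewrite ?co_sum2 ?addr_ge0 ?co_ge0.
have n2 t : g2 t != 0.
  apply: (@hplane_neq0 a b); apply: hplane2; rewrite ?addrA ?co_sum2 ?addr_ge0 ?co_ge0 //.
have v0E t : co t 1 = 0 -> t = v0.
  move=> h; have := co_sum1 t; rewrite h addr0 => h0.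
  by apply: simplex_ext => -[|[|k]] // _; rewrite co_mks.
have v1E t : co t 0 = 0 -> t = v1.
  move=> h; have := co_sum1 t; rewrite h add0r => h0.
  by apply: simplex_ext => -[|[|k]] // _; rewrite co_mks.
have dg := (co_degen, co_face20, co_face21, co_face22).
have rCs x y (z : C) : rC x * z + rC y * z = rC (x + y) * z by rewrite -mulrDl -mkCr0D.
have rC1 : rC 1 = 1 by apply: Cx_ext.
have rC0 : rC 0 = 0 by apply: Cx_ext.
have F10 : g1 \o face20 = fun=> p v1.
  apply/funext => t; rewrite /g1 /= (v1E (degen 1 _)); last by rewrite co_degen // /degf /= co_face20.
  by rewrite (e1 v1) ?co_mks // rCs !co_face20 add0r co_sum1 rC1 mul1r.
have F11 : g1 \o face21 = d.
  apply/funext => t; rewrite /g1 /= (_ : degen 1 _ = t); first by rewrite !co_face21 addr0.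
  apply: simplex_ext => -[|[|k]] // _; rewrite co_degen // /degf /= !co_face21 ?add0r //.
have F12 : g1 \o face22 = p.
  apply/funext => t; rewrite /g1 /= (_ : degen 1 _ = t).
    by rewrite !co_face22 co_sum1 rC1 rC0 mul1r mul0r addr0.
  apply: simplex_ext => -[|[|k]] // _; rewrite co_degen // /degf /= !co_face22 ?addr0 //.
have F20 : g2 \o face20 = q.
  apply/funext => t; rewrite /g2 /= (_ : degen 0 _ = t).
    by rewrite !co_face20 co_sum1 rC1 rC0 mul1r mul0r add0r.
  apply: simplex_ext => -[|[|k]] // _; rewrite co_degen // /degf /= !co_face20 ?add0r //.
have F21 : g2 \o face21 = d.
  apply/funext => t; rewrite /g2 /= (_ : degen 0 _ = t); first by rewrite !co_face21 add0r.
  apply: simplex_ext => -[|[|k]] // _; rewrite co_degen // /degf /= !co_face21 ?addr0 //.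
have F22 : g2 \o face22 = fun=> p v0.
  apply/funext => t; rewrite /g2 /= (v0E (degen 0 _)); last by rewrite co_degen // /degf /= co_face22.
  by rewrite (e0 v0) ?co_mks // rCs !co_face22 addr0 co_sum1 rC1 mul1r.
have := pdeg_cobd cg1; have := pdeg_cobd cg2.
rewrite !tdeg_neq0 // F10 F11 F12 F20 F21 F22 !pdeg_const; first by clear; lia.
  exact: hplane_neq0 (hp v1).
exact: hplane_neq0 (hp v0).
Qed.

Definition sg p q (t : simplex R 1) : C := rC (co t 0) * p + rC (co t 1) * q.

Lemma sg_cont p q : continuous (sg p q).
Proof. by move=> t; apply: (cvg_addC (nbhs_filter t)); apply: (cvg_rC (nbhs_filter t)); try exact: co_cont; exact: cvg_cst. Qed.

Definition tri p q r (t : simplex R 2) : C := rC (co t 0) * p + rC (co t 1) * q + rC (co t 2) * r.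

Lemma tri_cont p q r : continuous (tri p q r).
Proof.
move=> t; apply: (cvg_addC (nbhs_filter t)); last by apply: (cvg_rC (nbhs_filter t)); [exact: co_cont|exact: cvg_cst].
by apply: (cvg_addC (nbhs_filter t)); apply: (cvg_rC (nbhs_filter t)); try exact: co_cont; exact: cvg_cst.
Qed.

Lemma pdeg_tri p q r : pdeg (sg q r) - pdeg (sg p r) + pdeg (sg p q) = tdeg (tri p q r).
Proof.
have rC0 : rC 0 = 0 by apply: Cx_ext.
rewrite -(pdeg_cobd (@tri_cont p q r)).
congr (pdeg _ - pdeg _ + pdeg _); apply/funext => t; rewrite /tri /sg /=.
- by rewrite !co_face20 rC0 mul0r add0r.
- by rewrite !co_face21 rC0 mul0r addr0.
by rewrite !co_face22 rC0 mul0r addr0.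
Qed.

Lemma pdeg_sgD a b p q r : hplane a b p -> hplane a b q -> hplane a b r ->
  pdeg (sg p q) + pdeg (sg q r) = pdeg (sg p r).
Proof.
move=> hp hq hr; have := pdeg_tri p q r; rewrite tdeg_neq0; first by clear; lia.
  exact: tri_cont.
move=> t; apply: (@hplane_neq0 a b); rewrite /hplane /tri !ReImE.
rewrite (_ : _ + _ = co t 0 * (a * ReC p + b * ImC p) + co t 1 * (a * ReC q + b * ImC q)
  + co t 2 * (a * ReC r + b * ImC r)); last by ring.
have s := co_sum2 t; have t0 := co_ge0 t 0; have t1 := co_ge0 t 1; have t2 := co_ge0 t 2.
rewrite /hplane in hp hq hr.
have m0 := mulr_ge0 t0 (ltW hp); have m1 := mulr_ge0 t1 (ltW hq); have m2 := mulr_ge0 t2 (ltW hr).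
have [x0|x0] := ltP 0 (co t 0); first by have := mulr_gt0 x0 hp; lra.
have [x1|x1] := ltP 0 (co t 1); first by have := mulr_gt0 x1 hq; lra.
have x2 : 0 < co t 2 by lra.
by have := mulr_gt0 x2 hr; lra.
Qed.

Lemma pdeg_sg_sym a b p q : hplane a b p -> hplane a b q -> pdeg (sg q p) = - pdeg (sg p q).
Proof.
move=> hp hq; have := pdeg_sgD hp hq hp.
rewrite (_ : sg p p = fun=> p) ?pdeg_const; try exact: hplane_neq0 hp.
  by clear; lia.
apply/funext => t; rewrite /sg -mulrDl -mkCr0D co_sum1 (_ : mkC 1 0 = 1) ?mul1r //.
Qed.

Local Notation I := (mkC 0 1 : C).

Lemma pdeg_triangle (v := mkC (-1) (-1) : C) : pdeg (sg 1 I) + pdeg (sg I v) + pdeg (sg v 1) = 1.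
Proof.
have : tdeg (tri 1 I v) = 1.
  rewrite -tdeg_triangle; congr tdeg; apply/funext => t.
  have co_val k : (k < 3)%N -> (\val t : 'rV[R]_3) 0 (inord k) = co t k by rewrite /co => ->.
  have -> : triangle t = mkC (co t 0 - co t 2) (co t 1 - co t 2) by rewrite /triangle !co_val.
  by rewrite /tri /rC; apply: Cx_ext; rewrite !ReImE; ring.
rewrite -pdeg_tri (@pdeg_sg_sym 1 (-2) v 1); first by clear; lia.
  by rewrite /hplane !ReImE; lra.
by rewrite /hplane !ReImE; lra.
Qed.

(** The Thom class is normalized on the triangle 1, i, -1 - i. Inserting -1 and -i and then removing
    -1 - i keeps each group of three points in one half plane, whose normal is the pair of numbers
    supplied. *)
Lemma pdeg_square : pdeg (sg 1 I) + pdeg (sg I (-1)) + pdeg (sg (-1) (- I)) + pdeg (sg (- I) 1) = 1.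
Proof.
pose v : C := mkC (-1) (-1).
have := pdeg_triangle; rewrite -/v.
have h1 : pdeg (sg I (-1)) + pdeg (sg (-1) v) = pdeg (sg I v).
  by apply: (@pdeg_sgD (-2) 1); rewrite /hplane /v !ReImE; lra.
have h2 : pdeg (sg (-1) v) + pdeg (sg v (- I)) = pdeg (sg (-1) (- I)).
  by apply: (@pdeg_sgD (-1) (-1)); rewrite /hplane /v !ReImE; lra.
have h3 : pdeg (sg v (- I)) + pdeg (sg (- I) 1) = pdeg (sg v 1).
  by apply: (@pdeg_sgD 1 (-2)); rewrite /hplane /v !ReImE; lra.
by move: h1 h2 h3; clear; lia.
Qed.

(* With w = |c| + i c, the half plane Re (conj (w u) z) > 0 contains u, i u, c u and i c u. *)
Lemma pdeg_rotate (u c : C) : u != 0 -> 0 < ReC c -> 0 <= ImC c ->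
  pdeg (sg (u * c) (u * I * c)) =
  pdeg (sg u (u * I)) + pdeg (sg (u * I) (u * I * c)) - pdeg (sg u (u * c)).
Proof.
move=> u0 c1 c2.
pose w : C := (rC (cabs c) + I * c) * u.
have hw z : hplane (ReC w) (ImC w) (u * z) = (0 < cabs u ^+ 2 *
    ((cabs c - ImC c) * ReC z + ReC c * ImC z)).
  by rewrite /hplane cabs_sqr /w !ReImE; congr (0 < _); ring.
have u2 : 0 < cabs u ^+ 2 by rewrite exprn_gt0 // cabs_gt0.
have d0 : 0 < cabs c - ImC c.
  have c0 := cabs_ge0 c.
  rewrite subr_gt0 -(ltr_pXn2r (n := 2)) ?nnegrE // cabs_sqr ltrDr.
  by rewrite exprn_gt0.
have cc : 0 < cabs c by apply: lt_le_trans (ReC_le c); rewrite normr_gt0 gt_eqF.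
have k1 : hplane (ReC w) (ImC w) u.
  by rewrite -(mulr1 u) hw; apply: mulr_gt0 => //; rewrite !ReImE; lra.
have k2 : hplane (ReC w) (ImC w) (u * I).
  by rewrite hw; apply: mulr_gt0 => //; rewrite !ReImE; lra.
have k3 : hplane (ReC w) (ImC w) (u * c).
  rewrite hw; apply: mulr_gt0 => //.
  rewrite (_ : _ + _ = cabs c * ReC c); last by ring.
  exact: mulr_gt0.
have k4 : hplane (ReC w) (ImC w) (u * I * c).
  rewrite -mulrA hw; apply: mulr_gt0 => //; rewrite !ReImE.
  rewrite (_ : _ + _ = ReC c ^+ 2 + ImC c ^+ 2 - cabs c * ImC c); last by ring.
  rewrite -cabs_sqr expr2 -mulrBr; exact: mulr_gt0.
have := pdeg_sgD k1 k2 k4; have := pdeg_sgD k1 k3 k4; clear; lia.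
Qed.

(** The rotation identities for u = 1, i, -1, -i telescope: the segments from u to u c occur once
    with each sign. *)
Lemma pdeg_square_quadrant (c : C) : 0 < ReC c -> 0 <= ImC c ->
  pdeg (sg c (I * c)) + pdeg (sg (I * c) (- c)) + pdeg (sg (- c) (- I * c)) + pdeg (sg (- I * c) c) = 1.
Proof.
move=> c1 c2; rewrite -pdeg_square.
have I0 : I != 0 by rewrite -cabs_gt0 cabs_imag normr1.
have II : I * I = -1 by apply: Cx_ext; rewrite !ReImE; ring.
have h1 := @pdeg_rotate 1 c (oner_neq0 _) c1 c2.
have h2 := @pdeg_rotate I c I0 c1 c2.
have m0 : (-1 : C) != 0 by rewrite oppr_eq0 oner_neq0.
have mI : - I != 0 by rewrite oppr_eq0.
have h3 := @pdeg_rotate (-1) c m0 c1 c2.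
have h4 := @pdeg_rotate (- I) c mI c1 c2.
move: h1 h2 h3 h4; rewrite !(mul1r, mulN1r, mulNr, II, opprK).
by move=> -> -> -> ->; ring.
Qed.

(** One of c, i c, -c, -i c lies in the quadrant Re > 0, Im >= 0, and multiplying c by i permutes
    the four sides cyclically. *)
Lemma pdeg_square_any (c : C) : c != 0 ->
  pdeg (sg c (I * c)) + pdeg (sg (I * c) (- c)) + pdeg (sg (- c) (- (I * c))) + pdeg (sg (- (I * c)) c) = 1.
Proof.
move=> c0.
have Q d : 0 < ReC d -> 0 <= ImC d -> pdeg (sg d (I * d)) + pdeg (sg (I * d) (- d)) +
    pdeg (sg (- d) (- (I * d))) + pdeg (sg (- (I * d)) d) = 1.
  by move=> d1 d2; rewrite -mulNr; exact: pdeg_square_quadrant.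
have II z : I * (I * z) = - z by apply: Cx_ext; rewrite !ReImE; ring.
have c1 : (ReC c != 0) || (ImC c != 0).
  apply: contraT; rewrite negb_or !negbK => /andP[/eqP r /eqP i].
  by move/eqP: c0; case; apply: Cx_ext; rewrite ?r ?i !ReImE.
have [a|a] := ltP 0 (ReC c); have [b|b] := leP 0 (ImC c).
- exact: Q.
- have := Q (I * c); rewrite !ReImE II opprK => q.
  by rewrite -q; [ring|lra|lra].
- have [a0|a0] := eqVneq (ReC c) 0.
    rewrite a0 eqxx /= in c1.
    have := Q (- (I * c)); rewrite !ReImE mulrN II !opprK => q.
    rewrite -q; [ring| |lra].
    by rewrite lt_neqAle eq_sym; apply/andP; split; [|lra]; rewrite (_ : - _ = ImC c) //; ring.
  have [b0|b0] := eqVneq (ImC c) 0.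
    have := Q (- c); rewrite !ReImE mulrN !opprK => q.
    by rewrite -q; [ring| |lra]; rewrite oppr_gt0 lt_neqAle a0.
  have bp : 0 < ImC c by rewrite lt_neqAle eq_sym b0.
  have := Q (- (I * c)); rewrite !ReImE mulrN II !opprK => q.
  by rewrite -q; [ring|lra|lra].
- have [a0|a0] := eqVneq (ReC c) 0.
    have := Q (I * c); rewrite !ReImE II opprK => q.
    by rewrite -q; [ring|lra|lra].
  have := Q (- c); rewrite !ReImE mulrN !opprK => q.
  rewrite -q; [ring| |lra].
  by rewrite oppr_gt0 lt_neqAle a0.
Qed.

Definition arc c (t : simplex R 1) : C := mkC (cos (pi * co t 1)) (sin (pi * co t 1)) * c.

Lemma cvg_cis T (F : set_system T) (FF : Filter F) (f : T -> R) (a : R) :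
  f @ F --> a -> (fun t => mkC (cos (f t)) (sin (f t)) : C) @ F --> (mkC (cos a) (sin a) : C).
Proof.
move=> cf; apply/(cvgCx FF); split.
  exact: (cvg_comp _ _ cf (@continuous_cos R a)).
exact: (cvg_comp _ _ cf (@continuous_sin R a)).
Qed.

Definition quarter c (t : simplex R 1) : C :=
  mkC (cos (pi / 2 * co t 1)) (sin (pi / 2 * co t 1)) * c.

Lemma quarter_cont c : continuous (quarter c).
Proof.
move=> t; have c1 := @co_cont R 1 1 t.
have c2 : (fun t : simplex R 1 => pi / 2 * co t 1) @ t --> pi / 2 * co t 1.
  exact: (cvgM (cvg_cst (pi / 2 : R)) c1).
exact: (cvgCxM (cvg_cis (nbhs_filter t) c2) (cvg_cst c)).
Qed.

(** A quarter circle and its chord lie in the half plane with normal (1 + i) c, unlike a half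
    circle, whose end points are opposite; hence the passage through quarters. *)
Lemma pdeg_quarter (c : C) : c != 0 -> pdeg (quarter c) = pdeg (sg c (I * c)).
Proof.
move=> c0.
have u2 : 0 < cabs c ^+ 2 by rewrite exprn_gt0 // cabs_gt0.
pose w : C := mkC 1 1 * c.
have hw z : hplane (ReC w) (ImC w) (z * c) = (0 < cabs c ^+ 2 * (ReC z + ImC z)).
  by rewrite /hplane cabs_sqr /w !ReImE; congr (0 < _); ring.
have ct (t : simplex R 1) : 0 <= pi / 2 * co t 1 <= (pi : R) / 2.
  have s := co_sum1 t; have t0 := co_ge0 t 0; have t1 := co_ge0 t 1; have p0 := pi_ge0 R.
  apply/andP; split; first by rewrite mulr_ge0 // divr_ge0.
  by rewrite ger_pMr ?divr_gt0 ?pi_gt0 //; lra.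
apply: (@pdeg_homotopy (ReC w) (ImC w)).
- exact: quarter_cont.
- exact: sg_cont.
- move=> t; rewrite /quarter hw; apply: mulr_gt0 => //; rewrite !ReImE.
  have /andP[a0 a1] := ct t; have p0 := pi_gt0 R.
  have s0 : 0 <= sin (pi / 2 * co t 1) by apply: sin_ge0_pi; apply/andP; split; lra.
  have k0 : 0 <= cos (pi / 2 * co t 1) by apply: cos_ge0_pihalf; apply/andP; split; lra.
  have := cos2Dsin2 (pi / 2 * co t 1).
  have [-> e|s1 _] := eqVneq (sin (pi / 2 * co t 1)) 0; last first.
    by apply: ltr_wpDl => //; rewrite lt_neqAle eq_sym s1.
  rewrite addr0 lt_neqAle k0 andbT eq_sym; apply/eqP => k1; move: e; rewrite k1.
  by rewrite expr0n addr0 => /eqP; rewrite eq_sym oner_eq0.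
- move=> t; apply: hplane2; rewrite ?co_ge0 ?co_sum1 //.
    by rewrite -(mul1r c) hw; apply: mulr_gt0 => //; rewrite !ReImE; lra.
  by rewrite hw; apply: mulr_gt0 => //; rewrite !ReImE; lra.
- move=> t h; have := co_sum1 t; rewrite /quarter /sg h addr0 mulr0 cos0 sin0 => ->.
  by apply: Cx_ext; rewrite !ReImE; ring.
- move=> t h; have := co_sum1 t; rewrite /quarter /sg h add0r => ->.
  by rewrite mulr1 cos_pihalf sin_pihalf; apply: Cx_ext; rewrite !ReImE; ring.
Qed.

(** The triangle is collapsed onto the half circle with the middle vertex sent to the angle pi / 2;
    its faces are the half circle and its two quarters. *)
Lemma pdeg_arc (c : C) : c != 0 -> pdeg (arc c) = pdeg (quarter c) + pdeg (quarter (I * c)).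
Proof.
move=> c0.
pose g (t : simplex R 2) : C :=
  mkC (cos (pi * (co t 1 / 2 + co t 2))) (sin (pi * (co t 1 / 2 + co t 2))) * c.
have cg : continuous g.
  move=> t; have c1 := @co_cont R 2 1 t; have c2 := @co_cont R 2 2 t.
  have c3 : (fun t : simplex R 2 => pi * (co t 1 / 2 + co t 2)) @ t --> pi * (co t 1 / 2 + co t 2).
    exact: (cvgM (cvg_cst (pi : R)) (cvgD (cvgM c1 (cvg_cst (2^-1 : R))) c2)).
  exact: (cvgCxM (cvg_cis (nbhs_filter t) c3) (cvg_cst c)).
have ng t : g t != 0.
  rewrite mulf_neq0 // -cabs_eq0; apply/eqP => e.
  have := cabs_sqr (mkC (cos (pi * (co t 1 / 2 + co t 2))) (sin (pi * (co t 1 / 2 + co t 2)))).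
  by rewrite e !ReImE cos2Dsin2 expr0n => /eqP; rewrite eq_sym oner_eq0.
have := pdeg_cobd cg; rewrite tdeg_neq0 //.
have -> : g \o face20 = quarter (I * c).
  apply/funext => t; rewrite /g /quarter /= !co_face20.
  rewrite (_ : pi * _ = pi / 2 * co t 1 + pi / 2); last first.
    by rewrite (_ : co t 0 = 1 - co t 1); [field|have := co_sum1 t; lra].
  by rewrite cosDpihalf sinDpihalf mulrA; congr (_ * _); apply: Cx_ext; rewrite !ReImE; ring.
have -> : g \o face21 = arc c by apply/funext => t; rewrite /g /arc /= !co_face21 mul0r add0r.
have -> : g \o face22 = quarter c.
  apply/funext => t; rewrite /g /quarter /= !co_face22 addr0.
  by rewrite (_ : pi * _ = pi / 2 * co t 1) //; field.
by clear; lia.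
Qed.

Lemma pdeg_circle (c : C) : c != 0 -> pdeg (arc c) + pdeg (arc (- c)) = 1.
Proof.
move=> c0; rewrite -(pdeg_square_any c0).
have I0 : I != 0 by rewrite -cabs_gt0 cabs_imag normr1.
have Ic0 : I * c != 0 by rewrite mulf_neq0.
have II z : I * (I * z) = - z by apply: Cx_ext; rewrite !ReImE; ring.
rewrite !pdeg_arc ?oppr_eq0 // !pdeg_quarter ?mulf_neq0 ?oppr_eq0 // !mulrN !II opprK.
by rewrite addrA.
Qed.

End Winding.

(** * The Maslov cochain *)

Section BoundaryOfBoundary.
Variables (R : realType) (X : topologicalType).

Lemma ev_coeff (K : choiceType) (s : K) (c : {freeg K / int}) :
  ev (fun s' => (s' == s)%:R : int) c = coeff s c.
Proof.
have [hs|hs] := boolP (s \in dom c).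
  rewrite /ev (bigD1_seq s hs (uniq_dom c)) /= eqxx big1 ?addr0; last by move=> i /negPf ->; rewrite mul0rz.
  by rewrite intz.
rewrite coeff_outdom // /ev big_seq big1 // => i hi.
by rewrite (_ : i == s = false) ?mul0rz //; apply: contraNF hs => /eqP <-.
Qed.

Lemma cobd_cobd (f : cochain R X int 0) (s : simplex R 2 -> X) :
  @cobd R X int 2 (@cobd R X int 1 f) s = 0.
Proof.
rewrite /= !big_ord_recl !big_ord0 /=.
have e (i i' : 'I_3) (j j' : 'I_2) : (nat_of_ord i, nat_of_ord j, nat_of_ord i', nat_of_ord j') \in [:: (0, 0, 1, 0); (0, 1, 2, 0); (1, 1, 2, 1)]%N ->
    (s \o face i) \o face j = (s \o face i') \o face j'.
  move=> hi; apply/funext => t /=; congr (s _); apply: simplex_ext => k kn.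
  move: hi kn; rewrite !inE => /or3P[] /eqP[e1 e2 e3 e4]; case: k => [|[|[|k]]] // _;
    rewrite co_face // [RHS]co_face // e1 e3 /= ?co_face // ?e2 ?e4 //=.
rewrite (e ord0 (fintype.lift ord0 ord0) ord0 ord0) // (e ord0 (fintype.lift ord0 (fintype.lift ord0 ord0)) (fintype.lift ord0 ord0) ord0) //.
rewrite (e (fintype.lift ord0 ord0) (fintype.lift ord0 (fintype.lift ord0 ord0)) (fintype.lift ord0 ord0) (fintype.lift ord0 ord0)) //.
rewrite /bump /= !exprS expr0 !mulr1 mulN1r opprK !addr0 !mulrzDl !mulr1z !mulrN1z.
by ring.
Qed.

(** By duality: coefficients are pairings with indicator functions, so the claim reduces to the
    pointwise identity for coboundaries. *)
Lemma bd_bd (c : chain R X 2) : bd (bd c) = 0.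
Proof.
apply/eqP/freeg_eqP => s; rewrite coeff0 -ev_coeff ev_bd ev_bd.
by rewrite (@eq_ev _ _ _ (fun=> 0)) ?ev_fun0 // => s' _; exact: cobd_cobd.
Qed.

End BoundaryOfBoundary.

Section LagrangianClasses.
Variables (R : realType) (n : nat) (X : topologicalType) (A : set (chart R n X)).
Hypothesis cm : complex_manifold A.
Variable h : metric R n X.
Hypothesis hh : kaehler A h.
Variable tau : coh R int 2 [set: det_bundle A] (@det_nonzero R n X A).
Hypothesis htau : thom_det tau.
Implicit Types (phi psi chi : chart R n X) (y : det_bundle A) (g : lagr A h).
#[local] Opaque tangent_change.
Local Notation T := (corep tau).
Local Notation Tcocycle := (corep_cocycle tau).

Definition opp_lift m (l : simplex R m -> det_bundle A) t := dscale (-1) (l t).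

Lemma opp_liftK m (l : simplex R m -> det_bundle A) : opp_lift (opp_lift l) = l.
Proof. by apply/funext => t; rewrite /opp_lift dscaleA mulrNN mulr1 dscale1. Qed.

Lemma opp_lift_cont m (l : simplex R m -> det_bundle A) : continuous l -> continuous (opp_lift l).
Proof.
by move=> cl t; exact: (cvg_dscale cm (nbhs_filter t) (cvg_cst (-1 : Cx R)) (cl t)).
Qed.

(** Cochains are functions on all maps, so a discontinuous [s] needs some value; the zero section is
    a dummy. *)
Definition path_lift (s : simplex R 1 -> lagr A h) : simplex R 1 -> det_bundle A :=
  if pselect (continuous s) is left cs then s2val (cid2 (simplex_lift cm hh (m := 1) isT cs))
  else fun t => zero_section A (gbase (s t)).

Lemma path_liftP s : continuous s ->
  continuous (path_lift s) /\ forall t, is_lift (s t) (path_lift s t).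
Proof.
by move=> cs; rewrite /path_lift; case: pselect => // cs'; case: cid2 => l /=.
Qed.

(* The two lifts of a 2-simplex avoid the zero section, where the Thom cocycle
   vanishes, so the coboundary is twice the Euler cocycle. *)
Definition maslov_cochain (s : simplex R 1 -> lagr A h) : int :=
  Tprism T (path_lift s) + Tprism T (opp_lift (path_lift s)).

Lemma maslov_cochainE s l : continuous s -> continuous l -> (forall t, is_lift (s t) (l t)) ->
  maslov_cochain s = Tprism T l + Tprism T (opp_lift l).
Proof.
move=> cs cl ll; have [cp lp] := path_liftP cs.
have [->|->] := simplex_lift_unique cm cp lp cl ll; first by [].
by rewrite -[fun t => _]/(opp_lift (path_lift s)) opp_liftK addrC.
Qed.

(** A lift of the 2-simplex restricts on each face to one of the two lifts of that face, not
    necessarily the selected one; the symmetric sum does not see which. The prism formula for both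
    lifts then gives the factor 2. *)
Lemma cobd_maslov_cochain (s : simplex R 2 -> lagr A h) : continuous s ->
  @cobd R _ int 2 maslov_cochain s = T (fun t => zero_section A (gbase (s t))) *+ 2.
Proof.
move=> cs; have [l cl ll] := simplex_lift cm hh (m := 2) isT cs.
have sf (i : 'I_3) : continuous (s \o face i).
  by move=> t; exact: (cvg_comp _ _ (@face_cont R 1 i t) (cs _)).
have lf (i : 'I_3) : continuous (l \o face i).
  by move=> t; exact: (cvg_comp _ _ (@face_cont R 1 i t) (cl _)).
have B i : maslov_cochain (s \o face i) = Tprism T (l \o face i) + Tprism T (opp_lift l \o face i).
  by rewrite (maslov_cochainE (sf i) (lf i)) // => t; exact: ll.
rewrite /= !big_ord_recl big_ord0 /= !B.
have z (l' : simplex R 2 -> det_bundle A) : continuous l' -> (forall t, is_lift (s t) (l' t)) ->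
    T (fun t => zero_section A (gbase (s t))) =
    Tprism T (l' \o face ord0) - Tprism T (l' \o face (fintype.lift ord0 ord0)) +
    Tprism T (l' \o face (fintype.lift ord0 (fintype.lift ord0 ord0))).
  move=> cl' ll'; rewrite -(prism_formula cm Tcocycle) //.
  have -> : T l' = 0.
    by apply: (T_nonzero Tcocycle) => // t; exact: (is_lift_nonzero cm (ll' t)).
  by rewrite subr0; congr T; apply/funext => t; have [-> _] := ll' t.
have z1 := z l cl ll.
have z2 := z (opp_lift l) (opp_lift_cont cl) (fun t => is_liftN (ll t)).
rewrite mulr2n {1}z1 z2 /bump /= !exprS expr0 !mulr1 mulN1r opprK !mulr1z !mulrN1z.
by ring.
Qed.

Lemma ev_zero_gbase (W : chain R (lagr A h) 2) : chain_on [set: lagr A h] W ->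
  ev (fun s : simplex R 2 -> lagr A h => T (fun t => zero_section A (gbase (s t)))) W *+ 2 =
  ev maslov_cochain (bd W).
Proof.
move=> hW; rewrite ev_bd mulr2n -ev_funD; apply: (ev_eq_on hW) => s [cs _].
by rewrite cobd_maslov_cochain // mulr2n.
Qed.

Section FibreDegree.
Variables (phi : chart R n X) (x : X) (Ap : A phi) (hx : cdom phi x).
Local Notation iota := (fibre cm Ap hx).

Lemma triangle_cont : continuous (@triangle R).
Proof.
have c (k : nat) : (k < 3)%N -> continuous (fun t : simplex R 2 => (\val t : 'rV[R]_3) 0 (inord k)).
  move=> kn; have -> : (fun t : simplex R 2 => (\val t : 'rV[R]_3) 0 (inord k)) = @co R 2 ^~ k.
    by apply/funext => t; rewrite /co kn.
  exact: co_cont.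
move=> t; apply/(cvgCx (nbhs_filter t)); split.
  exact: (cvgB (c 0%N isT t) (c 2%N isT t)).
exact: (cvgB (c 1%N isT t) (c 2%N isT t)).
Qed.

Lemma iota_neq0 (z : Cx R) : z != 0 -> det_nonzero (iota z).
Proof. by move=> z0; apply/(det_nonzeroP (y := iota z) Ap hx); rewrite dcoord_fibre. Qed.

Lemma iota_cont m (f : simplex R m -> Cx R) : continuous f -> continuous (iota \o f).
Proof. by move=> cf t; apply: continuous_comp; [exact: cf|exact: fibre_continuous]. Qed.

Lemma thom_triangle : T (iota \o @triangle R) = 1.
Proof.
have cl : continuous (iota \o @triangle R) by apply: iota_cont; exact: triangle_cont.
have cyc : (<< iota \o @triangle R >> : chain R (det_bundle A) 2) \in
    cycles (R := R) [set: det_bundle A] (@det_nonzero R n X A).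
  apply/cyclesP; split; first by apply: chain_onU.
  rewrite bdU; apply: chain_on_sum => i; apply: chain_onU; split.
    by move=> t; exact: (cvg_comp _ _ (@face_cont R 1 i t) (cl _)).
  (* At a zero of [triangle] the three coordinates are equal, hence 1/3, whereas on the i-th face
     the i-th coordinate is 0. *)
  move=> t; apply: iota_neq0; apply/eqP => e.
  have tE : triangle (face i t) = mkC (co (face i t) 0 - co (face i t) 2) (co (face i t) 1 - co (face i t) 2).
    by rewrite /triangle /co.
  have /(congr1 (@ReC R)) := e; have /(congr1 (@ImC R)) := e; rewrite tE !ReImE.
  have s := co_sum2 (face i t).
  have : (co (face i t) i = 0) by rewrite co_face ?ltnn ?eqxx // -ltnS.
  move: i s {e tE} => [[|[|[|i]]] hi] //= s; lra.
have := htau Ap hx (s := iota \o @triangle R) _; rewrite pairing_hcl // evU mulr1z; apply.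
by move=> t; split=> //; exact: dcoord_fibre.
Qed.

(** Not necessarily 0: on a constant 3-simplex the four terms of the cocycle condition cancel, so it
    leaves this value free. *)
Definition thom_zero : int := T (fun=> zero_section A x).

Lemma Tprism_circle (c : Cx R) : c != 0 ->
  Tprism T (iota \o arc c) + Tprism T (iota \o arc (- c)) = thom_zero *+ 2 - 1.
Proof.
move=> c0.
(* The degree of a path is [thom_zero] minus its prism. The coboundary of a constant in degree 1 is
   that constant, so the prism formula makes the coboundary of the degree equal to the Thom
   cocycle. *)
have k1 : forall g : simplex R 2 -> Cx R, continuous g ->
    (thom_zero - Tprism T (iota \o (g \o face20))) - (thom_zero - Tprism T (iota \o (g \o face21))) +
    (thom_zero - Tprism T (iota \o (g \o face22))) = T (iota \o g).
  move=> g cg.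
  have e : thom_zero - T (iota \o g) = Tprism T (iota \o (g \o face20)) -
      Tprism T (iota \o (g \o face21)) + Tprism T (iota \o (g \o face22)).
    exact: (@prism_formula R n X A cm T Tcocycle (iota \o g) (@Ordinal 3 0 isT)
      (@Ordinal 3 1 isT) (@Ordinal 3 2 isT) (iota_cont cg) erefl erefl erefl).
  move: e; move: (Tprism T _) (Tprism T _) (Tprism T _) (T _) => a b c' d.
  by clear; lia.
have k2 : forall g : simplex R 2 -> Cx R, continuous g -> (forall t, g t != 0) -> T (iota \o g) = 0.
  by move=> g cg g0; apply: (T_nonzero Tcocycle); [exact: iota_cont|move=> t; exact: iota_neq0].
have := @pdeg_circle R (fun f : simplex R 1 -> Cx R => thom_zero - Tprism T (iota \o f)) (fun q : simplex R 2 -> Cx R => T (iota \o q)) k1 k2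
  thom_triangle c c0.
by clear; lia.
Qed.

End FibreDegree.
End LagrangianClasses.

(** * The generating loop of a fibre and its lifts *)

Section FibreLoop.
Variables (R : realType) (n : nat) (X : topologicalType) (A : set (chart R n X)).
Hypothesis cm : complex_manifold A.
Variable h : metric R n X.
Hypothesis hh : kaehler A h.
Implicit Types (phi psi chi : chart R n X) (y : det_bundle A) (g : lagr A h).
Hypothesis n0 : (0 < n)%N.
#[local] Opaque tangent_change.

Definition rot_row (a : R) : 'rV[Cx R]_n :=
  \row_j (if val j == 0%N then mkC (cos a) (sin a) else 1).
Definition rot (a : R) (U : 'M[Cx R]_n) : 'M[Cx R]_n := diag_mx (rot_row a) *m U.

Lemma rotE a U i j : rot a U i j = (if val i == 0%N then mkC (cos a) (sin a) else 1) * U i j.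
Proof. by rewrite /rot mul_diag_mx !mxE. Qed.

Lemma det_rot a U : \det (rot a U) = mkC (cos a) (sin a) * \det U.
Proof.
rewrite /rot det_mulmx det_diag; congr (_ * _).
rewrite (bigD1 (Ordinal n0)) //= mxE /= big1 ?mulr1 // => i.
by rewrite mxE -val_eqE /= => /negPf ->.
Qed.

Lemma adjoint_cis a (i : 'I_n) : rot_row a 0 i * Num.conj (rot_row a 0 i) = 1.
Proof.
rewrite mxE; case: ifP => _; last by rewrite rmorph1 mulr1.
apply: Cx_ext; rewrite !ReImE; last by ring.
by rewrite mulrN opprK -!expr2 cos2Dsin2.
Qed.

Variables (phi : chart R n X) (x : X) (U : 'M[Cx R]_n).
Hypotheses (Ap : A phi) (hx : cdom phi x) (hU : U *m h phi x *m adjoint U = 1%:M).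

Lemma rot_unitary a : rot a U *m h phi x *m adjoint (rot a U) = 1%:M.
Proof.
rewrite /rot adjointM -!mulmxA [U *m _]mulmxA [_ *m (adjoint U *m _)]mulmxA hU mul1mx.
apply/matrixP => i j; rewrite mul_diag_mx !mxE; have [->|ij] := eqVneq i j.
  by have := adjoint_cis a j; rewrite !mxE mulr1n.
by rewrite mulr0n rmorph0 mulr0.
Qed.

Lemma unitary_det : cabs (\det U) ^+ 2 * cabs (\det (h phi x)) = 1.
Proof.
have := congr1 (fun M => cabs (\det M)) hU.
by rewrite !det_mulmx det_adjoint !cabsM cabs_conj det1 cabs1 => <-; ring.
Qed.

Lemma unitary_det_neq0 : \det U != 0.
Proof.
apply/eqP => e; have := unitary_det.
by rewrite e cabs0 expr0n mul0r => /eqP; rewrite eq_sym oner_eq0.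
Qed.

Lemma cabs_cis (a : R) : cabs (mkC (cos a) (sin a)) = 1.
Proof. by rewrite /cabs !ReImE cos2Dsin2 sqrtr1. Qed.

Lemma rot_frame a : lagrangian_frame h phi x (rot a U).
Proof.
split=> [c hc|j k]; last by rewrite rot_unitary mxE; case: eqP; rewrite ?ReImE.
have dU : rot a U \in unitmx.
  rewrite unitmxE det_rot unitfE mulf_neq0 ?unitary_det_neq0 //.
  by rewrite -cabs_gt0 cabs_cis ltr01.
have c0 : realmx c = 0 by rewrite -(mulmxK dU (realmx c)) hc mul0mx.
apply/rowP => j; have := congr1 (fun M : 'rV[Cx R]_n => ReC (M 0 j)) c0.
by rewrite !mxE !ReImE.
Qed.

Variable s : simplex R 1 -> lagr A h.
Hypothesis sx : forall t, gbase (s t) = x.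
Hypothesis sp : forall t, gplane (s t) phi = rspan (rot (pi * co t 1) U).

Lemma fibre_loop_cont : continuous s.
Proof.
move=> t0 V; rewrite nbhsE => -[V' [oV' V's] sub].
have hst : cdom phi (gbase (s t0)) by rewrite sx.
have fr : lagrangian_frame h phi (gbase (s t0)) (rot (pi * co t0 1) U) by rewrite sx; exact: rot_frame.
have H := oV' (s t0) V's phi Ap hst _ fr (sp t0).
have c1 : (fun t : simplex R 1 => pi * co t 1) @ t0 --> pi * co t0 1.
  exact: (cvgM (cvg_cst (pi : R)) (@co_cont R 1 1 t0)).
have c2 : (fun t : simplex R 1 => rot (pi * co t 1) U) @ t0 --> rot (pi * co t0 1) U.
  apply: (cvg_mx (nbhs_filter t0)) => i j.
  rewrite rotE (_ : (fun t => _) = fun t : simplex R 1 =>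
    (if val i == 0%N then mkC (cos (pi * co t 1)) (sin (pi * co t 1)) else 1) * U i j); last first.
    by apply/funext => t; rewrite rotE.
  case: ifP => _; last exact: cvg_cst.
  exact: (cvgCxM (cvg_cis (nbhs_filter t0) c1) (cvg_cst (U i j))).
have c3 : (fun t : simplex R 1 => (gbase (s t0), rot (pi * co t 1) U)) @ t0 -->
    (gbase (s t0), rot (pi * co t0 1) U).
  exact: (cvg_pair (cvg_cst (gbase (s t0))) c2).
have := c3 _ H; apply: (@filterS _ (nbhs t0)) => t /= Ht; apply: sub; apply: Ht.
- by rewrite !sx.
- by rewrite sx; exact: rot_frame.
exact: sp.
Qed.

(** At angle pi the first basis vector has only changed its sign, which preserves the real span:
    this is why the half turn is already a closed loop of planes. *)
Lemma rspan_rot_pi : rspan (rot pi U) = rspan (rot 0 U).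
Proof.
pose e : 'rV[R]_n := \row_j (if val j == 0%N then -1 else 1).
have E (c : 'rV[R]_n) : realmx (c *m diag_mx e) *m rot 0 U = realmx c *m rot pi U.
  rewrite /rot realmxM -!mulmxA; congr (_ *m _); rewrite mulmxA; congr (_ *m _).
  apply/matrixP => i j; rewrite mul_mx_diag !mxE cospi sinpi cos0 sin0.
  have [->|ij] := eqVneq i j; last by rewrite !mulr0n; apply: Cx_ext; rewrite !ReImE; ring.
  by rewrite !mulr1n; case: ifP => _; apply: Cx_ext; rewrite !ReImE; ring.
have ee (c : 'rV[R]_n) : c *m diag_mx e *m diag_mx e = c.
  apply/rowP => j; rewrite !mul_mx_diag !mxE; case: ifP => _; ring.
apply/seteqP; split=> v [c ->].
  by exists (c *m diag_mx e); rewrite E.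
by exists (c *m diag_mx e); rewrite -E ee.
Qed.

Lemma fibre_loop_bd : bd (<< s >> : chain R (lagr A h) 1) = 0.
Proof.
rewrite bdU !big_ord_recl big_ord0 /= addr0.
suff -> : s \o face ord0 = s \o face (fintype.lift ord0 ord0).
  by rewrite freegUD expr0 /bump /= expr1 subrr freegU0.
apply/funext => t; rewrite -[LHS]/(s (face _ t)) -[RHS]/(s (face _ t)).
apply: (lagr_ext Ap); [by rewrite sx|by rewrite !sx|rewrite !sp].
have -> : co (face ord0 t) 1 = 1.
  by rewrite co_face //= -(co_sum t) big_ord_recl big_ord0 addr0.
have -> : co (face (fintype.lift ord0 ord0) t) 1 = 0 by rewrite co_face.
by rewrite mulr1 mulr0 rspan_rot_pi.
Qed.

(** The determinant of the rotated frame is e^(i pi t) det U, and it has length 1 because U is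
    unitary. The lift is thus a half circle that ends at the opposite of its origin. *)
Lemma fibre_loop_lift t : is_lift (s t) (fibre cm Ap hx (arc (\det U) t)).
Proof.
have hst : cdom phi (gbase (s t)) by rewrite sx.
have fr : lagrangian_frame h phi (gbase (s t)) (rot (pi * co t 1) U) by rewrite sx; exact: rot_frame.
apply: (is_lift_chart (F := rot (pi * co t 1) U) hh Ap hst (sp t) fr).
- by rewrite sx.
- by exists 1; rewrite dcoord_fibre det_rot (_ : mkC 1 0 = 1) ?mul1r.
by rewrite dcoord_fibre sx /arc cabsM cabs_cis mul1r unitary_det.
Qed.

Variable tau : coh R int 2 [set: det_bundle A] (@det_nonzero R n X A).
Hypothesis htau : thom_det tau.

Lemma maslov_cochain_fibre_loop : maslov_cochain cm hh tau s = thom_zero tau x *+ 2 - 1.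
Proof.
rewrite (@maslov_cochainE R n X A cm h hh tau s (fibre cm Ap hx \o arc (\det U))).
- rewrite -(Tprism_circle cm htau Ap hx unitary_det_neq0); congr (_ + Tprism _ _).
  apply/funext => t; rewrite /opp_lift /= dscale_fibre; congr fibre.
  by rewrite /arc mulN1r mulrN.
- exact: fibre_loop_cont.
- apply: iota_cont => t; have c1 : (fun t : simplex R 1 => pi * co t 1) @ t --> pi * co t 1.
    exact: (cvgM (cvg_cst (pi : R)) (@co_cont R 1 1 t)).
  exact: (cvgCxM (cvg_cis (nbhs_filter t) c1) (cvg_cst (\det U))).
exact: fibre_loop_lift.
Qed.

End FibreLoop.

(** * Divisible coefficients *)

Section Baer.
Variables (V M : zmodType).
Hypothesis M_div : forall (m : M) (d : int), d != 0 -> exists m', m' *~ d = m.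

(* Graphs of homomorphisms from a subgroup of V to M. *)
Definition partial_hom (G : set (V * M)) : Prop :=
  [/\ G (0, 0), forall p q, G p -> G q -> G (p.1 - q.1, p.2 - q.2) & forall m, G (0, m) -> m = 0].

Lemma partial_homD G p q : partial_hom G -> G p -> G q -> G (p.1 + q.1, p.2 + q.2).
Proof.
move=> [g0 gB _] Gp Gq; have := gB p _ Gp (gB _ _ g0 Gq).
by rewrite /= !sub0r !opprK.
Qed.

Lemma partial_homMz G p (a : int) : partial_hom G -> G p -> G (p.1 *~ a, p.2 *~ a).
Proof.
move=> hG Gp; have [g0 gB _] := hG.
have hn (k : nat) : G (p.1 *+ k, p.2 *+ k).
  elim: k => [|k IH]; first by rewrite !mulr0n.
  by rewrite !mulrS; exact: (partial_homD hG Gp IH).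
case: a => k; first exact: hn.
by rewrite NegzE !mulrNz; have := gB _ _ g0 (hn k.+1); rewrite /= !sub0r.
Qed.

Lemma partial_hom_fun G v m m' : partial_hom G -> G (v, m) -> G (v, m') -> m = m'.
Proof.
move=> [_ gB g1] h1 h2; apply/eqP; rewrite -subr_eq0; apply/eqP/g1.
by have := gB _ _ h1 h2; rewrite /= subrr.
Qed.

(** The integers a for which a v lies in the domain form a subgroup d Z. If d is positive, the value
    at d v is divided by d; if d = 0, any value would do, and 0 is taken. *)
Lemma partial_hom_value G v : partial_hom G ->
  exists m' : M, forall (a : int) m, G (v *~ a, m) -> m = m' *~ a.
Proof.
move=> hG; have [g0 gB g1] := hG.
pose P d := `[< (0 < d)%N /\ exists m, G (v *~ d%:Z, m) >].
have [[d0 Pd0]|nP] := pselect (exists d, P d); last first.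
  exists 0 => a m Gm; rewrite mul0rz.
  have [a0|a0] := eqVneq a 0; first by move: Gm; rewrite a0 mulr0z => /g1.
  case: nP; exists `|a|%N; apply/asboolP; split; first by rewrite absz_gt0.
  have := partial_homMz (sgz a) hG Gm; rewrite /= -!mulrzA mulrC -abszEsg.
  by move=> h; exists (m *~ sgz a).
have exP : exists d, P d by exists d0.
case: (ex_minnP exP) => d /asboolP[d1 [md Gd]] dmin.
have dn : d%:Z != 0 by rewrite -lt0n.
have [m' hm'] := M_div md dn; exists m' => a m Gm.
have ad : (a %% d%:Z)%Z = 0.
  have r0 := modz_ge0 a dn; have r1 : (a %% d%:Z)%Z < d%:Z by apply: ltz_pmod.
  case e : (a %% d%:Z)%Z r0 r1 => [r|r] // _ r1; congr Posz; apply/eqP; rewrite -leqn0 leqNgt.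
  apply/negP => rp; have : P r.
    apply/asboolP; split=> //.
    have := gB _ _ Gm (partial_homMz (a %/ d%:Z)%Z hG Gd).
    rewrite /= -!mulrzA -mulrzBr (_ : a - _ = r); first by eexists; eassumption.
    by rewrite -e {1}(divz_eq a d%:Z); ring.
  by move=> /dmin; rewrite leqNgt; move: r1; rewrite ltz_nat => ->.
have aE : a = d%:Z * (a %/ d%:Z)%Z by rewrite {1}(divz_eq a d%:Z) ad addr0 mulrC.
have := partial_homMz (a %/ d%:Z)%Z hG Gd; rewrite /= -mulrzA -aE => h2.
by rewrite (partial_hom_fun hG Gm h2) -hm' -mulrzA -aE.
Qed.

Lemma partial_hom_extend G v : partial_hom G ->
  exists2 G', partial_hom G' & G `<=` G' /\ exists m, G' (v, m).
Proof.
move=> hG; have [g0 gB g1] := hG; have [m' hm'] := partial_hom_value v hG.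
pose G' : set (V * M) := [set p | exists (q : V * M) (a : int), G q /\ p = (q.1 + v *~ a, q.2 + m' *~ a)].
exists G'; last first.
  split; first by move=> [w m] Gw; exists (w, m), 0; rewrite !mulr0z !addr0.
  by exists m'; exists (0, 0), 1; rewrite !add0r !mulr1z.
split.
- by exists (0, 0), 0; rewrite !mulr0z !addr0.
- move=> p q [p' [a [Gp ->]]] [q' [b [Gq ->]]].
  exists (p'.1 - q'.1, p'.2 - q'.2), (a - b); split; first exact: gB.
  by rewrite /= !mulrzBr; congr (_, _); rewrite opprD addrACA.
move=> m [[w m0] [a [Gw /= [e1 ->]]]].
have := gB _ _ g0 Gw; rewrite /= !sub0r (_ : - w = v *~ a); last first.
  by apply/eqP; rewrite eq_sym -subr_eq0 opprK addrC -e1.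
by move=> /hm' h; rewrite -h subrr.
Qed.

(** Baer's criterion for divisible groups: a maximal extension, given by Zorn's lemma, is defined
    everywhere, since otherwise it could be extended by one more element. *)
Lemma hom_extend G : partial_hom G ->
  exists2 f : V -> M, {morph f : x y / x + y} & forall v m, G (v, m) -> f v = m.
Proof.
move=> hG.
pose P (H : set (V * M)) := H = set0 \/ (G `<=` H /\ partial_hom H).
have chains F : F `<=` P -> total_on F subset -> P (\bigcup_(H in F) H).
  move=> FP tot.
  have [[G1 FG1 G10]|nF] := pselect (exists2 H, F H & H !=set0); last first.
      left; apply/seteqP; split=> // p [H FH Hp]; apply: nF.
      by exists H => //; exists p.
    have full H : F H -> H !=set0 -> G `<=` H /\ partial_hom H.
      by move=> FH [p Hp]; have [e|//] := FP H FH; move: Hp; rewrite e.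
    have [GG1 [g0 gB g1]] := full G1 FG1 G10.
    right; split; first by move=> p /GG1 ?; exists G1.
    split; first by exists G1.
      move=> p q [H1 F1 H1p] [H2 F2 H2q].
      have [k|k] := tot H1 H2 F1 F2.
        exists H2 => //; have [_ [_ h2 _]] := full H2 F2 (ex_intro _ q H2q).
        by apply: h2 => //; exact: k.
      exists H1 => //; have [_ [_ h2 _]] := full H1 F1 (ex_intro _ p H1p).
      by apply: h2 => //; exact: k.
    move=> m [H FH Hm]; have [_ [_ _ h3]] := full H FH (ex_intro _ _ Hm).
    exact: h3.
have [H [PH Hmax]] := Zorn_bigcup chains.
have [GH hH] : G `<=` H /\ partial_hom H.
  case: PH => // H0; exfalso; apply: (Hmax G); last by right; split.
  by rewrite H0; split; [move=> ? []|move=> /(_ (0, 0)); case: hG => g0 _ _ /(_ g0)].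
have ex v : exists m, H (v, m).
  have [H' hH' [HH' [m H'm]]] := partial_hom_extend v hH.
  apply: contrapT => nv; apply: (Hmax H'); last by right; split=> // p /GH /HH'.
  by split=> // H'H; apply: nv; exists m; exact: H'H.
have /choice [f hf] := ex.
exists f => [x y|v m /GH hv]; last exact: (partial_hom_fun hH (hf v) hv).
by apply: (partial_hom_fun hH (hf _)); exact: (partial_homD hH (hf x) (hf y)).
Qed.
End Baer.

Lemma pchar0_intr_neq0 (k : fieldType) (a : int) : [pchar k] =i pred0 ->
  a != 0 -> a%:~R != 0 :> k.
Proof.
move=> hk a0; have hn p : (0 < p)%N -> p%:R != 0 :> k.
  by move=> p0; apply/negP => /(natf0_pchar p0) [q]; rewrite hk.
case: a a0 => p; first by rewrite -lt0n; exact: hn.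
by move=> _; rewrite NegzE mulrNz oppr_eq0; exact: hn.
Qed.

Lemma pchar0_divisible (k : fieldType) (m : k) (d : int) : [pchar k] =i pred0 ->
  d != 0 -> exists m', m' *~ d = m.
Proof.
move=> hk d0; exists (m / d%:~R); rewrite -mulrzr divfK //.
exact: pchar0_intr_neq0.
Qed.

Lemma additive_eq0 (U V : zmodType) (f : U -> V) : {morph f : x y / x + y} -> f 0 = 0.
Proof. by move=> fD; apply: (addrI (f 0)); rewrite -fD !addr0. Qed.

Lemma morph_mulz (U V : zmodType) (f : U -> V) (a : int) x : {morph f : x y / x + y} ->
  f (x *~ a) = f x *~ a.
Proof.
move=> fD; have f0 := additive_eq0 fD.
have hn p : f (x *+ p) = f x *+ p by elim: p => [|p IH]; rewrite ?mulr0n // !mulrS fD IH.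
case: a => p; first exact: hn.
have fN y : f (- y) = - f y.
  by apply/eqP; rewrite -subr_eq0 opprK -fD addNr f0.
by rewrite NegzE !mulrNz fN; congr (- _); exact: hn.
Qed.

Lemma ev_morph (K : choiceType) (U V : zmodType) (f : U -> V) (g : K -> U) (c : {freeg K / int}) :
  {morph f : x y / x + y} -> ev (f \o g) c = f (ev g c).
Proof.
move=> fD; rewrite /ev (big_morph f fD (additive_eq0 fD)).
by apply: eq_bigr => s _; rewrite morph_mulz.
Qed.

(** Multiples of z are sent to their integer coefficients, well defined in characteristic 0, and the
    rationals are divisible. *)
Lemma additive_to_rat (k : fieldType) (z : k) : [pchar k] =i pred0 -> z != 0 ->
  exists2 f : k -> rat, {morph f : x y / x + y} & f z != 0.
Proof.
move=> hk z0.
have hG : partial_hom [set p : k * rat | exists a : int, p = (z *~ a, a%:~R)].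
  split.
  - by exists 0; rewrite mulr0z.
  - by move=> p q [a ->] [b ->]; exists (a - b); rewrite /= mulrzBr intrB.
  move=> m [a [/esym/eqP]]; rewrite -mulrzr mulf_eq0 (negPf z0) /= => e ->.
  by have [-> //|a0] := eqVneq a 0; move: (pchar0_intr_neq0 hk a0); rewrite e.
have rdiv (m : rat) (d : int) : d != 0 -> exists m', m' *~ d = m.
  by move=> d0; apply: pchar0_divisible => // p; exact: pchar_num.
have [f fD hf] := hom_extend rdiv hG; exists f => //.
rewrite (hf z 1); first exact: oner_neq0.
by exists 1; rewrite !mulr1z.
Qed.

Lemma coh_eq0 (R : realType) (X : topologicalType) (M : zmodType) n (S T : set X)
    (a : coh R M n S T) :
  a = 0 <-> corep a \in coboundaries (R := R) (n := n) S T.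
Proof.
have h := sclass_eqP (coboundaries S T) (corep_cocycle a) (rpred0 (cocycles (R := R) (n := n) S T)).
rewrite subr0 sclass0 in h; rewrite -h /corep sclass_srepr; by [].
Qed.

(** A cocycle f vanishes on every cycle z: otherwise an additive map to the rationals that is
    nonzero on f(z) turns f into a rational cocycle, a coboundary by hypothesis, with nonzero value
    on z. Hence f(z) depends only on the boundary of z, and the homomorphism on boundaries so
    defined extends to all 1-chains; the extension is a primitive. *)
Lemma coh_rat_field (R : realType) (X : topologicalType) (k : fieldType) (S : set X) :
  [pchar k] =i pred0 -> (forall a : coh R rat 2 S set0, a = 0) ->
  forall a : coh R k 2 S set0, a = 0.
Proof.
move=> hk h0 a; apply/coh_eq0; set f := corep a.
have [_ f_cocycle] := proj1 (cocyclesP _ _ _) (corep_cocycle a); rewrite -/f in f_cocycle.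
have nil (s : simplex R 1 -> X) : ~ sing set0 s.
  by move=> [_ h]; exact: (h (mks 1 (fun=> 0))).
have fz z : chain_on S z -> bd z = 0 -> ev f z = 0.
  move=> hz bz; apply: contrapT => /eqP fz0.
  have [p pD pn] := additive_to_rat hk fz0.
  have cp : (p \o f : cochain R X rat 2) \in cocycles (R := R) (n := 2) S set0.
    apply/cocyclesP; split=> [s [_ h]|s hs]; first by case: (h (mks 2 (fun=> 0))).
    have e : @cobd R X rat 3 (p \o f) s = p (@cobd R X k 3 f s).
      rewrite /= (big_morph p pD (additive_eq0 pD)); apply: eq_bigr => i _.
      by rewrite morph_mulz.
    by rewrite e f_cocycle // additive_eq0.
  have := h0 (cocl S set0 (p \o f)).
  rewrite -(sclass0 (cocycles S set0) (coboundaries S set0)) => e.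
  have /(sclass_eqP (coboundaries S set0) cp (rpred0 _)) : cocl S set0 (p \o f) = sclass _ _ 0 := e.
  rewrite subr0 => cob.
  have cz : z \in cycles (R := R) (n := 2) S set0.
    by apply/cyclesP; split=> //; rewrite bz; exact: chain_on0.
  have := ev_coboundary_cycle cob cz.
  by rewrite ev_morph // => /eqP; apply/negP.
pose G : set (chain R X 1 * k) := [set q | exists z : chain R X 2, [/\ chain_on S z, q.1 = bd z & q.2 = ev f z]].
have hG : partial_hom G.
  split.
  - by exists 0; rewrite bd0 ev0; split=> //; exact: chain_on0.
  - move=> p q [z [hz -> ->]] [z' [hz' -> ->]]; exists (z - z').
    by rewrite bdB evB; split=> //; exact: chain_onB.
  by move=> m [z [hz /= /esym bz ->]]; exact: fz.
have [g gD hg] := hom_extend (fun m d => @pchar0_divisible k m d hk) hG.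
apply/coboundariesP; exists (fun s => g << s >>); split=> [s /nil //|s hs].
have e : g (bd (<< s >> : chain R X 2)) = ev f (<< s >> : chain R X 2).
  by apply: hg; exists << s >>; split=> //; exact: chain_onU.
rewrite evU mulr1z bdU (big_morph g gD (additive_eq0 gD)) in e; rewrite -e.
apply: eq_bigr => i _.
rewrite -morph_mulz //; congr g.
by rewrite freegU_mulz intz.
Qed.

(** * The Chern number of the degree *)

Section ChernNumber.
Variables (R : realType) (n m : nat) (X : topologicalType).
Variables (A : set (chart R n X)) (D : 'I_m -> set X).
Hypothesis cm : complex_manifold A.
Variable tau : forall p, coh R int 2 [set: X] (~` D p).
Variable h : metric R n X.
Hypothesis hh : kaehler A h.
Variable s : simplex R 1 -> lagr A h.
Hypothesis hs : fibre_loop (~` total_divisor D) s.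
Variable c1 : coh R int 2 [set: X] set0.
Hypothesis hc1 : first_chern A c1.
Hypothesis n0 : (0 < n)%N.
#[local] Opaque tangent_change.
Local Notation XD := (~` total_divisor D).
Local Notation GXD := (@lagr_over R n X A h XD).

Lemma zero_section_cont : continuous (@zero_section R n X A).
Proof.
move=> x; have [phi Ap hx] := cm_cover cm x.
apply: (@cvg_det_bundle _ _ _ _ _ _ (nbhs_filter x) _ (zero_section A x) phi Ap hx).
  exact: cvg_id.
exact: cvg_cst.
Qed.

Lemma ev_pull (Y : topologicalType) (M : zmodType) (f : X -> Y) (S' T' : set Y)
    (S T : set X) (a : coh R M 2 S' T') (z : chain R X 2) :
  continuous f -> (forall x, S x -> S' (f x)) -> (forall x, T x -> T' (f x)) ->
  z \in cycles (R := R) (n := 2) S T ->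
  ev (corep (pull f S T a)) z = ev (fun r : simplex R 2 -> X => corep a (f \o r)) z.
Proof.
move=> cf fS fT hz; rewrite ev_corep_cocl //.
have [a1 a2] := proj1 (cocyclesP _ _ _) (corep_cocycle a).
have sf (p : nat) (B : set X) (B' : set Y) (r : simplex R p -> X) : (forall x, B x -> B' (f x)) ->
    sing B r -> sing B' (f \o r).
  by move=> fB [cr Br]; split=> t; [apply: continuous_comp; [exact: cr|exact: cf]|exact/fB/Br].
apply/cocyclesP; split=> r hr; first by apply: a1; exact: sf hr.
exact: (a2 (f \o r) (sf _ _ _ _ fS hr)).
Qed.

Lemma degree_chern_number (v : 'rV[int]_m) (d : @grading_group R n m X A D h) (i : nat) :
  monomial_degree tau v d -> grading_int D s (Posz i) + d = grading_int D s 2 ->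
  exists Z : chain R X 2, [/\ chain_on [set: X] Z, bd Z = 0,
    forall p, ev (corep (tau p)) Z = v 0 p & ev (corep c1) Z *+ 2 = 2 - Posz i].
Proof.
move=> [u [w [hu hw ->]]] hg.
have [phi [x [U [Ap hx Sx hU hsx]]]] := hs.
have sx t : gbase (s t) = x by have [] := hsx t.
have sp t : gplane (s t) phi = rspan (rot (pi * co t 1) U) by have [_] := hsx t.
have [T hT c1E] := hc1.
pose W := hrep w.
have /cyclesP [WT bW] := hrep_cycle w.
have cs := fibre_loop_cont n0 Ap hx hU sx sp.
have ss : sing GXD s by split=> // t; rewrite /lagr_over /= sx.
pose L : chain R (lagr A h) 1 := << s >>.
have bL : bd L = 0 by exact: (fibre_loop_bd Ap hx sx sp).
have Lc : L \in cycles (R := R) (n := 1) GXD set0.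
  by apply/cyclesP; split; [exact: chain_onU|rewrite bL; exact: chain_on0].
have bWc : bd W \in cycles (R := R) (n := 1) GXD set0.
  by apply/cyclesP; split=> //; rewrite bd_bd; exact: chain_on0.
have Lmz (a : int) : L *~ a \in cycles (R := R) (n := 1) GXD set0 by exact: rpredMz.
have eG : sclass (cycles GXD set0) (boundaries GXD set0) (L *~ (Posz i) - bd W) =
    sclass (cycles GXD set0) (boundaries GXD set0) (L *~ 2).
  by rewrite sclassB // !sclass_mulz //; exact: hg.
have LW : L *~ (Posz i) - bd W \in cycles (R := R) (n := 1) GXD set0 by exact: rpredB.
have /boundariesP := proj1 (sclass_eqP (boundaries GXD set0) LW (Lmz 2)) eG.
move=> [b [c' [hb /chain_on_set0 ->]]]; rewrite addr0 => e.
(* Equality of degrees makes (i - 2) copies of s minus the boundary of W the boundary of a chain b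
   over X \ D; adding b leaves a chain bounded exactly by copies of s. *)
pose W' := W + b; pose j := Posz i - 2.
have W'T : chain_on [set: lagr A h] W' by apply: chain_onD => //; exact: chain_on_sub hb.
have bW' : bd W' = L *~ j by rewrite /W' bdD -e mulrzBr addrC addrAC subrK.
(* The loop s projects to a constant 1-simplex, which is the boundary of the constant 2-simplex
   because 1 - 1 + 1 = 1. The point x lies outside D, so the caps do not change intersection
   numbers. *)
pose kx : chain R X 2 := << (fun=> x : X) >>.
pose Z := pushc (@gbase R n X A h) W' - kx *~ j.
have ckx : sing XD (fun _ : simplex R 2 => x) by split; [exact: cst_continuous|].
have cg : continuous (@gbase R n X A h) by move=> g; exact: gbase_cont.
have kT : chain_on XD kx by exact: chain_onU.
have ZT : chain_on [set: X] Z.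
  apply: chain_onB; first exact: (chain_on_pushc cg _ W'T).
  by apply: chain_on_mulz; exact: chain_on_sub kT.
have bdmz (c : chain R X 2) (a : int) : bd (c *~ a) = bd c *~ a.
  by apply: morph_mulz => c1' c2'; exact: bdD.
have bZ : bd Z = 0.
  rewrite /Z bdB bd_pushc bW' pushc_mulz bdmz pushcU (_ : bd kx = << (fun=> x) >>).
    by rewrite (_ : _ \o s = fun=> x) ?subrr //; apply/funext => t; exact: sx.
  rewrite bdU !big_ord_recl big_ord0 /= addr0 /comp /bump /= !exprS expr0 !mulr1 mulN1r opprK.
  by rewrite freegUD addNr freegU0 addr0.
exists Z; split=> //.
  move=> p; rewrite -hu /intersection.
  have DX : XD `<=` ~` D p by move=> y ny Dy; apply: ny; exists p.
  pose uc := pushc id (hrep u).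
  have uC : uc \in cycles (R := R) (n := 2) [set: X] (~` D p).
    have /cyclesP [uT ub] := hrep_cycle u; apply/cyclesP; split.
      by apply: (chain_on_pushc (S := setT)) => // y; exact: cvg_id.
    by rewrite bd_pushc; apply: (chain_on_pushc (S := XD)) => // y; exact: cvg_id.
  have -> : pairing (tau p) (push id [set: X] (~` D p) u) = ev (corep (tau p)) uc.
    exact: pairing_hcl.
  have [tau0 _] := proj1 (cocyclesP _ _ _) (corep_cocycle (tau p)).
  have -> : ev (corep (tau p)) uc = ev (corep (tau p)) (hrep u) by rewrite ev_pushc.
  have gW : pushc (@gbase R n X A h) W \in cycles (R := R) (n := 2) [set: X] XD.
    apply/cyclesP; split; first exact: (chain_on_pushc cg _ WT).
    by rewrite bd_pushc; exact: (chain_on_pushc cg _ bW).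
  have hB : hrep u - pushc (@gbase R n X A h) W \in boundaries (R := R) (n := 2) [set: X] (~` D p).
    have : hrep u - pushc (@gbase R n X A h) W \in boundaries (R := R) (n := 2) [set: X] XD.
      by rewrite -hw; exact: srepr_sclass.
    move=> /boundariesP [b' [c'' [h1 h2 h3]]]; apply/boundariesP; exists b', c''.
    by split=> //; exact: chain_on_sub h2.
  (* Z differs from the projection of W by the projection of b and the caps, both in X \ D, where
     the Thom cocycle of D_p vanishes. *)
  have hZ : chain_on (~` D p) (Z - pushc (@gbase R n X A h) W).
    rewrite /Z /W' /pushc fgliftD -/(pushc _ b) -/(pushc _ W) addrAC [X in X - _]addrAC subrr add0r.
    apply: chain_onB; first by apply: (chain_on_pushc cg _ hb) => g; exact: DX.
    by apply: chain_on_mulz; exact: chain_on_sub kT.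
  have e1 := ev_cocycle_boundary (corep_cocycle (tau p)) hB.
  have e2 : ev (corep (tau p)) (Z - pushc (@gbase R n X A h) W) = 0 := ev_on hZ tau0.
  move: e1 e2; rewrite !evB => /eqP; rewrite subr_eq0 => /eqP -> /eqP.
  by rewrite subr_eq0 => /eqP.
have ZC : Z \in cycles (R := R) (n := 2) [set: X] set0.
  by apply/cyclesP; split=> //; rewrite bZ; exact: chain_on0.
rewrite c1E ev_pull //; last exact: zero_section_cont.
rewrite /Z evB ev_mulz evU mulr1z ev_pushc.
(* With K the value of [thom_zero] at x and j = i - 2, the projection of W' contributes j (2 K - 1)
   to 2 c_1(Z) and the caps contribute -2 j K; the sum is -j = 2 - i. *)
have k1 := ev_zero_gbase cm hh T W'T.
rewrite bW' ev_mulz evU mulr1z (maslov_cochain_fibre_loop cm hh n0 Ap hx hU sx sp hT) in k1.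
rewrite -[corep T (_ \o _)]/(thom_zero T x).
rewrite mulrnBl; apply: etrans (congr1 (fun y => y - _) k1) _.
by rewrite /j !mulrzz; move: (thom_zero T x) (Posz i) => K i'; ring.
Qed.

End ChernNumber.

(** * Chern numbers with real coefficients and positivity *)

Section RealClasses.
Variables (R : realType) (m : nat) (X : topologicalType).
Variables (D : 'I_m -> set X) (tau : forall p, coh R int 2 [set: X] (~` D p)).
Variable c1 : coh R int 2 [set: X] set0.

Lemma intr_cocycle (S T : set X) (a : coh R int 2 S T) :
  (fun s : simplex R 2 -> X => (corep a s)%:~R : R) \in cocycles (R := R) (n := 2) S T.
Proof.
have [a1 a2] := proj1 (cocyclesP _ _ _) (corep_cocycle a).
apply/cocyclesP; split=> s hs; first by rewrite a1.
transitivity ((@cobd R X int 3 (corep a) s)%:~R : R); last by rewrite a2.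
by rewrite /= rmorph_sum; apply: eq_bigr => i _; rewrite rmorphMz.
Qed.

Lemma ev_intr (K : choiceType) (f : K -> int) (c : {freeg K / int}) :
  ev (fun s => (f s)%:~R : R) c = (ev f c)%:~R.
Proof. exact: (ev_morph f c (rmorphD (intmul (1 : R)))). Qed.

Variable Z : chain R X 2.
Hypotheses (ZT : chain_on [set: X] Z) (bZ : bd Z = 0).

Lemma closed_cycle (T : set X) : Z \in cycles (R := R) (n := 2) [set: X] T.
Proof. by apply/cyclesP; split=> //; rewrite bZ; exact: chain_on0. Qed.

Lemma ev_chern_real : ev (corep (chern_real c1)) Z = (ev (corep c1) Z)%:~R.
Proof. by rewrite ev_corep_cocl ?ev_intr //; [exact: intr_cocycle|exact: closed_cycle]. Qed.

Lemma calabi_yau_ev : calabi_yau c1 -> ev (corep c1) Z = 0.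
Proof.
move=> cy; have /coh_eq0 := cy => h.
have := ev_coboundary_cycle h (closed_cycle set0).
by rewrite ev_chern_real => /eqP; rewrite intr_eq0 => /eqP.
Qed.

Lemma ev_divisor_class (a : 'rV[R]_m) :
  ev (corep (divisor_class tau a)) Z = \sum_p a 0 p * (ev (corep (tau p)) Z)%:~R.
Proof.
rewrite ev_corep_cocl; last exact: closed_cycle.
  rewrite /ev; under eq_bigr do rewrite -mulrzr mulr_suml.
  rewrite exchange_big; apply: eq_bigr => p _.
  rewrite -[\sum_(_ <- _) _]/(ev _ Z) -ev_intr /ev mulr_sumr; apply: eq_bigr => s _.
  by rewrite -[in RHS]mulrzr mulrA.
apply/cocyclesP; split=> s hs.
  apply: big1 => p _; have [t0 _] := proj1 (cocyclesP _ _ _) (corep_cocycle (tau p)).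
  rewrite t0 ?mulr0 //; case: hs => cs hs; split=> // t Dt; apply: (hs t).
  by exists p.
rewrite /=; under eq_bigr do rewrite mulrz_suml.
rewrite exchange_big big1 // => p _.
have /cocyclesP [_ /(_ s hs)] := intr_cocycle (tau p) => /= e.
under eq_bigr do rewrite -mulrzAr.
by rewrite -mulr_sumr e mulr0.
Qed.

(** An interior point a of N pairs strictly positively with v: a small shift of a in the direction
    -v stays in N, where the pairing is still at least 0, and the shift lowered it by a positive
    multiple of |v|^2. *)
Lemma positive_ev (N : set 'rV[R]_m) (v : 'rV[int]_m) : positive tau N c1 ->
  (forall p, ev (corep (tau p)) Z = v 0 p) -> dual_cone N v -> v != 0 -> 0 < ev (corep c1) Z.
Proof.
move=> [a aN ca] hv vN v0.
have : (ev (corep c1) Z)%:~R = \sum_p a 0 p * (v 0 p)%:~R :> R.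
  rewrite -ev_chern_real ca ev_pull //; last exact: closed_cycle.
    by rewrite ev_divisor_class; apply: eq_bigr => p _; rewrite hv.
  by move=> x; exact: cvg_id.
(* The Euclidean dual of v itself serves as the direction of the shift. *)
pose w : 'rV[R]_m := \row_p (v 0 p)%:~R.
have cw : (fun e : R => a - e *: w) @ (0 : R) --> a.
  apply: (cvg_mx (nbhs_filter (0 : R))) => i j; rewrite (ord1 i).
  have -> : (fun e : R => (a - e *: w) 0 j) = fun e => a 0 j - e * w 0 j.
    by apply/funext => e; rewrite !mxE.
  have ce : (fun e : R => e) @ (0 : R) --> (0 : R) by exact: cvg_id.
  have k : (fun e : R => a 0 j - e * w 0 j) @ (0 : R) --> a 0 j - 0 * w 0 j.
    exact: (cvgB (cvg_cst (a 0 j)) (cvgM ce (cvg_cst (w 0 j)))).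
  by rewrite mul0r subr0 in k.
have /nbhs_ballP [e /= e0 he] := cw _ aN.
have e2 : 0 < e / 2 by rewrite divr_gt0.
have Ne : N (a - (e / 2) *: w).
  by apply: he; rewrite /ball /= sub0r normrN gtr0_norm //; lra.
move=> E; rewrite -(ltr0z R) E.
have := vN _ Ne; rewrite (_ : \sum_p _ = \sum_p a 0 p * (v 0 p)%:~R - e / 2 * \sum_p (v 0 p)%:~R ^+ 2); last first.
  by rewrite mulr_sumr -sumrB; apply: eq_bigr => p _; rewrite !mxE; ring.
rewrite subr_ge0; apply: lt_le_trans; apply: mulr_gt0 => //.
have [p vp] : exists p, v 0 p != 0.
  apply: contrapT => nv; move/eqP: v0; apply; apply/rowP => p; rewrite mxE.
  by apply/eqP/negPn/negP => vp; apply: nv; exists p.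
rewrite (bigD1 p) //=; apply: ltr_pwDl.
  by rewrite lt_neqAle eq_sym sqrf_eq0 intr_eq0 vp sqr_ge0.
by apply: sumr_ge0 => q _; exact: sqr_ge0.
Qed.
End RealClasses.

(** A point of D_p lies in an adapted chart where D_p is a coordinate hyperplane, so there is a
    coordinate. The fibre loop needs one to rotate; the index p comes from a nonzero entry of v. *)
Lemma snc_dim_gt0 (R : realType) (n m : nat) (X : topologicalType)
    (A : set (chart R n X)) (D : 'I_m -> set X) (p : 'I_m) : snc_divisor A D -> (0 < n)%N.
Proof.
move=> [hD hA]; have [[x Dx] _] := hD p.
have [phi [J [[_ hJ _] hx]]] := hA x.
have := proj1 (hJ p x hx) Dx; case: (J p) => // j _.
exact: leq_ltn_trans (leq0n _) (ltn_ord j).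
Qed.

Theorem lemma1p29 (R : realType) (k : fieldType) (hk : [pchar k] =i pred0)
    (n m : nat) (X : topologicalType)
    (A : set (chart R n X)) (D : 'I_m -> set X) (hX : snc_pair A D)
    (tau : forall p, coh R int 2 [set: X] (~` D p))
    (htau : forall p, thom_divisor A (tau p))
    (c1 : coh R int 2 [set: X] set0) (hc1 : first_chern A c1)
    (h : metric R n X) (hh : kaehler A h)
    (s : simplex R 1 -> lagr A h) (hs : fibre_loop (~` total_divisor D) s)
    (N : set 'rV[R]_m) (hN : convex_cone N) (hnef : N `<=` nef_cone A tau)
    (hint : interior N !=set0)
    (hcase :
      (calabi_yau c1 /\
       forall a : coh R rat 2 (~` total_divisor D) set0, a = 0) \/
      (positive tau N c1 /\
       exists2 d : nat, minimal_chern_number c1 d & (2 <= d)%N)) :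
  H_maximal_ideal tau N k s (grading_int D s 2) = [set (fun _ _ => 0)].
Proof.
have [[cm _ _] hsnc _] := hX.
apply/seteqP; split=> [c [_ hv hg]|_ ->]; last first.
  split=> [|i v|i v]; rewrite ?eqxx //.
  rewrite (_ : [set iv : nat * 'rV[int]_m | _] = set0); first exact: finite_set0.
  by apply/seteqP; split=> // iv /=; rewrite eqxx.
suff c0 : forall i v, c i v = 0.
  (* The type of [c i] depends on the degree i, hence dependent extensionality. *)
  by apply: functional_extensionality_dep => i; apply/funext => v; exact: c0.
move=> i v.
apply: contrapT => /eqP cn; have [vN v0] := hv i v cn.
have [d hd hdi] := hg i v cn.
have [p vp] : exists p, v 0 p != 0.
  apply: contrapT => nv; move/eqP: v0; apply; apply/rowP => p; rewrite mxE.
  by apply/eqP/negPn/negP => vp; apply: nv; exists p.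
have n0 := snc_dim_gt0 p hsnc.
have [Z [ZT bZ Zv Zc]] := degree_chern_number cm hh hs hc1 n0 hd hdi.
case: hcase => [[cy hQ]|[pos [b hb b2]]].
  have i2 : i = 2%N by move: Zc; rewrite (calabi_yau_ev ZT bZ cy); clear; lia.
  by move/eqP: cn; apply; subst i; exact: coh_rat_field.
have c_gt0 := positive_ev ZT bZ pos Zv vN v0.
have : (b%:Z %| ev (corep c1) Z)%Z.
  apply/hb; exists (hcl [set: X] set0 Z); rewrite pairing_hcl //.
  exact: closed_cycle.
move=> /dvdzP [q e]; have b0 : 0 < b%:Z by apply: leq_trans b2.
have q1 : 1 <= q by rewrite -gtz0_ge1 -(pmulr_lgt0 _ b0) -e.
have be : b%:Z <= ev (corep c1) Z by rewrite e ler_peMl // ltW.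
(* Here c_1(Z) >= 2 would give 2 - i >= 4, impossible for a natural number i. *)
by move: Zc be b2; clear; lia.
Qed.
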